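(* Let $1<\alpha<2$. There exists a constant $C_3>0$ depending on $\alpha$ such that the following holds. Let $\mathcal{X}=\{x_1,\dots,x_N\}\subset(0,1)$ be a set of pairwise distinct points with fill distance $h=\sup_{x\in(0,1)}\min_{1\le j\le N}|x-x_j|$. Let $f:[0,1]\to\mathbb{R}$ be continuously differentiable on $[0,1]$ with $f(0)=f(1)=0$ and $f'(0)=0$. Let $s(x)=\sum_{j=1}^N c_j\,G(x,x_j)$ be the interpolant of $f$ on $\mathcal{X}$ by the left Riemann-Liouville Green's kernel $G$ of order $\alpha$, i.e. the coefficients $c_1,\dots,c_N\in\mathbb{R}$ are such that $s(x_i)=f(x_i)$ for $i=1,\dots,N$. Then $$\|f-s\|_{L^2([0,1])}\le C_3\,h^{\alpha}\,\|{}_0D_x^{\alpha}f\|_{L^2([0,1])}.$$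
   Context: The left Riemann-Liouville Green's kernel of order $\alpha$ on $[0,1]\times[0,1]$ is $$G(x,z)=\frac{1}{\Gamma(\alpha)}\begin{cases}(x(1-z))^{\alpha-1}-(x-z)^{\alpha-1}, & 0\le z\le x\le 1,\\ x^{\alpha-1}(1-z)^{\alpha-1}, & 0\le x\le z\le 1.\end{cases}$$ It is the Green's function of the boundary value problem $-{}_0D_x^{\alpha}u=f$ in $(0,1)$, $u(0)=u(1)=0$. For $1<\alpha<2$, the left-sided Riemann-Liouville fractional derivative of order $\alpha$ based at $0$ is $${}_0D_x^{\alpha}f(x)=\frac{1}{\Gamma(2-\alpha)}\frac{d^2}{dx^2}\int_0^x (x-\tau)^{1-\alpha}f(\tau)\,d\tau,$$ where the derivatives are understood in the weak (distributional) sense on $(0,1)$. The right-hand side of the estimate is understood as $+\infty$ if ${}_0D_x^{\alpha}f\notin L^2([0,1])$. The coefficient vector $\mathbf{c}=(c_1,\dots,c_N)^T$ of the interpolant solves the linear system $\mathrm{G}\mathbf{c}=\mathbf{y}$ with $\mathrm{G}_{ij}=G(x_i,x_j)$ and $\mathbf{y}=(f(x_1),\dots,f(x_N))^T$. *)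

(* Defs.v *)
From HB Require Import structures.
From mathcomp Require Import all_boot all_order all_algebra.
From mathcomp Require Import all_classical all_reals all_analysis.
Import Order.TTheory GRing.Theory Num.Theory.
Import numFieldNormedType.Exports.

Set Implicit Arguments.
Unset Strict Implicit.
Unset Printing Implicit Defensive.

Local Open Scope classical_set_scope.
Local Open Scope ring_scope.

(* Functions on [0, 1] are total functions R -> R; no definition below, used
   with nodes in (0, 1), depends on their values outside [0, 1]. *)

(* The integral converges for a > 0. *)
Definition Gamma (R : realType) (a : R) : R :=
  \int[lebesgue_measure]_(t in `]0, +oo[) (t `^ (a - 1) * expR (- t)).

Definition RL_Green (R : realType) (alpha x z : R) : R :=
  (Gamma alpha)^-1 *
  (if z <= x then (x * (1 - z)) `^ (alpha - 1) - (x - z) `^ (alpha - 1)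
   else x `^ (alpha - 1) * (1 - z) `^ (alpha - 1)).

Definition interpolant (R : realType) (alpha : R) (N : nat)
    (X c : 'I_N -> R) (x : R) : R :=
  \sum_(j < N) c j * RL_Green alpha x (X j).

(* For N > 0 the inner infimum ranges over a finite nonempty set, hence is a
   minimum. *)
Definition fill_distance (R : realType) (N : nat) (X : 'I_N -> R) : R :=
  sup [set inf [set `|x - X j| | j in [set: 'I_N]] | x in `]0, 1[].

(* f is C^1 on [0, 1] with derivative f'; difference quotients are taken within
   [0, 1], so that the derivatives at 0 and 1 are one-sided. *)
Definition C1_with_derivative (R : realType) (f f' : R -> R) : Prop :=
  (forall x : R, x \in `[0, 1] ->
     (f y - f x) / (y - x) @[y --> within `[0, 1] x^'] --> f' x) /\
  {within `[0, 1], continuous f'}.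

Definition test_function (R : realType) (phi : R -> R) : Prop :=
  (forall (n : nat) (x : R), derivable (derive1n n phi) x 1) /\
  (exists K : set R, [/\ compact K, K `<=` `]0, 1[ &
     forall x, ~ K x -> phi x = 0]).

(* The integrand is 0 at tau = x, since 0 `^ a = 0 for a != 0. *)
Definition RL_integral (R : realType) (alpha : R) (f : R -> R) (x : R) : R :=
  (Gamma (2 - alpha))^-1 *
  \int[lebesgue_measure]_(tau in `[0, x]) ((x - tau) `^ (1 - alpha) * f tau).

(* The left Riemann-Liouville derivative of f, i.e. the second distributional
   derivative of RL_integral alpha f on (0, 1), is the function g. *)
Definition is_RL_derivative (R : realType) (alpha : R) (f g : R -> R) : Prop :=
  locally_integrable `]0, 1[ g /\
  forall phi : R -> R, test_function phi ->
    \int[lebesgue_measure]_(x in `]0, 1[) (RL_integral alpha f x * derive1n 2 phi x)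
    = \int[lebesgue_measure]_(x in `]0, 1[) (g x * phi x).

(* Extended-real valued: +oo when a measurable u is not in L^2. *)
Definition L2norm01 (R : realType) (u : R -> R) : \bar R :=
  Lnorm lebesgue_measure 2%:E (EFin \o (u \_ `[0, 1])).

(* Main.v *)
(* With b = alpha - 1, the energy method applied to the error e = f - s, its
   density d = e' and h(q) = int (q - p)_+^(-b) d(p) dp.
   By Fubini, the double integral over t < x of (e(x) - e(t))^2 (x - t)^(-alpha-1)
   equals 2 / (b (b + 1)) times int d h.
   The weak equation and the du Bois-Reymond lemma give
   h_f = const + Gamma(2 - alpha) int_0^q g for the part of h coming from f, while
   on (0, 1) the part coming from s is a step function with jumps at 0 and at the
   nodes, because the convolution of x_+^(-b) with x_+^(b-1) is constant on x > 0.
   As e vanishes at 0, at 1 and at the nodes, int d h = - Gamma(2 - alpha) int g e.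
   A fractional Hardy inequality on each gap between consecutive nodes bounds
   int e^2 by a multiple of h_X^alpha times the double integral, h_X being the
   fill distance, and Hoelder's inequality concludes. *)
Require Import Defs.
From HB Require Import structures.
From mathcomp Require Import all_boot all_order all_algebra.
From mathcomp Require Import all_classical all_reals all_analysis.
From mathcomp Require Import measurable_realfun ring lra.
Import Order.TTheory GRing.Theory Num.Theory.
Import numFieldNormedType.Exports.
Set Implicit Arguments.
Unset Strict Implicit.
Unset Printing Implicit Defensive.
Local Open Scope classical_set_scope.
Local Open Scope ring_scope.

(** The Green's kernel is not symmetric, so no reproducing kernel Hilbert space is at hand. What
    saves the energy method is that the quadratic form int d h sees only the symmetric part |q -
    p|^(-b) / 2 of the kernel (q - p)_+^(-b), and that part is a positive superposition of products
    of indicators of intervals (t, x) taken at p and at q; each of them contributes a square (e(x) -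
    e(t))^2. The energy has order alpha / 2 in e, while its value - Gamma(2 - alpha) int g e is
    linear in e. Thus int e^2 is at most a constant times h_X^alpha times the product of the L^2
    norms of g and e; one norm of e cancels, and the full power alpha results without a duality
    argument. The obstacle is regularity. The density of s behaves like (x - z)^(b-1) to the right
    of z and is not square integrable when b <= 1/2, so d is only known to be integrable and e to be
    b-Hölder. The exchange of integrals behind the energy identity therefore rests on a bound,
    uniform in q, for int (q - p)_+^(-b) |d(p)| dp, and the absorption in the Hardy inequality on
    the Hölder bound of e. *)

(** * Lebesgue measure under reflections, translations and dilations *)

Section affine_change_of_variable.
Context {R : realType}.
Local Notation mu := (@lebesgue_measure R).
Local Open Scope ereal_scope.

Lemma ge0_integral_reflect (f : R -> \bar R) (c : R) :
  measurable_fun [set: R] f -> (forall x, 0 <= f x) ->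
  \int[mu]_x f (c - x)%R = \int[mu]_x f x.
Proof.
move=> mf f0.
have mphi : measurable_fun [set: R] (fun x : R => (c - x)%R : measurableTypeR R).
  by apply: measurable_funB.
transitivity (\int[pushforward mu (fun x : R => (c - x)%R : measurableTypeR R)]_x f x); last first.
  apply: eq_measure_integral => //= A mA _.
  apply/esym/lebesgue_measure_unique => //= _ [[a b]] _ <-.
  (* Uniqueness is tested on the intervals []a, b]], whose reflections are closed on the left
     instead, with the same length. *)
  rewrite /pushforward/= [X in _ = mu X](_ : _ = `[(c - b)%R, (c - a)%R[%classic).
    rewrite !lebesgue_measure_itv/= !lte_fin ltrD2l ltrN2.
    by case: ifP => // _; congr EFin; ring.
  apply/seteqP; split => x /=; rewrite !in_itv/= => /andP[h1 h2]; apply/andP; split; lra.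
by rewrite ge0_integral_pushforward.
Qed.

(** A translation is the composition of two reflections. *)
Lemma ge0_integral_shift (f : R -> \bar R) (c : R) :
  measurable_fun [set: R] f -> (forall x, 0 <= f x) ->
  \int[mu]_x f (x - c)%R = \int[mu]_x f x.
Proof.
move=> mf f0.
rewrite -(@ge0_integral_reflect f (- c))//.
rewrite -(@ge0_integral_reflect (fun x => f (- c - x)%R) 0)//.
  by apply: eq_integral => x _; congr f; ring.
apply: measurableT_comp => //; exact: measurable_funB.
Qed.

(** The image of [mu] under x -> k x is mu / k, so k times this image is [mu] again. *)
Lemma ge0_integral_dilate (f : R -> \bar R) (k : R) : (0 < k)%R ->
  measurable_fun [set: R] f -> (forall x, 0 <= f x) ->
  \int[mu]_x (k%:E * f (k * x)%R) = \int[mu]_x f x.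
Proof.
move=> k0 mf f0.
have mphi : measurable_fun [set: R] (fun x : R => (k * x)%R : measurableTypeR R).
  exact: mulrl_measurable.
unshelve refine (@etrans _ _ (\int[mscale (NngNum (ltW k0)) (pushforward mu
    (fun x : R => (k * x)%R : measurableTypeR R))]_x f x) _ _ _); [exact: mphi| |].
  rewrite ge0_integral_mscale//= ge0_integral_pushforward//=.
  rewrite ge0_integralZl//; last by rewrite lee_fin ltW.
  exact: measurableT_comp.
apply: eq_measure_integral => //= A mA _.
apply/esym/lebesgue_measure_unique => //= _ [[a b]] _ <-.
rewrite /mscale/= /pushforward/= [X in _ = (_ * mu X)](_ : _ = `](a / k)%R, (b / k)%R]%classic).
  rewrite !lebesgue_measure_itv/= !lte_fin ltr_pM2r ?invr_gt0//.
  case: ifP => // _; last by rewrite mule0.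
  by rewrite -!EFinD -EFinM; congr EFin; field; rewrite gt_eqF.
by apply/seteqP; split => x /=; rewrite !in_itv/= ltr_pdivrMr// ler_pdivlMr// [(x * k)%R]mulrC.
Qed.

End affine_change_of_variable.

(** * Integrals of powers and of truncated powers *)

Section truncated_power.
Context {R : realType}.
Local Notation mu := (@lebesgue_measure R).

Lemma derivable_powR_itv (a u v : R) : 0 < u -> u < v ->
  derivable_oo_LRcontinuous (fun x : R => x `^ a) u v.
Proof.
move=> u0 uv.
have dF x : 0 < x -> derivable (fun x : R => x `^ a) x 1.
  by move=> x0; apply: derivable_powR; rewrite in_itv/= andbT.
have cF x : 0 < x -> {for x, continuous (fun x : R => x `^ a)}.
  by move=> x0; apply/differentiable_continuous/derivable1_diffP/dF.
split.
- by move=> x /[!in_itv]/= /andP[ux _]; apply: dF; exact: lt_trans ux.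
- by apply: cvg_at_right_filter; exact: cF.
- by apply: cvg_at_left_filter; apply: cF; exact: lt_trans uv.
Qed.

Lemma within_continuous_powR (a u v : R) : 0 < u -> u < v ->
  {within `[u, v], continuous (fun x : R => x `^ a)}.
Proof.
by move=> u0 uv; apply: derivable_oo_LRcontinuous_within; exact: derivable_powR_itv.
Qed.

Lemma integral_powR_itv (a u v : R) : a != 0 -> 0 < u -> u < v ->
  (\int[mu]_(x in `[u, v]) (x `^ (a - 1))%:E = ((v `^ a - u `^ a) / a)%:E)%E.
Proof.
move=> a0 u0 uv.
rewrite (@continuous_FTC2 _ _ (fun x => a^-1 * x `^ a))//.
- by rewrite -EFinB; congr EFin; field.
- exact: within_continuous_powR.
- have [d1 d2 d3] := derivable_powR_itv a u0 uv; split.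
  + by move=> x xuv; apply: derivableM => //; exact: d1.
  + by apply: cvgMr.
  + by apply: cvgMr.
- move=> x xuv; have [d1 _ _] := derivable_powR_itv a u0 uv.
  have x0 : 0 < x by move: xuv; rewrite in_itv/= => /andP[/(lt_trans u0)].
  rewrite derive1E deriveZ; last exact: d1.
  rewrite -derive1E powR_derive1 ?in_itv/= ?x0//.
  by rewrite [LHS]mulrA mulVf// mul1r.
Qed.

Lemma integral_powR0 (a v : R) : 0 < a -> 0 < v ->
  (\int[mu]_(x in `]0%R, v]) (x `^ (a - 1))%:E = (v `^ a / a)%:E)%E.
Proof.
(* The divisor n + 2 keeps the left end strictly below [v] for every n, as the formula on segments
   requires. *)
move=> a0 v0; pose F n := `[v / n.+2%:R, v]%classic.
have vn (n : nat) : 0 < v / n.+2%:R by rewrite divr_gt0.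
have vnv (n : nat) : v / n.+2%:R < v.
  by rewrite ltr_pdivrMr// ltr_pMr// ltr1n.
have mp D : measurable_fun D (fun x : R => (x `^ (a - 1))%:E).
  apply/measurable_funTS/measurable_EFinP; exact: measurable_powR.
have -> : `]0, v]%classic = \bigcup_n F n.
  apply/seteqP; split => [x|x [n _]]; rewrite /F /= !in_itv/=; last first.
    by move=> /andP[h ->]; rewrite andbT (lt_le_trans _ h).
  move=> /andP[x0 xv]; exists (Num.truncn (v / x)) => //=.
  rewrite in_itv/= xv andbT ler_pdivrMr// mulrC -ler_pdivrMr//.
  by apply/ltW/(lt_trans (truncnS_gt _)); rewrite ltr_nat.
apply: (@cvg_unique _ _ (\int[mu]_(x in F n) (x `^ (a - 1))%:E @[n --> \oo])%E) => //.
  apply: ge0_nondecreasing_set_cvg_integral => //.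
  - apply/nondecreasing_seqP => n; rewrite subsetEset /F.
    apply: subset_itvr; rewrite bnd_simp ler_pM2l// lef_pV2 ?posrE// ler_nat//.
  - by move=> n; exact: measurable_itv.
  - by move=> n; exact: mp.
  - by move=> n x _; rewrite lee_fin powR_ge0.
rewrite (_ : (fun n => _) = (fun n => ((v `^ a - (v / n.+2%:R) `^ a) / a)%:E)); last first.
  by apply/funext => n; rewrite /F integral_powR_itv// gt_eqF.
apply: cvg_EFin; first exact: nearW.
rewrite -[X in _ --> X / a]subr0; apply: cvgMl => //; apply: cvgB; first exact: cvg_cst.
have /cvg_at_rightP := powR_cvg0 a0; apply; split => //.
rewrite -[0](mulr0 v); apply: cvgMr.
have := @cvg_harmonic R; rewrite -cvg_shiftS; exact.
Qed.

Lemma powR_cvgy0 (a : R) : a < 0 -> x `^ a @[x --> +oo] --> 0.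
Proof.
move=> a0; apply/cvgrPdist_le => e e0; near=> x.
have xe : e `^ a^-1 <= x by near: x; exact: nbhs_pinfty_ge.
have x0 : 0 < x by rewrite (lt_le_trans _ xe)// powR_gt0.
rewrite sub0r normrN ger0_norm ?powR_ge0// -[a]opprK powRN invf_ple ?posrE ?powR_gt0//.
have -> : e^-1 = (e `^ a^-1) `^ (- a).
  by rewrite -powRrM mulrN mulVf ?lt_eqF// powRN powRr1// ltW.
by rewrite ge0_ler_powR ?nnegrE ?oppr_ge0 ?powR_ge0// ltW.
Unshelve. all: by end_near. Qed.

Lemma integral_powRy (a v : R) : 0 < a -> 0 < v ->
  (\int[mu]_(x in `[v, +oo[) (x `^ (- a - 1))%:E = (v `^ (- a) / a)%:E)%E.
Proof.
move=> a0 v0.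
have pos x : v <= x -> 0 < x by exact: lt_le_trans.
have dp x : v <= x -> derivable (fun x : R => x `^ (- a)) x 1.
  by move=> vx; apply: derivable_powR; rewrite in_itv/= andbT pos.
have cp b x : v <= x -> {for x, continuous (fun x : R => x `^ b)}.
  move=> vx; apply/differentiable_continuous/derivable1_diffP/derivable_powR.
  by rewrite in_itv/= andbT pos.
rewrite (@ge0_continuous_FTC2y _ _ (fun x => - a^-1 * x `^ (- a)) _ 0).
- by rewrite -EFinB; congr EFin; rewrite sub0r mulNr opprK mulrC.
- by move=> x _; exact: powR_ge0.
- apply/continuous_within_itvcyP; split.
    by move=> x; rewrite in_itv/= andbT => /ltW vx; exact: cp.
  by apply: cvg_at_right_filter; exact: cp.
- by rewrite -[X in _ --> X](mulr0 (- a^-1)); apply: cvgMr; apply: powR_cvgy0; rewrite oppr_lt0.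
- by move=> x /ltW vx; apply: derivableM => //; exact: dp.
- by apply: cvgMr; apply: cvg_at_right_filter; exact: cp.
- move=> x; rewrite in_itv/= andbT => /ltW vx.
  rewrite derive1E deriveZ; last exact: dp.
  rewrite -derive1E powR_derive1 ?in_itv/= ?pos//.
  by rewrite [LHS]mulrA mulrNN mulVf ?gt_eqF// mul1r.
Qed.

(* The truncated power [x_+^a]; [pw 0] is the indicator function of [x > 0]. *)
Definition pw (a x : R) : R := if 0 < x then x `^ a else 0.

Lemma pw_ge0 a x : 0 <= pw a x.
Proof. by rewrite /pw; case: ifP => // _; exact: powR_ge0. Qed.

Lemma pwE a x : 0 < x -> pw a x = x `^ a.
Proof. by rewrite /pw => ->. Qed.

Lemma pw_le0 a x : x <= 0 -> pw a x = 0.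
Proof. by rewrite /pw leNgt => /negbTE ->. Qed.

Lemma pw0E x : pw 0 x = (0 < x)%R%:R.
Proof. by rewrite /pw powRr0; case: ifP. Qed.

Lemma measurable_pw a : measurable_fun [set: R] (pw a).
Proof.
apply: measurable_fun_ifT => //; exact: measurable_fun_ltr.
Qed.

Lemma pw_dilate a k x : 0 < k -> pw a (k * x) = k `^ a * pw a x.
Proof.
move=> k0; rewrite /pw pmulr_rgt0//; case: ifP => [x0|]; last by rewrite mulr0.
by rewrite powRM ?ltW.
Qed.

Lemma pwM a b x : pw a x * pw b x = pw (a + b) x.
Proof.
rewrite /pw; case: ifP => x0; last by rewrite mulr0.
by rewrite powRD// (gt_eqF x0) implybT.
Qed.

(** Thanks to the truncation both sides vanish when v <= z, so no order between [z] and [v] is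
    assumed. *)
Lemma integral_pw_left (a z v : R) : 0 < a ->
  (\int[mu]_x (pw (a - 1) (x - z) * pw 0 (v - x))%:E = (pw a (v - z) / a)%:E)%E.
Proof.
move=> a0.
pose F x := (pw (a - 1) x * pw 0 (v - z - x))%:E.
transitivity (\int[mu]_x F (x - z)%R)%E.
  by apply: eq_integral => x _; congr (_ * pw 0 _)%:E; ring.
rewrite ge0_integral_shift /F {F}; last 2 first.
- apply/measurable_EFinP; apply: measurable_funM; first exact: measurable_pw.
  by apply: measurableT_comp; [exact: measurable_pw|exact: measurable_funB].
- by move=> x; rewrite lee_fin mulr_ge0// pw_ge0.
move: (v - z) => w; have [w0|w0] := ltP 0 w; last first.
  rewrite (pw_le0 _ w0) mul0r integral0_eq// => x _; congr EFin.
  have [x0|x0] := ltP 0 x; first by rewrite (@pw_le0 _ (w - x)) ?mulr0//; lra.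
  by rewrite pw_le0 ?mul0r.
rewrite (pwE _ w0) -integral_powR0// -integral_itv_bndo_bndc//; last first.
  by apply/measurable_EFinP; apply: measurable_funTS; exact: measurable_powR.
rewrite [RHS]integral_mkcond; apply: eq_integral => x _.
rewrite patchE mem_setE in_itv/= /pw powRr0 subr_gt0.
by case: (0 < x); case: (x < w); rewrite ?(mulr1, mulr0, mul0r).
Qed.

Lemma integral_pw_right (a z v : R) : 0 < a ->
  (\int[mu]_x (pw 0 (x - z) * pw (a - 1) (v - x))%:E = (pw a (v - z) / a)%:E)%E.
Proof.
move=> a0; rewrite -(integral_pw_left z v a0) -(@ge0_integral_reflect _ _ (v + z)).
- by apply: eq_integral => x _; rewrite mulrC; congr (pw _ _ * pw _ _)%:E; ring.
- apply/measurable_EFinP; apply: measurable_funM;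
  (apply: measurableT_comp; [exact: measurable_pw|exact: measurable_funB]).
- by move=> x; rewrite lee_fin mulr_ge0// pw_ge0.
Qed.

(** For q <= z the left side would diverge while the right side is 0, hence the assumption
    [z < q]. *)
Lemma integral_pw_tail (a z q : R) : 0 < a -> z < q ->
  (\int[mu]_x (pw (- a - 1) (x - z) * pw 0 (x - q))%:E = (pw (- a) (q - z) / a)%:E)%E.
Proof.
move=> a0 zq.
pose F x := (pw (- a - 1) x * pw 0 (x - (q - z)))%:E.
transitivity (\int[mu]_x F (x - z)%R)%E.
  by apply: eq_integral => x _; congr (_ * pw 0 _)%:E; ring.
rewrite ge0_integral_shift /F {F}; last 2 first.
- apply/measurable_EFinP; apply: measurable_funM; first exact: measurable_pw.
  by apply: measurableT_comp; [exact: measurable_pw|exact: measurable_funB].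
- by move=> x; rewrite lee_fin mulr_ge0// pw_ge0.
have : 0 < q - z by lra.
move: (q - z) => w w0.
rewrite (pwE _ w0) -integral_powRy// -integral_itv_obnd_cbnd//; last first.
  by apply/measurable_EFinP; apply: measurable_funTS; exact: measurable_powR.
rewrite [RHS]integral_mkcond; apply: eq_integral => x _.
rewrite patchE mem_setE in_itv/= andbT /pw powRr0 subr_gt0.
by case: (ltP w x) => [/(lt_trans w0)->|_]; rewrite ?mulr1 ?mulr0.
Qed.

Lemma integral_pw_tail_left (a p z : R) : 0 < a -> p < z ->
  (\int[mu]_x (pw (- a - 1) (z - x) * pw 0 (p - x))%:E = (pw (- a) (z - p) / a)%:E)%E.
Proof.
move=> a0 pz; have := @integral_pw_tail a p z a0 pz.
rewrite -(@ge0_integral_reflect _ _ (z + p)); last 2 first.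
- apply/measurable_EFinP; apply: measurable_funM;
  (apply: measurableT_comp; [exact: measurable_pw|exact: measurable_funB]).
- by move=> x; rewrite lee_fin mulr_ge0// pw_ge0.
move=> <-; apply: eq_integral => x _; congr (pw _ _ * pw _ _)%:E; ring.
Qed.

End truncated_power.

(** * The energy identity *)

Section energy.
Context {R : realType}.
Local Notation mu := (@lebesgue_measure R).
Local Notation mu2 := (mu \x mu)%E.

Lemma measurable_pw_comp d (T : measurableType d) (a : R) (f : T -> R) :
  measurable_fun [set: T] f -> measurable_fun [set: T] (fun x => pw a (f x)).
Proof. by move=> mf; apply: measurableT_comp => //; exact: measurable_pw. Qed.

Lemma pw0_le1 (x : R) : pw 0 x <= 1.
Proof. by rewrite pw0E; case: (0 < x). Qed.

(** Integrating over x > q yields the factor 1 / (b + 1), then over t < p the factor 1 / b. The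
    indicator of p < q makes both sides vanish when q <= p. *)
Lemma integral_pw_tail_prod (b p q : R) : 0 < b ->
  (\int[mu2]_z (pw (- b - 2) (z.2 - z.1) *
    (pw 0 (p - z.1) * pw 0 (q - p) * pw 0 (z.2 - q)))%:E
   = ((b * (b + 1))^-1 * pw (- b) (q - p))%:E)%E.
Proof.
move=> b0.
rewrite fubini_tonelli1/=; last 2 first.
- apply/measurable_EFinP; apply: measurable_funM.
    by apply: measurable_pw_comp; exact: measurable_funB.
  apply: measurable_funM; last by apply: measurable_pw_comp; exact: measurable_funB.
  by apply: measurable_funM => //; apply: measurable_pw_comp; exact: measurable_funB.
- by move=> z; rewrite lee_fin !mulr_ge0// pw_ge0.
have [pq|qp] := ltP p q; last first.
  rewrite [pw (- b) _]pw_le0 ?subr_le0// mulr0; apply: integral0_eq => t _.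
  apply: integral0_eq => x _ /=; congr EFin.
  by rewrite [pw 0 (q - p)]pw_le0 ?subr_le0// mulr0 mul0r mulr0.
transitivity (\int[mu]_t (((b + 1)^-1)%:E * (pw (- b - 1) (q - t) * pw 0 (p - t))%:E))%E.
  apply: eq_integral => t _; rewrite /fubini_F/=.
  transitivity (\int[mu]_x ((pw 0 (p - t))%:E * (pw (- (b + 1) - 1) (x - t) * pw 0 (x - q))%:E))%E.
    apply: eq_integral => x _; rewrite -EFinM; congr EFin.
    rewrite [pw 0 (q - p)]pwE ?subr_gt0// powRr0.
    have -> : - (b + 1) - 1 = - b - 2 by ring.
    ring.
  rewrite ge0_integralZl//; last 3 first.
  - apply/measurable_EFinP; apply: measurable_funM;
    by apply: measurable_pw_comp; exact: measurable_funB.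
  - by move=> x _; rewrite lee_fin mulr_ge0// pw_ge0.
  - by rewrite lee_fin pw_ge0.
  have [tp|pt] := ltP t p; last first.
    by rewrite (@pw_le0 _ 0 (p - t)) ?subr_le0// mulr0 mul0e mule0.
  rewrite integral_pw_tail; last 2 first.
  - by rewrite addr_gt0.
  - exact: lt_trans pq.
  rewrite -!EFinM; congr EFin.
  have -> : - (b + 1) = - b - 1 by ring.
  ring.
rewrite ge0_integralZl//; last 3 first.
- apply/measurable_EFinP; apply: measurable_funM;
  by apply: measurable_pw_comp; exact: measurable_funB.
- by move=> x _; rewrite lee_fin mulr_ge0// pw_ge0.
- by rewrite lee_fin invr_ge0 addr_ge0// ltW.
rewrite integral_pw_tail_left// -EFinM; congr EFin; field.
by rewrite !gt_eqF// addr_gt0.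
Qed.
Lemma integrable_prod (u v : R -> R) :
  mu.-integrable setT (EFin \o u) -> mu.-integrable setT (EFin \o v) ->
  mu2.-integrable setT (fun z => (u z.1 * v z.2)%:E).
Proof.
move=> iu iv.
have mu_ : measurable_fun setT u by apply/measurable_EFinP; exact: measurable_int iu.
have mv : measurable_fun setT v by apply/measurable_EFinP; exact: measurable_int iv.
apply/integrable12ltyP.
  apply/measurable_EFinP; apply: measurable_funM; exact: measurableT_comp.
have v0 : (\int[mu]_y `|(v y)%:E| < +oo)%E by case/integrableP : iv.
have u0 : (\int[mu]_y `|(u y)%:E| < +oo)%E by case/integrableP : iu.
under eq_integral => x _.
  under eq_integral do rewrite /= normrM EFinM.
  rewrite ge0_integralZl//; last first.
    by apply/measurable_EFinP; exact: measurableT_comp.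
  over.
rewrite ge0_integralZr//; last 2 first.
  by apply/measurable_EFinP; exact: measurableT_comp.
  by apply: integral_ge0.
by apply: lte_mul_pinfty => //; [exact: integral_ge0|rewrite ge0_fin_numE//; exact: integral_ge0].
Qed.

Lemma integrable_kernel_prod (k : R * R -> R) (u v : R -> R) (M : R) :
  measurable_fun setT k -> (forall z, `|k z| <= M) ->
  mu.-integrable setT (EFin \o u) -> mu.-integrable setT (EFin \o v) ->
  mu2.-integrable setT (fun z => (k z * (u z.1 * v z.2))%:E).
Proof.
move=> mk kM iu iv.
have iuv := integrable_prod iu iv.
have -> : (fun z => (k z * (u z.1 * v z.2))%:E) = ((EFin \o k) \* (fun z => (u z.1 * v z.2)%:E))%E.
  by apply/funext => z /=; rewrite EFinM.
apply: integrableMr => //; exists M; split; first exact: num_real.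
by move=> x Mx z _ /=; rewrite (le_trans (kM z))// ltW.
Qed.

(** The square of the integral is a double integral whose parts over p < q and q < p agree by
    symmetry; the diagonal is negligible. *)
Lemma integral_triangle_prod (u : R -> R) :
  mu.-integrable setT (EFin \o u) ->
  (\int[mu2]_z (pw 0 (z.2 - z.1) * (u z.1 * u z.2))%:E =
   (2^-1 * (\int[mu]_x u x) ^+ 2)%:E)%E.
Proof.
move=> iu.
have mu_ : measurable_fun setT u by apply/measurable_EFinP; exact: measurable_int iu.
have mk : measurable_fun setT (fun z : R * R => pw 0 (z.2 - z.1)).
  by apply: measurable_pw_comp; exact: measurable_funB.
have mk' : measurable_fun setT (fun z : R * R => pw 0 (z.1 - z.2)).
  by apply: measurable_pw_comp; exact: measurable_funB.
have iA : mu2.-integrable setT (fun z => (pw 0 (z.2 - z.1) * (u z.1 * u z.2))%:E).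
  by apply: (@integrable_kernel_prod _ _ _ 1) => // z; rewrite ger0_norm ?pw_ge0// pw0_le1.
have iB : mu2.-integrable setT (fun z => (pw 0 (z.1 - z.2) * (u z.1 * u z.2))%:E).
  by apply: (@integrable_kernel_prod _ _ _ 1) => // z; rewrite ger0_norm ?pw_ge0// pw0_le1.
have AB : (\int[mu2]_z (pw 0 (z.2 - z.1) * (u z.1 * u z.2))%:E =
          \int[mu2]_z (pw 0 (z.1 - z.2) * (u z.1 * u z.2))%:E)%E.
  rewrite -integral12_prod_meas1// -integral21_prod_meas1//=.
  apply: eq_integral => x _; apply: eq_integral => y _ /=.
  by rewrite (mulrC (u x)).
have sAB : (\int[mu2]_z (pw 0 (z.2 - z.1) * (u z.1 * u z.2))%:E +
  \int[mu2]_z (pw 0 (z.1 - z.2) * (u z.1 * u z.2))%:E = ((\int[mu]_x u x) ^+ 2)%:E)%E.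
  rewrite -integralD//.
  rewrite -integral21_prod_meas1/=; last exact: integrableD.
  transitivity (\int[mu]_y ((u y)%:E * \int[mu]_x (u x)%:E))%E.
    apply: eq_integral => y _; rewrite /fubini_G/=.
    rewrite -integralZl//.
    apply: ae_eq_integral => //.
    - by apply/measurable_funTS/emeasurable_funD; apply/measurable_EFinP; apply: measurable_funM;
        try (apply: measurable_pw_comp; exact: measurable_funB); exact: measurable_funM.
    - by apply/measurable_EFinP; exact: measurable_funM.
    exists [set y]; split => //; first exact: lebesgue_measure_set1.
    move=> x /= h; apply: contrapT => /eqP xy; apply: h => _.
    rewrite -EFinD -EFinM; congr EFin; rewrite -mulrDl [RHS]mulrC.
    have -> : pw 0 (y - x) + pw 0 (x - y) = 1.
      rewrite !pw0E !subr_gt0.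
      by move: xy; rewrite neq_lt => /orP[] h; rewrite h (lt_gtF h) ?addr0 ?add0r.
    by rewrite mul1r.
  rewrite (_ : (\int[mu]_x (u x)%:E)%E = (\int[mu]_x u x)%:E); last first.
    by rewrite /Rintegral fineK//; exact: integrable_fin_num.
  rewrite integralZr// (_ : (\int[mu]_x (u x)%:E)%E = (\int[mu]_x u x)%:E)// ?expr2//.
  by rewrite /Rintegral fineK//; exact: integrable_fin_num.
move: sAB; rewrite -AB.
have /fineK <- : (\int[mu2]_z (pw 0 (z.2 - z.1) * (u z.1 * u z.2))%:E)%E \is a fin_num.
  exact: integrable_fin_num.
by rewrite -EFinD => -[]; move: (fine _) => r h; congr EFin; rewrite -h; lra.
Qed.
(** The kernel is unbounded, but its integral against |v| is bounded uniformly in q, and [u] is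
    integrable. *)
Lemma integrable_singular_prod (b C : R) (u v : R -> R) :
  mu.-integrable setT (EFin \o u) -> measurable_fun setT v ->
  (forall q, (\int[mu]_p (pw (- b) (q - p) * `|v p|)%:E <= C%:E)%E) ->
  mu2.-integrable setT (fun z => (pw (- b) (z.2 - z.1) * (v z.1 * u z.2))%:E).
Proof.
move=> iu mv vC.
have mu_ : measurable_fun setT u by apply/measurable_EFinP; exact: measurable_int iu.
apply/integrable21ltyP.
  apply/measurable_EFinP; apply: measurable_funM.
    by apply: measurable_pw_comp; exact: measurable_funB.
  apply: measurable_funM; exact: measurableT_comp.
have u0 : (\int[mu]_y `|(u y)%:E| < +oo)%E by case/integrableP : iu.
have mk (y : R) : measurable_fun setT (fun x : R => pw (- b) (y - x) * `|v x|).
  apply: measurable_funM; last exact: measurableT_comp.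
  by apply: measurable_pw_comp; exact: measurable_funB.
apply: (@le_lt_trans _ _ (\int[mu]_y ((`|C|)%:E * `|(u y)%:E|))%E); last first.
  rewrite ge0_integralZl//; last by apply/measurable_EFinP; exact: measurableT_comp.
  apply: lte_mul_pinfty => //.
apply: ge0_le_integral => //.
- by move=> y _; apply: integral_ge0.
- apply: (@measurable_fun_fubini_tonelli_G _ _ _ _ _ mu (fun z : R * R => `|(pw (- b) (z.2 - z.1) * (v z.1 * u z.2))%:E|)%E) => //.
  apply: measurableT_comp => //; apply/measurable_EFinP; apply: measurable_funM.
    by apply: measurable_pw_comp; exact: measurable_funB.
  apply: measurable_funM; exact: measurableT_comp.
- apply: emeasurable_funM => //; apply: measurableT_comp => //; exact/measurable_EFinP.
- move=> y _ /=.
  under eq_integral do rewrite normrM (normrM (v _)) (ger0_norm (pw_ge0 _ _)) mulrA EFinM.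
  rewrite ge0_integralZr//; last 2 first.
  + by apply/measurable_EFinP; exact: mk.
  + by move=> x _; rewrite lee_fin mulr_ge0// pw_ge0.
  rewrite lee_wpmul2r//; apply: (le_trans (vC y)).
  by rewrite lee_fin ler_norm.
Qed.

Lemma sigma_finite_mu2 : sigma_finite setT (mu \x mu)%E.
Proof.
pose F n := `[- n%:R, n%:R]%classic : set R.
exists (fun n => F n `*` F n).
  apply/esym; rewrite -subTset => -[x y] _; exists (Num.truncn (Num.max `|x| `|y|)).+1 => //=.
  have /ltW := truncnS_gt (Num.max `|x| `|y|).
  by rewrite ge_max !ler_norml /F /= !in_itv/= => /andP[].
move=> n; split; first by apply: measurableX; exact: measurable_itv.
have mF : measurable (F n) by exact: measurable_itv.
rewrite product_measure1E//.
have Fy : (mu (F n) < +oo)%E by rewrite /F lebesgue_measure_itv/=; case: ifP; rewrite ?ltry.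
by apply: lte_mul_pinfty => //; rewrite ge0_fin_numE.
Qed.
(** In the energy identity Fubini exchanges the pair (t, x) with the pair (p, q), which requires a
    sigma-finite measure on the plane. *)
Definition lebesgue_measure2 : {sigma_finite_measure set (measurableTypeR R * measurableTypeR R)%type -> \bar R} :=
  HB.pack (product_measure1 mu mu) (Measure_isSigmaFinite.Build _ _ _ (mu \x mu)%E sigma_finite_mu2).

(* Expand the square into a double integral over [(p, q)]; the integral of
   [(z.2 - z.1)^(-b-2)] over the intervals containing [p] and [q] is a multiple of
   [|q - p|^(-b)]. *)
Lemma energy_identity (b C : R) (d : R -> R) : 0 < b ->
  mu.-integrable setT (EFin \o d) ->
  (forall q, (\int[mu]_p (pw (- b) (q - p) * `|d p|)%:E <= C%:E)%E) ->
  (\int[mu2]_z (pw (- b - 2) (z.2 - z.1) *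
     (\int[mu]_p (pw 0 (p - z.1) * pw 0 (z.2 - p) * d p)) ^+ 2)%:E
   = (2 / (b * (b + 1)) *
      \int[mu]_q (d q * \int[mu]_p (pw (- b) (q - p) * d p)))%:E)%E.
Proof.
move=> b0 id dC.
have md : measurable_fun setT d by apply/measurable_EFinP; exact: measurable_int id.
(* With z = (t, x) and w = (p, q), the indicators select t < p < q < x, which accounts for half of
   the square of the integral of [d] over (t, x). *)
pose H (z w : R * R) := pw (- b - 2) (z.2 - z.1) *
  (pw 0 (w.1 - z.1) * pw 0 (w.2 - w.1) * pw 0 (z.2 - w.2)) * (d w.1 * d w.2).
have mH : measurable_fun setT (fun u : (R * R) * (R * R) => (H u.1 u.2)%:E).
  apply/measurable_EFinP; apply: measurable_funM; last first.
    apply: measurable_funM; apply: measurableT_comp => //;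
    exact: measurableT_comp.
  have m11 : measurable_fun setT (fun u : (R * R) * (R * R) => u.1.1) by exact: measurableT_comp.
  have m12 : measurable_fun setT (fun u : (R * R) * (R * R) => u.1.2) by exact: measurableT_comp.
  have m21 : measurable_fun setT (fun u : (R * R) * (R * R) => u.2.1) by exact: measurableT_comp.
  have m22 : measurable_fun setT (fun u : (R * R) * (R * R) => u.2.2) by exact: measurableT_comp.
  apply: measurable_funM; first by apply: measurable_pw_comp; exact: measurable_funB.
  apply: measurable_funM; last by apply: measurable_pw_comp; exact: measurable_funB.
  by apply: measurable_funM; apply: measurable_pw_comp; exact: measurable_funB.
pose K := (b * (b + 1))^-1.
have K0 : 0 <= K by rewrite invr_ge0 mulr_ge0 ?addr_ge0// ltW.
have isp := integrable_singular_prod id md dC.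
pose m (w z : R * R) := pw (- b - 2) (z.2 - z.1) *
  (pw 0 (w.1 - z.1) * pw 0 (w.2 - w.1) * pw 0 (z.2 - w.2)).
have m0 w z : 0 <= m w z by rewrite !mulr_ge0// pw_ge0.
have mm w : measurable_fun setT (m w).
  apply: measurable_funM; first by apply: measurable_pw_comp; exact: measurable_funB.
  apply: measurable_funM; last by apply: measurable_pw_comp; exact: measurable_funB.
  by apply: measurable_funM; apply: measurable_pw_comp => //; exact: measurable_funB.
have intm w : (\int[mu2]_z (m w z)%:E = (K * pw (- b) (w.2 - w.1))%:E)%E.
  exact: integral_pw_tail_prod.
(* By Tonelli: the integral of |H| over z is a multiple of the singular kernel covered by [isp]. *)
have iH : (lebesgue_measure2 \x lebesgue_measure2)%E.-integrable setT (fun u => (H u.1 u.2)%:E).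
  apply/(integrable21ltyP lebesgue_measure2 lebesgue_measure2 mH).
  rewrite [ltLHS](_ : _ = \int[mu2]_w (K%:E * `|(pw (- b) (w.2 - w.1) * (d w.1 * d w.2))%:E|))%E; last first.
    apply: eq_integral => w _ /=.
    transitivity (\int[mu2]_z ((m w z)%:E * (`|d w.1 * d w.2|)%:E))%E.
      by apply: eq_integral => z _; rewrite /H normrM -/(m w z) (ger0_norm (m0 _ _)).
    rewrite ge0_integralZr//; last 2 first.
      by apply/measurable_EFinP; exact: mm.
      by move=> z _; rewrite lee_fin.
    by rewrite intm (normrM (pw _ _)) (ger0_norm (pw_ge0 _ _)) -!EFinM mulrA.
  rewrite ge0_integralZl//.
    by apply: lte_mul_pinfty => //; case/integrableP : isp.
  by case/integrableP : isp => h _; exact: measurableT_comp.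
pose E z := (pw (- b - 2) (z.2 - z.1) *
     (\int[mu]_p (pw 0 (p - z.1) * pw 0 (z.2 - p) * d p)) ^+ 2).
have FE z : fubini_F lebesgue_measure2 (fun u => (H u.1 u.2)%:E) z = (2^-1 * E z)%:E.
  case: z => t x; rewrite /fubini_F /E/=.
  pose u p := pw 0 (p - t) * pw 0 (x - p) * d p.
  have mpu : measurable_fun setT (fun p : R => pw 0 (p - t) * pw 0 (x - p)).
    by apply: measurable_funM; apply: measurable_pw_comp; exact: measurable_funB.
  have iu : mu.-integrable setT (EFin \o u).
    have -> : EFin \o u = ((EFin \o (fun p => pw 0 (p - t) * pw 0 (x - p))%R) \* (EFin \o d))%E.
      by apply/funext => p /=; rewrite EFinM.
    apply: integrableMr => //; exists 1; split; first exact: num_real.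
    move=> y y1 p _ /=; rewrite ger0_norm ?mulr_ge0 ?pw_ge0// (le_trans _ (ltW y1))//.
    by rewrite mulr_ile1 ?pw_ge0 ?pw0_le1.
  transitivity (\int[mu2]_w ((pw (- b - 2) (x - t))%:E * (pw 0 (w.2 - w.1) * (u w.1 * u w.2))%:E))%E.
    apply: eq_integral => -[p q] _ /=; rewrite /H/= -EFinM; congr EFin.
    rewrite /u !pw0E !subr_gt0.
    case: (ltP p q) => pq; last by rewrite !(mulr0, mul0r).
    case: (ltP t p) => tp; last by rewrite !(mulr0, mul0r).
    case: (ltP q x) => qx; last by rewrite !(mulr0, mul0r).
    by rewrite (lt_trans tp pq) (lt_trans pq qx) !(mulr1, mul1r).
  have mk : measurable_fun setT (fun z : R * R => pw 0 (z.2 - z.1)).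
    by apply: measurable_pw_comp; exact: measurable_funB.
  rewrite integralZl//; last first.
    by apply: (@integrable_kernel_prod _ _ _ 1) => // z; rewrite ger0_norm ?pw_ge0// pw0_le1.
  by rewrite integral_triangle_prod// -!EFinM; congr EFin; rewrite mulrCA.
(* [E] contains an integral depending on parameters; its measurability is read off from that of the
   partial integral, which equals E / 2. *)
have mE : measurable_fun setT (fun z => (E z)%:E).
  have := measurable_fubini_F iH.
  move=> /(@emeasurable_funM _ _ _ _ (cst 2%:E) _ (measurable_cst _)).
  apply: eq_measurable_fun => z _ /=.
  rewrite [fubini_F _ _ _](FE z) -EFinM mulrA divff ?mul1r//.
have := Fubini iH => /=.
rewrite [X in X = _ -> _](_ : _ = \int[mu2]_z (2^-1%:E * (E z)%:E))%E; last first.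
  by apply: eq_integral => z _; rewrite -EFinM -(FE z).
rewrite [X in _ = X -> _](_ : _ = \int[mu2]_w (K%:E * (pw (- b) (w.2 - w.1) * (d w.1 * d w.2))%:E))%E; last first.
  apply: eq_integral => w _ /=.
  transitivity (\int[mu2]_z ((m w z)%:E * (d w.1 * d w.2)%:E))%E; first exact: eq_integral.
  rewrite integralZr//; last first.
    apply/integrableP; split; first by apply/measurable_EFinP; exact: mm.
    under eq_integral do rewrite gee0_abs ?lee_fin//.
    by rewrite intm ltry.
  by rewrite intm -!EFinM -mulrA.
have E0 z : (0 <= (E z)%:E)%E by rewrite lee_fin mulr_ge0 ?pw_ge0// sqr_ge0.
rewrite ge0_integralZl// integralZl//.
have mk (y : R) : measurable_fun setT (fun x : R => pw (- b) (y - x) * d x).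
  by apply: measurable_funM => //; apply: measurable_pw_comp; exact: measurable_funB.
have ik (y : R) : mu.-integrable setT (fun x : R => (pw (- b) (y - x) * d x)%:E).
  apply/integrableP; split; first by apply/measurable_EFinP; exact: mk.
  apply: le_lt_trans (ltry C); apply: le_trans (dC y).
  apply: ge0_le_integral => //.
  - by do 2 apply: measurableT_comp => //; exact: mk.
  - apply/measurable_EFinP; apply: measurable_funM; last exact: measurableT_comp.
    by apply: measurable_pw_comp; exact: measurable_funB.
  - by move=> x _; rewrite /= lee_fin normrM ger0_norm ?pw_ge0.
pose h q := \int[mu]_p (pw (- b) (q - p) * d p).
have GE (q : R) : fubini_G mu (fun z : R * R => (pw (- b) (z.2 - z.1) * (d z.1 * d z.2))%:E) q
    = (d q * h q)%:E.
  rewrite /fubini_G/= /h /Rintegral EFinM fineK; last first.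
    exact: (integrable_fin_num measurableT (ik q)).
  rewrite -(integralZl measurableT (ik q)).
  by apply: eq_integral => p _; rewrite -EFinM; congr EFin; ring.
rewrite -[X in (K%:E * X)%E]fineK; last exact: integrable_fin_num.
have -> : fine (\int[mu2]_z (pw (- b) (z.2 - z.1) * (d z.1 * d z.2))%:E)%E =
    \int[mu]_q (d q * h q).
  rewrite -(integral21_prod_meas1 isp)/= /Rintegral; congr fine.
  by apply: eq_integral => q _; exact: GE.
move=> /(congr1 (fun u => 2%:E * u)%E).
rewrite muleA -!EFinM divff// mul1e => ->; congr EFin.
by rewrite /Rintegral -/h mulrA.
Qed.
End energy.

(** * A fractional Hardy inequality on one interval *)

Section fractional_hardy.
Context {R : realType}.
Local Notation mu := (@lebesgue_measure R).
Local Notation mu2 := (mu \x mu)%E.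

(* For [c1 > 0] the finiteness of [A] is needed, as the inequality is void at [+oo]. *)
Lemma ge0_absorb (c1 c2 : R) (A Q : \bar R) : c1 < 1 -> 0 <= c2 ->
  (0 <= A)%E -> (A < +oo)%E -> (0 <= Q)%E ->
  (A <= c1%:E * A + c2%:E * Q)%E -> (A <= (c2 / (1 - c1))%:E * Q)%E.
Proof.
move=> c11 c20; case: A => // A A0 _; case: Q => [Q| |//] Q0.
  rewrite -!EFinM -EFinD !lee_fin => h.
  by rewrite mulrAC ler_pdivlMr ?subr_gt0//; lra.
have [->|c2n0] := eqVneq c2 0.
  rewrite !(mul0e, mul0r, adde0) -EFinM !lee_fin => h.
  by rewrite -subr_ge0 in h; rewrite lee_fin in A0; nra.
by move=> _; rewrite gt0_muley ?leey// lte_fin divr_gt0 ?subr_gt0// lt_neqAle eq_sym c2n0.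
Qed.

(* The weight [(x - l)^(-1-b)] of [e(x)^2] is the integral of [(x - l)^(-b-2)] over
   [t] in [(l, x)], and [(x - l)^(-b-2) <= (x - t)^(-b-2)]. Splitting [e(x)] as
   [e(t) + (e(x) - e(t))] under this integral, the [e(t)] part comes back with the
   factor [(1 + b / 2) / (1 + b) < 1] and is absorbed. *)
Lemma fractional_hardy (b M l r : R) (e : R -> R) : 0 < b -> l < r ->
  measurable_fun setT e ->
  (forall x, l < x < r -> `|e x| <= M * (x - l) `^ b) ->
  (\int[mu]_x (pw 0 (x - l) * pw 0 (r - x) * e x ^+ 2)%:E <=
   (2 * (1 + b) * (2 + b) / b ^+ 2 * (r - l) `^ (1 + b))%:E *
   \int[mu2]_z (pw 0 (z.1 - l) * pw 0 (r - z.2) *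
      (pw (- b - 2) (z.2 - z.1) * (e z.2 - e z.1) ^+ 2))%:E)%E.
Proof.
move=> b0 lr me eM.
(* With z = (t, x): the indicator of l < t < x < r times (x - l)^(-b-2). *)
pose w (z : R * R) := pw 0 (z.1 - l) * pw 0 (r - z.2) * pw 0 (z.2 - z.1) * pw (- b - 2) (z.2 - l).
have w0 z : 0 <= w z by rewrite !mulr_ge0// pw_ge0.
have mw : measurable_fun setT w.
  by repeat apply: measurable_funM; apply: measurable_pw_comp; exact: measurable_funB.
have me1 : measurable_fun setT (fun z : R * R => e z.1) by exact: measurableT_comp.
have me2 : measurable_fun setT (fun z : R * R => e z.2) by exact: measurableT_comp.
pose A : \bar R := (\int[mu]_x (pw 0 (r - x) * pw (- (1 + b)) (x - l) * e x ^+ 2)%:E)%E.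
pose Q : \bar R := (\int[mu2]_z (pw 0 (z.1 - l) * pw 0 (r - z.2) *
      (pw (- b - 2) (z.2 - z.1) * (e z.2 - e z.1) ^+ 2))%:E)%E.
have mA : measurable_fun setT (fun x : R => pw 0 (r - x) * pw (- (1 + b)) (x - l) * e x ^+ 2).
  apply: measurable_funM; last exact: measurable_funX.
  by apply: measurable_funM; apply: measurable_pw_comp; exact: measurable_funB.
have A0 : (0 <= A)%E by apply: integral_ge0 => x _; rewrite lee_fin !(sqr_ge0, pw_ge0, mulr_ge0).
(* Since e(x)^2 <= M^2 (x - l)^(2b), the integrand is at most a multiple of the integrable (x -
   l)^(b-1). The bound [M] yields only finiteness, so it is absent from the constant. *)
have Ay : (A < +oo)%E.
  apply: (@le_lt_trans _ _ (\int[mu]_x ((M ^+ 2)%:E * (pw (b - 1) (x - l) * pw 0 (r - x))%:E))%E); last first.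
    rewrite ge0_integralZl//.
    - by rewrite integral_pw_left// -EFinM ltry.
    - by apply/measurable_EFinP; apply: measurable_funM; apply: measurable_pw_comp; exact: measurable_funB.
    - by move=> x _; rewrite lee_fin mulr_ge0// pw_ge0.
    - by rewrite lee_fin sqr_ge0.
  apply: ge0_le_integral => //.
  - by move=> x _; rewrite lee_fin !(sqr_ge0, pw_ge0, mulr_ge0).
  - exact/measurable_EFinP.
  - apply/measurable_EFinP; apply: measurable_funM => //.
    by apply: measurable_funM; apply: measurable_pw_comp; exact: measurable_funB.
  - move=> x _; rewrite -EFinM lee_fin.
    have [lx|xl] := ltP l x; last by rewrite !(@pw_le0 _ _ (x - l)) ?subr_le0// !(mulr0, mul0r).
    have [xr|rx] := ltP x r; last by rewrite !(@pw_le0 _ _ (r - x)) ?subr_le0// !(mulr0, mul0r).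
    rewrite !pwE ?subr_gt0// powRr0 mul1r mulr1.
    have -> : (x - l) `^ (b - 1) = (x - l) `^ (- (1 + b)) * ((x - l) `^ b) ^+ 2.
      rewrite expr2 -!powRD ?(gt_eqF (_ : 0 < x - l)) ?implybT ?subr_gt0//.
      by congr powR; ring.
    rewrite [leRHS]mulrCA ler_wpM2l ?powR_ge0// -exprMn -ler_sqrt ?sqr_ge0//.
    rewrite !sqrtr_sqr (le_trans (eM x _)) ?lx ?xr// ler_norm//.
have I1 : (\int[mu2]_z (w z * e z.2 ^+ 2)%:E = A)%E.
  rewrite fubini_tonelli2//=; last 2 first.
  - by apply/measurable_EFinP; apply: measurable_funM => //; exact: measurable_funX.
  - by move=> z; rewrite lee_fin !(sqr_ge0, w0, mulr_ge0).
  apply: eq_integral => x _; rewrite /fubini_G/= /w/=.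
  transitivity (\int[mu]_t ((pw 0 (t - l) * pw (1 - 1) (x - t))%:E *
     (pw 0 (r - x) * pw (- b - 2) (x - l) * e x ^+ 2)%:E))%E.
    by apply: eq_integral => t _; rewrite -EFinM subrr; congr EFin; ring.
  rewrite ge0_integralZr//; last 3 first.
  - by apply/measurable_EFinP; apply: measurable_funM; apply: measurable_pw_comp; exact: measurable_funB.
  - by move=> t _; rewrite lee_fin mulr_ge0// pw_ge0.
  - by rewrite lee_fin !(sqr_ge0, pw_ge0, mulr_ge0).
  rewrite integral_pw_right// divr1 -EFinM; congr EFin.
  rewrite mulrA; congr (_ * _); rewrite mulrCA pwM; congr (_ * pw _ _); ring.
(* The range t < x < r is enlarged to x > t, where (x - l)^(-b-2) has integral (t - l)^(-1-b) / (1 +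
   b). *)
have I2 : (\int[mu2]_z (w z * e z.1 ^+ 2)%:E <= ((1 + b)^-1)%:E * A)%E.
  rewrite fubini_tonelli1//=; last 2 first.
  - by apply/measurable_EFinP; apply: measurable_funM => //; exact: measurable_funX.
  - by move=> z; rewrite lee_fin !(sqr_ge0, w0, mulr_ge0).
  rewrite -ge0_integralZl//; last 3 first.
  - by apply/measurable_EFinP.
  - by move=> x _; rewrite lee_fin !(sqr_ge0, pw_ge0, mulr_ge0).
  - by rewrite lee_fin invr_ge0 addr_ge0// ltW.
  apply: ge0_le_integral => //.
  - by move=> t _; apply: integral_ge0 => x _; rewrite lee_fin !(sqr_ge0, w0, mulr_ge0).
  - apply: (@measurable_fun_fubini_tonelli_F _ _ _ _ _ mu (fun z : R * R => (w z * e z.1 ^+ 2)%:E)) => //.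
      by apply/measurable_EFinP; apply: measurable_funM => //; exact: measurable_funX.
    by move=> z; rewrite lee_fin !(sqr_ge0, w0, mulr_ge0).
  - by apply: emeasurable_funM => //; exact/measurable_EFinP.
  move=> t _; rewrite /fubini_F/= -EFinM.
  have rhs0 : 0 <= (1 + b)^-1 * (pw 0 (r - t) * pw (- (1 + b)) (t - l) * e t ^+ 2).
    by rewrite mulr_ge0 ?invr_ge0 ?addr_ge0 ?(ltW b0)// !(sqr_ge0, pw_ge0, mulr_ge0).
  have [lt|tl] := ltP l t; last first.
    rewrite integral0_eq ?lee_fin// => x _; congr EFin.
    by rewrite /w/= (@pw_le0 _ 0 (t - l)) ?subr_le0// !mul0r.
  have [tr|rt] := ltP t r; last first.
    rewrite integral0_eq ?lee_fin// => x _; congr EFin.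
    rewrite /w/=; have [xr|rx] := ltP x r.
      by rewrite (@pw_le0 _ 0 (x - t)) ?subr_le0 ?(mulr0, mul0r)// (le_trans (ltW xr)).
    by rewrite (@pw_le0 _ 0 (r - x)) ?subr_le0 ?(mulr0, mul0r).
  apply: (@le_trans _ _ (\int[mu]_x ((pw (- (1 + b) - 1) (x - l) * pw 0 (x - t))%:E * (e t ^+ 2)%:E))%E).
    apply: ge0_le_integral => //.
    - by move=> x _; rewrite lee_fin !(sqr_ge0, w0, mulr_ge0).
    - apply/measurable_EFinP; apply: measurable_funM => //.
      exact: measurableT_comp mw (pair1_measurable _).
    - apply: emeasurable_funM => //; apply/measurable_EFinP; apply: measurable_funM;
      by apply: measurable_pw_comp; exact: measurable_funB.
    - move=> x _; rewrite -EFinM lee_fin ler_wpM2r ?sqr_ge0// /w/=.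
      have -> : - (1 + b) - 1 = - b - 2 by ring.
      rewrite [leRHS]mulrC ler_wpM2r ?pw_ge0// ler_piMl ?pw_ge0//.
      by rewrite mulr_ile1 ?pw_ge0 ?pw0_le1.
  rewrite ge0_integralZr//; last 3 first.
  - by apply/measurable_EFinP; apply: measurable_funM; apply: measurable_pw_comp; exact: measurable_funB.
  - by move=> x _; rewrite lee_fin mulr_ge0// pw_ge0.
  - by rewrite lee_fin sqr_ge0.
  rewrite integral_pw_tail ?addr_gt0// -EFinM lee_fin.
  rewrite [pw 0 (r - t)]pwE ?subr_gt0// powRr0 mul1r.
  by rewrite -[leLHS]mulrA [leRHS]mulrCA.
have mD : measurable_fun setT (fun z : R * R => (e z.2 - e z.1) ^+ 2).
  by apply: measurable_funX; exact: measurable_funB.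
have I3 : (\int[mu2]_z (w z * (e z.2 - e z.1) ^+ 2)%:E <= Q)%E.
  apply: ge0_le_integral => //.
  - by move=> z _; rewrite lee_fin !(sqr_ge0, w0, mulr_ge0).
  - by apply/measurable_EFinP; exact: measurable_funM.
  - apply/measurable_EFinP; apply: measurable_funM.
      by repeat apply: measurable_funM; apply: measurable_pw_comp; exact: measurable_funB.
    by apply: measurable_funM => //; apply: measurable_pw_comp; exact: measurable_funB.
  move=> [t x] _; rewrite lee_fin /w/= mulrA ler_wpM2r ?sqr_ge0//.
  have [lt|tl] := ltP l t; last by rewrite (@pw_le0 _ 0 (t - l)) ?subr_le0// !mul0r.
  have [tx|xt] := ltP t x; last first.
    by rewrite (@pw_le0 _ 0 (x - t)) ?subr_le0// !(mulr0, mul0r) !mulr_ge0 ?pw_ge0.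
  rewrite -mulrA ler_wpM2l ?mulr_ge0 ?pw_ge0//.
  rewrite !pwE ?subr_gt0//; last exact: lt_trans tx.
  rewrite powRr0 mul1r -opprD !powRN lef_pV2 ?posrE ?powR_gt0 ?subr_gt0//; last exact: lt_trans tx.
  apply: ge0_ler_powR; rewrite ?nnegrE ?subr_ge0 ?(ltW tx) ?(ltW (lt_trans lt tx))//.
    by rewrite addr_ge0// ltW.
  by rewrite lerD2l lerN2 ltW.
(* Young's inequality v^2 <= (1 + eps) u^2 + (1 + 1 / eps) (v - u)^2 with eps = b / 2, a choice that
   keeps (1 + eps) / (1 + b) below 1. *)
have I123 : (A <= ((1 + b / 2) / (1 + b))%:E * A + (1 + 2 / b)%:E * Q)%E.
  have b2 : 0 <= 1 + b / 2 by rewrite addr_ge0// divr_ge0// ltW.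
  have b2' : 0 <= 1 + 2 / b by rewrite addr_ge0// divr_ge0// ltW.
  apply: (@le_trans _ _ ((1 + b / 2)%:E * (\int[mu2]_z (w z * e z.1 ^+ 2)%:E)
     + (1 + 2 / b)%:E * (\int[mu2]_z (w z * (e z.2 - e z.1) ^+ 2)%:E))%E); last first.
    apply: leeD; last by rewrite lee_wpmul2l ?lee_fin.
    rewrite [((1 + b / 2) / _)%:E]EFinM -muleA lee_wpmul2l ?lee_fin//.
  have mE1 : measurable_fun setT (fun z : R * R => (w z * e z.1 ^+ 2)%:E).
    by apply/measurable_EFinP; apply: measurable_funM => //; exact: measurable_funX.
  have mE2 : measurable_fun setT (fun z : R * R => (w z * (e z.2 - e z.1) ^+ 2)%:E).
    by apply/measurable_EFinP; apply: measurable_funM.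
  have E10 (z : R * R) : (0 <= (w z * e z.1 ^+ 2)%:E)%E by rewrite lee_fin !(sqr_ge0, w0, mulr_ge0).
  have E20 (z : R * R) : (0 <= (w z * (e z.2 - e z.1) ^+ 2)%:E)%E by rewrite lee_fin !(sqr_ge0, w0, mulr_ge0).
  rewrite -I1 -ge0_integralZl// -ge0_integralZl// -ge0_integralD//; last 4 first.
  - by move=> z _; rewrite mule_ge0// lee_fin.
  - exact: emeasurable_funM.
  - by move=> z _; rewrite mule_ge0// lee_fin.
  - exact: emeasurable_funM.
  apply: ge0_le_integral => //.
  - by move=> z _; rewrite lee_fin !(sqr_ge0, w0, mulr_ge0).
  - by apply/measurable_EFinP; apply: measurable_funM => //; exact: measurable_funX.
  - by apply: emeasurable_funD; exact: emeasurable_funM.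
  move=> z _; rewrite -!EFinM -EFinD lee_fin.
  move: (e z.1) (e z.2) (w z) (w0 z) => u v k k0.
  rewrite [X in X + _]mulrCA [X in _ + X]mulrCA -[leRHS]mulrDr ler_wpM2l//.
  have -> : (1 + b / 2) * u ^+ 2 + (1 + 2 / b) * (v - u) ^+ 2 =
     v ^+ 2 + 2 / b * (v - u - b / 2 * u) ^+ 2 by field; rewrite gt_eqF.
  by rewrite lerDl mulr_ge0 ?sqr_ge0// divr_ge0// ltW.
(* The weight is removed by (x - l)^(-1-b) >= (r - l)^(-1-b) on (l, r). *)
apply: (@le_trans _ _ (((r - l) `^ (1 + b))%:E * A)%E).
  rewrite -ge0_integralZl//; last 3 first.
  - by apply/measurable_EFinP.
  - by move=> x _; rewrite lee_fin !(sqr_ge0, pw_ge0, mulr_ge0).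
  - by rewrite lee_fin powR_ge0.
  apply: ge0_le_integral => //.
  - by move=> x _; rewrite lee_fin !(sqr_ge0, pw_ge0, mulr_ge0).
  - apply/measurable_EFinP; apply: measurable_funM; last exact: measurable_funX.
    by apply: measurable_funM; apply: measurable_pw_comp; exact: measurable_funB.
  - by apply: emeasurable_funM => //; exact/measurable_EFinP.
  move=> x _; rewrite -EFinM lee_fin [leRHS]mulrA ler_wpM2r ?sqr_ge0//.
  have [lx|xl] := ltP l x; last by rewrite !(@pw_le0 _ _ (x - l)) ?subr_le0// !(mulr0, mul0r).
  have [xr|rx] := ltP x r; last by rewrite !(@pw_le0 _ _ (r - x)) ?subr_le0// !(mulr0, mul0r).
  rewrite !pwE ?subr_gt0// !powRr0 !mul1r powRN ler_pdivlMr ?powR_gt0 ?subr_gt0// mul1r.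
  apply: ge0_ler_powR; rewrite ?nnegrE ?subr_ge0 ?(ltW lr) ?(ltW lx)//.
    by rewrite addr_ge0// ltW.
  by rewrite lerD2r ltW.
have Q0 : (0 <= Q)%E.
  by apply: integral_ge0 => z _; rewrite lee_fin !(sqr_ge0, pw_ge0, mulr_ge0).
rewrite mulrC EFinM -muleA lee_wpmul2l ?lee_fin ?powR_ge0//.
have c1 : (1 + b / 2) / (1 + b) < 1.
  by rewrite ltr_pdivrMr ?addr_gt0// mul1r ltrD2l ltr_pdivrMr// ltr_pMr// ltr1n.
have c2 : 0 <= 1 + 2 / b by rewrite addr_ge0// divr_ge0// ltW.
have := ge0_absorb c1 c2 A0 Ay Q0 I123.
congr (_ <= _%:E * _)%E; field.
by rewrite !gt_eqF ?addr_gt0//; apply/andP; split=> //.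
Qed.
End fractional_hardy.

(** * Summation over the gaps between nodes *)

Section gaps.
Context {R : realType}.
Local Notation mu := (@lebesgue_measure R).
Local Notation mu2 := (mu \x mu)%E.

(** The interval (0, c) is cut at the largest node p < c. The integrals of e^2 add up, and the
    triangles 0 < t < x < p and p < t < x < c are disjoint parts of 0 < t < x < c. Each gap uses the
    zero of [e] at its left end, which is 0 or a node. *)
Lemma gaps_hardy (b M delta : R) (N : nat) (X : 'I_N -> R) (e : R -> R) :
  0 < b -> measurable_fun setT e ->
  (forall x y, 0 <= x -> x < y -> y <= 1 -> `|e y - e x| <= M * (y - x) `^ b) ->
  (forall j, 0 < X j) -> e 0 = 0 -> (forall j, e (X j) = 0) ->
  (forall l r, 0 <= l -> l < r -> r <= 1 -> (forall j, ~ (l < X j < r)) -> r - l <= delta) ->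
  (\int[mu]_x (pw 0 x * pw 0 (1 - x) * e x ^+ 2)%:E <=
   (2 * (1 + b) * (2 + b) / b ^+ 2 * delta `^ (1 + b))%:E *
   \int[mu2]_z (pw 0 z.1 * pw 0 (1 - z.2) *
      (pw (- b - 2) (z.2 - z.1) * (e z.2 - e z.1) ^+ 2))%:E)%E.
Proof.
move=> b0 me eM X0 e0 eX gap.
pose K := 2 * (1 + b) * (2 + b) / b ^+ 2 * delta `^ (1 + b).
have K1 : 0 <= 2 * (1 + b) * (2 + b) / b ^+ 2.
  by rewrite divr_ge0 ?sqr_ge0// !mulr_ge0 ?addr_ge0// ltW.
have K0 : 0 <= K by rewrite mulr_ge0 ?powR_ge0.
pose L l r x := pw 0 (x - l) * pw 0 (r - x) * e x ^+ 2.
pose q l r (z : R * R) := pw 0 (z.1 - l) * pw 0 (r - z.2) *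
      (pw (- b - 2) (z.2 - z.1) * (e z.2 - e z.1) ^+ 2).
have L0 l r x : (0 <= (L l r x)%:E)%E by rewrite lee_fin !(sqr_ge0, pw_ge0, mulr_ge0).
have q0 l r z : (0 <= (q l r z)%:E)%E by rewrite lee_fin !(sqr_ge0, pw_ge0, mulr_ge0).
have mL l r : measurable_fun setT (fun x => (L l r x)%:E).
  apply/measurable_EFinP; apply: measurable_funM; last exact: measurable_funX.
  by apply: measurable_funM; apply: measurable_pw_comp; exact: measurable_funB.
have mq l r : measurable_fun setT (fun z => (q l r z)%:E).
  apply/measurable_EFinP; apply: measurable_funM.
    by apply: measurable_funM; apply: measurable_pw_comp; exact: measurable_funB.
  apply: measurable_funM; first by apply: measurable_pw_comp; exact: measurable_funB.
  by apply: measurable_funX; apply: measurable_funB; exact: measurableT_comp.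
have one l r : 0 <= l -> l < r -> r <= 1 -> e l = 0 -> (forall j, ~ (l < X j < r)) ->
    (\int[mu]_x (L l r x)%:E <= K%:E * \int[mu2]_z (q l r z)%:E)%E.
  move=> l0 lr r1 el nX.
  apply: (le_trans (fractional_hardy (M := M) b0 lr me _)).
    by move=> x /andP[lx xr]; have := eM _ _ l0 lx (le_trans (ltW xr) r1); rewrite el subr0.
  apply: lee_wpmul2r; first by apply: integral_ge0 => z _; exact: q0.
  rewrite lee_fin ler_wpM2l//.
  apply: ge0_ler_powR; rewrite ?nnegrE ?subr_ge0 ?(ltW lr)//.
  - by rewrite addr_ge0// ltW.
  - by rewrite (le_trans _ (gap _ _ l0 lr r1 nX))// subr_ge0 ltW.
  - exact: gap.
(* Induction on a bound [n] for the number of nodes below [c]. The right end [c] is general because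
   the cut replaces it by a node. *)
suff main n c : 0 < c -> c <= 1 -> (#|[set j | (X j < c)%R]%SET| <= n)%N ->
    (\int[mu]_x (L 0 c x)%:E <= K%:E * \int[mu2]_z (q 0 c z)%:E)%E.
  have := main _ 1 ltr01 (lexx _) (leqnn _).
  rewrite -/K; congr (_ <= _ * _)%E; apply: eq_integral => z _; by rewrite /L /q !subr0.
elim: n c => [|n IH] c c0 c1.
  rewrite leqn0 cards_eq0 => /eqP S0; apply: one => // j /andP[_ jc].
  by have := finset.in_set0 j; rewrite -S0 inE jc.
move=> Sn.
case: (pickP [pred j | X j < c]) => [j0 /= j0c|none]; last first.
  by apply: one => // j /andP[_ jc]; have := none j; rewrite /= jc.
have [j /= jc jmax] := @arg_maxP _ _ _ j0 [pred j | X j < c] X j0c.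
pose p := X j.
have pc : p < c by [].
have p0 : 0 < p by exact: X0.
have Hr : (\int[mu]_x (L p c x)%:E <= K%:E * \int[mu2]_z (q p c z)%:E)%E.
  apply: one => //; first exact: ltW.
    exact: eX.
  by move=> i /andP[pi ic]; have := jmax i ic; rewrite leNgt pi.
have Hl : (\int[mu]_x (L 0 p x)%:E <= K%:E * \int[mu2]_z (q 0 p z)%:E)%E.
  apply: IH => //; first by rewrite (le_trans (ltW pc)).
  rewrite -ltnS; apply: leq_trans Sn; apply: proper_card; apply/properP; split.
    by apply/fintype.subsetP => i; rewrite !inE => /lt_trans; exact.
  by exists j; rewrite !inE ?ltxx.
apply: (@le_trans _ _ (\int[mu]_x (L 0 p x)%:E + \int[mu]_x (L p c x)%:E)%E).
  rewrite -ge0_integralD//; [|exact: mL..].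
  apply: (@ae_ge0_le_integral _ _ _ mu setT) => //.
  - exact: mL.
  - by move=> x _; exact: adde_ge0.
  - by apply: emeasurable_funD; exact: mL.
  exists [set p]; split => //; first exact: lebesgue_measure_set1.
  move=> x /= h; apply: contrapT => /eqP xp; apply: h => _.
  rewrite -EFinD lee_fin /L -mulrDl ler_wpM2r ?sqr_ge0//.
  rewrite !pw0E !subr_gt0.
  move: xp; rewrite neq_lt => /orP[] h.
    by rewrite (lt_trans h pc) h (lt_gtF h) /= !mulr1 addr0.
  by rewrite h (lt_trans p0 h) (lt_gtF h) /= !mul1r add0r.
apply: (le_trans (leeD Hl Hr)).
rewrite -ge0_muleDr; [|by apply: integral_ge0 => z _; exact: q0..].
apply: lee_wpmul2l => //.
rewrite -ge0_integralD//; [|exact: mq..].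
apply: ge0_le_integral => //.
- by move=> x _; exact: adde_ge0.
- by apply: emeasurable_funD; exact: mq.
- exact: mq.
move=> [t x] _; rewrite -EFinD lee_fin /q/= -mulrDl.
have [tx|xt] := ltP t x; last by rewrite [pw _ (x - t)]pw_le0 ?subr_le0// mul0r !mulr0.
rewrite ler_wpM2r ?(mulr_ge0 (pw_ge0 _ _) (sqr_ge0 _))//.
rewrite !pw0E !subr_gt0.
have [xp|px] := ltP x p.
  rewrite (lt_gtF (lt_trans tx xp)) mul0r addr0 (lt_trans xp pc) mulr1.
  by case: (0 < t).
have [pt|tp] := ltP p t; last by rewrite mulr0 mul0r addr0 mulr_ge0.
by rewrite (lt_trans p0 pt) mulr0 add0r.
Qed.
End gaps.

(** * Gap lengths and the fill distance *)

Section fill_distance_gap.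
Context {R : realType}.

(** The midpoint of a gap is at distance at least (r - l) / 2 from every node. The two end gaps,
    bounded by 0 or 1, are included. *)
Lemma gap_le_fill_distance (N : nat) (X : 'I_N -> R) (l r : R) :
  (0 < N)%N -> (forall j, 0 < X j < 1) -> 0 <= l -> l < r -> r <= 1 ->
  (forall j, ~ (l < X j < r)) -> r - l <= 2 * fill_distance X.
Proof.
move=> N0 X01 l0 lr r1 nX; pose m := (l + r) / 2.
have m0 : 0 < m by rewrite /m; lra.
have m1 : m < 1 by rewrite /m; lra.
pose D x := [set `|x - X j| | j in [set: 'I_N]].
have D0 x : D x !=set0 by exists `|x - X (Ordinal N0)|; exists (Ordinal N0).
suff h : (r - l) / 2 <= fill_distance X by lra.
apply: (@le_trans _ _ (inf (D m))).
  apply: lb_le_inf => // _ [j _ <-].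
  have [Xl|lX] := leP (X j) l.
    by apply: le_trans (ler_norm _); rewrite /m; lra.
  have [rX|Xr] := leP r (X j).
    by rewrite distrC; apply: le_trans (ler_norm _); rewrite /m; lra.
  by case: (nX j); rewrite lX.
apply: ub_le_sup; last by exists m => //=; rewrite in_itv/= m0 m1.
(* The supremum requires a bounded set: two points of (0, 1) are at distance at most 1. *)
exists 1 => _ [x /= /[!in_itv]/= /andP[x0 x1] <-].
apply: (@le_trans _ _ `|x - X (Ordinal N0)|); last first.
  by have /andP[? ?] := X01 (Ordinal N0); rewrite ler_norml; lra.
apply: ge_inf; last by exists (Ordinal N0).
by exists 0 => _ [j _ <-].
Qed.

(** The gap between 0 and the leftmost node has positive length. Positivity matters when the norm of
    the derivative is +oo: the product with the constant must be +oo as well. *)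
Lemma fill_distance_gt0 (N : nat) (X : 'I_N -> R) :
  (0 < N)%N -> (forall j, 0 < X j < 1) -> 0 < fill_distance X.
Proof.
move=> N0 X01.
have [j _ jmin] := @arg_minP _ _ _ (Ordinal N0) xpredT X isT.
have /andP[Xj0 Xj1] := X01 j.
suff : X j - 0 <= 2 * fill_distance X by lra.
apply: gap_le_fill_distance => //; first exact: ltW.
by move=> i /andP[_]; rewrite ltNge jmin.
Qed.

End fill_distance_gap.

(** * The Beta integral *)

Section beta_kernel.
Context {R : realType}.
Local Notation mu := (@lebesgue_measure R).

Lemma beta_kernel_lty (a b : R) : 0 < a < 1 -> 0 < b < 1 ->
  (\int[mu]_t (pw (a - 1) (1 - t) * pw (b - 1) t)%:E < +oo)%E.
Proof.
move=> /andP[a0 a1] /andP[b0 b1].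
pose f t : R := pw (b - 1) (t - 0) * pw 0 (1 - t).
pose g t : R := pw 0 (t - 0) * pw (a - 1) (1 - t).
have mf : measurable_fun setT f.
  by apply: measurable_funM; apply: measurable_pw_comp; exact: measurable_funB.
have mg : measurable_fun setT g.
  by apply: measurable_funM; apply: measurable_pw_comp; exact: measurable_funB.
have f0 t : 0 <= f t by rewrite mulr_ge0// pw_ge0.
have g0 t : 0 <= g t by rewrite mulr_ge0// pw_ge0.
apply: (@le_lt_trans _ _ (\int[mu]_t (2%:E * (f t + g t)%:E))%E).
  apply: ge0_le_integral => //.
  - by move=> t _; rewrite lee_fin mulr_ge0// pw_ge0.
  - apply/measurable_EFinP; apply: measurable_funM; apply: measurable_pw_comp => //.
    exact: measurable_funB.
  - by apply: emeasurable_funM => //; apply/measurable_EFinP; exact: measurable_funD.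
  - move=> t _; rewrite -EFinM lee_fin /f /g subr0.
    have [t0|t0] := ltP 0 t; last by rewrite !(@pw_le0 _ _ t)// !(mul0r, mulr0) addr0 mulr0.
    have [t1|t1] := ltP t 1; last by rewrite !(@pw_le0 _ _ (1 - t)) ?subr_le0// !(mul0r, mulr0) addr0 mulr0.
    rewrite !pwE ?subr_gt0// !powRr0 mulr1 mul1r.
    (* On either side of 1/2 one of the two factors is nonsingular and at most 2. *)
    have half (c x : R) : 0 < c < 1 -> 2^-1 <= x -> x `^ (c - 1) <= 2.
      move=> /andP[c0 c1] x2; have x0 : 0 < x by lra.
      rewrite -opprB powRN invf_ple ?posrE ?powR_gt0//.
      rewrite (@le_trans _ _ ((2^-1) `^ (1 - c)))//.
        by apply: ger1_powR; lra.
      apply: ge0_ler_powR; rewrite ?nnegrE ?invr_ge0//; [lra|exact: ltW].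
    have p1 := powR_ge0 t (b - 1); have p2 := powR_ge0 (1 - t) (a - 1).
    have [tl|tr] := leP t 2^-1.
      have h : (1 - t) `^ (a - 1) <= 2 by apply: half; [rewrite a0|lra].
      by rewrite mulrDr ler_wpDr ?mulr_ge0// ler_wpM2r.
    have h : t `^ (b - 1) <= 2 by apply: half; [rewrite b0|lra].
    by rewrite mulrDr ler_wpDl ?mulr_ge0// mulrC ler_wpM2r.
rewrite ge0_integralZl//; last 2 first.
- by apply/measurable_EFinP; exact: measurable_funD.
- by move=> t _; rewrite lee_fin addr_ge0.
under eq_integral do rewrite EFinD.
rewrite ge0_integralD//; [|by move=> t _; rewrite lee_fin|by apply/measurable_EFinP
  |by move=> t _; rewrite lee_fin|by apply/measurable_EFinP].
by rewrite integral_pw_left// integral_pw_right// -EFinD -EFinM ltry.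
Qed.

(** The Beta value B(b, 1 - b), the common factor of the jumps of the step function. *)
Definition beta_const (b : R) : R :=
  \int[mu]_t (pw (- b) (1 - t) * pw (b - 1) t).

Lemma beta_const_ge0 b : 0 <= beta_const b.
Proof. by apply: Rintegral_ge0 => t _; rewrite mulr_ge0// pw_ge0. Qed.

(* The exponents add up to [-1], which makes the convolution scale invariant. *)
Lemma integral_beta_kernel (b z x : R) : 0 < b < 1 ->
  (\int[mu]_t (pw (- b) (x - t) * pw (b - 1) (t - z))%:E = (beta_const b * pw 0 (x - z))%:E)%E.
Proof.
move=> /andP[b0 b1].
have [zx|xz] := ltP z x; last first.
  rewrite [pw 0 _]pw_le0 ?subr_le0// mulr0 integral0_eq// => t _; congr EFin.
  have [tx|xt] := ltP t x; last by rewrite (@pw_le0 _ _ (x - t)) ?subr_le0// mul0r.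
  by rewrite (@pw_le0 _ _ (t - z)) ?mulr0// subr_le0 (le_trans (ltW tx)).
rewrite [pw 0 _]pwE ?subr_gt0// powRr0 mulr1.
have w0 : 0 < x - z by rewrite subr_gt0.
pose F t := (pw (- b) (x - z - t) * pw (b - 1) t)%:E.
have mF : measurable_fun setT F.
  apply/measurable_EFinP; apply: measurable_funM; apply: measurable_pw_comp => //.
  exact: measurable_funB.
have F0 t : (0 <= F t)%E by rewrite lee_fin mulr_ge0// pw_ge0.
transitivity (\int[mu]_t F (t - z)%R)%E.
  by apply: eq_integral => t _; rewrite /F; congr (pw _ _ * _)%:E; ring.
rewrite ge0_integral_shift// -(ge0_integral_dilate w0)// /beta_const /Rintegral fineK; last first.
  rewrite ge0_fin_numE; last by apply: integral_ge0 => t _; rewrite lee_fin mulr_ge0 ?pw_ge0.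
  have := @beta_kernel_lty (1 - b) b; rewrite (_ : 1 - b - 1 = - b); last by ring.
  by apply; rewrite ?b0 ?b1//; lra.
apply: eq_integral => t _; rewrite /F -EFinM; congr EFin.
have -> : x - z - (x - z) * t = (x - z) * (1 - t) by ring.
rewrite !pw_dilate//.
have k1 : (x - z) * ((x - z) `^ (- b) * (x - z) `^ (b - 1)) = 1.
  rewrite -powRD; last by rewrite (gt_eqF w0) implybT.
  have -> : - b + (b - 1) = - 1 :> R by ring.
  by rewrite powR_inv1 ?ltW// divff// gt_eqF.
by rewrite -[RHS]mul1r -[X in _ = X * _]k1; ring.
Qed.
End beta_kernel.

(** * Smoothness of the bump functions *)

Section bump.
Context {R : realType}.

(* [p q^-k exp(-1/q)] where [q > 0], extended by [0]: a class of functions closed under differentiation. *)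
Definition bump_fun (p q : {poly R}) (k : nat) (x : R) : R :=
  if 0 < q.[x] then p.[x] * q.[x]^-1 ^+ k * expR (- q.[x]^-1) else 0.

(** The numerator left when the derivative of p q^-k exp(-1/q) is written over q^(k+2). *)
Definition bump_deriv (p q : {poly R}) (k : nat) : {poly R} :=
  p^`() * q ^+ 2 - (p * q^`() * q) *+ k + p * q^`().

Lemma bump_derivE p q k x : (bump_deriv p q k).[x] = p^`().[x] * q.[x] ^+ 2 -
  p.[x] * q^`().[x] * q.[x] *+ k + p.[x] * q^`().[x].
Proof. by rewrite /bump_deriv !(hornerD, hornerN, hornerMn, hornerM, horner_exp). Qed.

Lemma expR_pow_le (n : nat) (r : R) : 0 <= r -> r ^+ n.+1 * expR (- r) <= n.+1`!%:R.
Proof.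
move=> r0; rewrite expRN ler_pdivrMr ?expR_gt0//.
have f0 : 0 < n.+1`!%:R :> R by rewrite ltr0n fact_gt0.
rewrite -ler_pdivrMl// mulrC; apply: le_trans (expR_ge1Dxn n r0).
by rewrite lerDr.
Qed.

(** With r = 1 / q, the bound r^(k+2) exp(-r) <= (k+2)! makes p r^k exp(-r) of order q^2, and q is
    divisible by X - x. Hence the derivative at a zero of q exists and is 0. *)
Lemma bump_fun_bound (p q : {poly R}) k (x : R) : q.[x] = 0 ->
  exists C : R, \forall y \near x, `|bump_fun p q k y| <= C * (y - x) ^+ 2.
Proof.
move=> qx; have /factor_theorem [q1 q1E] : root q x by apply/eqP.
have cp : {for x, continuous (fun y => `|p.[y]|)}.
  by apply: (continuous_comp (@continuous_horner _ p x)); exact: norm_continuous.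
have cq : {for x, continuous (fun y => `|q1.[y]|)}.
  by apply: (continuous_comp (@continuous_horner _ q1 x)); exact: norm_continuous.
exists ((`|p.[x]| + 1) * (k.+2)`!%:R * (`|q1.[x]| + 1) ^+ 2).
near=> y.
have py : `|p.[y]| <= `|p.[x]| + 1.
  by near: y; apply: (cvgr_le _ cp); rewrite ltrDl.
have qy : `|q1.[y]| <= `|q1.[x]| + 1.
  by near: y; apply: (cvgr_le _ cq); rewrite ltrDl.
have rhs0 : 0 <= (`|p.[x]| + 1) * (k.+2)`!%:R * (`|q1.[x]| + 1) ^+ 2 * (y - x) ^+ 2.
  by rewrite mulr_ge0 ?sqr_ge0// mulr_ge0 ?sqr_ge0// mulr_ge0 ?addr_ge0.
rewrite /bump_fun; case: ifPn => [q0|_]; last by rewrite normr0.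
have r0 : 0 <= q.[y]^-1 by rewrite invr_ge0 ltW.
rewrite !normrM normrX (ger0_norm r0) (ger0_norm (expR_ge0 _)).
have h := expR_pow_le k.+1 r0.
have -> : `|p.[y]| * q.[y]^-1 ^+ k * expR (- q.[y]^-1) =
  `|p.[y]| * (q.[y]^-1 ^+ k.+2 * expR (- q.[y]^-1)) * (`|q1.[y]| ^+ 2 * (y - x) ^+ 2).
  rewrite -[(y - x) ^+ 2]real_normK ?num_real// -exprMn -normrM.
  have -> : q1.[y] * (y - x) = q.[y] by rewrite q1E hornerM hornerXsubC.
  rewrite real_normK ?num_real// -[in RHS]addn2 exprD.
  have : q.[y]^-1 ^+ 2 * q.[y] ^+ 2 = 1 by rewrite -exprMn mulVf ?expr1n// gt_eqF.
  move=> rq; rewrite -[LHS]mulr1 -[X in _ * X = _]rq; ring.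
rewrite [leRHS](_ : _ = (`|p.[x]| + 1) * (k.+2)`!%:R * ((`|q1.[x]| + 1) ^+ 2 * (y - x) ^+ 2)); last by rewrite mulrA.
have t0 : 0 <= q.[y]^-1 ^+ k.+2 * expR (- q.[y]^-1).
  by apply: mulr_ge0; [exact: exprn_ge0|exact: expR_ge0].
apply: ler_pM.
- exact: mulr_ge0.
- by apply: mulr_ge0; exact: sqr_ge0.
- exact: ler_pM.
- by rewrite ler_wpM2r ?sqr_ge0// lerXn2r ?nnegrE ?addr_ge0.
Unshelve. all: by end_near. Qed.

Lemma is_derive_bump (p q : {poly R}) k (x : R) :
  is_derive x 1 (bump_fun p q k) (bump_fun (bump_deriv p q k) q k.+2 x).
Proof.
have cq : {for x, continuous (fun y => q.[y])} by exact: continuous_horner.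
have [q0|q0|q0] := ltgtP 0 q.[x].
- rewrite {2}/bump_fun q0.
  pose f y := p.[y] * q.[y]^-1 ^+ k * expR (- q.[y]^-1).
  apply: (@near_eq_is_derive _ _ _ f) => //.
    near=> y; rewrite /bump_fun ifT//.
    by near: y; apply: (cvgr_gt _ cq).
  have qn0 : q.[x] != 0 by rewrite gt_eqF.
  have dr : is_derive x 1 (fun y => q.[y]^-1) (- q.[x] ^- 2 *: q^`().[x]).
    by apply: is_deriveV => //; exact: is_derive_poly.
  have de : is_derive x 1 (fun y => expR (- q.[y]^-1))
      (expR (- q.[x]^-1) * (- (- q.[x] ^- 2 *: q^`().[x]))).
    exact: (@is_derive1_comp _ expR (fun y => - q.[y]^-1)).
  have dk : is_derive x 1 ((fun y => q.[y]^-1) ^+ k) _ := is_deriveX k dr.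
  have df := is_deriveM (is_deriveM (is_derive_poly p x) dk) de.
  rewrite (_ : f = (horner p * (fun y => q.[y]^-1) ^+ k) * (fun y => expR (- q.[y]^-1))); last first.
    by apply/funext => y; rewrite /f !fctE.
  apply: (is_derive_eq df).
  have rq : q.[x]^-1 * q.[x] = 1 by rewrite mulVf.
  rewrite bump_derivE !fctE /GRing.scale/= -exprVn -(mulr_natr (_ * _)).
  move: (p.[x]) (p^`().[x]) (q^`().[x]) (expR _) rq => P P' Q' E.
  move: (q.[x]) => Q rq; set r := Q^-1 in rq *.
  have rQ2 : r ^+ k.+2 * Q ^+ 2 = r ^+ k by rewrite -addn2 exprD -mulrA -exprMn rq expr1n mulr1.
  have rQ1 : k%:R * r ^+ k.+2 * Q = k%:R * r ^+ k.+1 by rewrite exprSr -!mulrA rq mulr1.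
  have rk : k%:R * r ^+ k.-1 * r ^+ 2 = k%:R * r ^+ k.+1.
    by case: (k) => [|n]; rewrite ?mul0r// -mulrA -exprD addn2.
  transitivity (E * (P * r ^+ k.+2 * Q' - P * Q' * (k%:R * r ^+ k.+1) + r ^+ k * P')).
    by rewrite -rk -[in r ^+ k.+2]addn2 exprD; ring.
  by rewrite -rQ1 -[X in X * P']rQ2; ring.
- have -> : bump_fun (bump_deriv p q k) q k.+2 x = 0 by rewrite /bump_fun lt_gtF.
  apply: (@near_eq_is_derive _ _ _ (cst 0)) => //.
  near=> y; rewrite /bump_fun lt_gtF//.
  by near: y; apply: (cvgr_lt _ cq).
- have [C CP] := bump_fun_bound p k (esym q0).
  have b0 : bump_fun p q k x = 0 by rewrite /bump_fun -q0 ltxx.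
  rewrite {2}/bump_fun -q0 ltxx.
  apply/is_derive1_caratheodory.
  (* The slope function of Carathéodory's criterion; the quadratic bound makes it continuous at x
     with value 0. *)
  exists (fun z => if z == x then 0 else bump_fun p q k z / (z - x)); split.
  + move=> z; rewrite b0 subr0; case: eqP => [->|/eqP zx]; first by rewrite b0 mul0r.
    by rewrite divfK// subr_eq0.
  + rewrite /prop_for /continuous_at /= eqxx; apply/cvgr0Pnorm_le => e e0.
    have C0 : 0 < `|C| + 1 by rewrite ltr_wpDl.
    near=> z; case: eqP => [_|/eqP zx]; first by rewrite normr0 ltW.
    have zx0 : 0 < `|z - x| by rewrite normr_gt0 subr_eq0.
    rewrite normrM normfV ler_pdivrMr//.
    have h : `|bump_fun p q k z| <= C * (z - x) ^+ 2 by near: z.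
    apply: (le_trans h); rewrite -real_normK ?num_real// expr2 mulrA ler_pM2r//.
    apply: (@le_trans _ _ ((`|C| + 1) * `|z - x|)).
      by rewrite ler_wpM2r// (le_trans (ler_norm C))// lerDl.
    rewrite mulrC -ler_pdivlMr// distrC ltW//.
    by near: z; apply: (nbhsx_ballx x); rewrite divr_gt0.
  + by rewrite eqxx.
Unshelve. all: by end_near. Qed.
End bump.

(** * The du Bois-Reymond lemma *)

Section du_bois_reymond.
Context {R : realType}.
Local Notation mu := (@lebesgue_measure R).

(** For e > 0 this quadratic is positive exactly on (a, a + e), which fixes the support of the
    bump. *)
Definition bump_quad (a e : R) : {poly R} := ('X - a%:P) * ((a + e)%:P - 'X).

Definition bump (a e : R) : R -> R := bump_fun 1 (bump_quad a e) 0.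

Lemma bump_quadE a e x : (bump_quad a e).[x] = (x - a) * (a + e - x).
Proof. by rewrite /bump_quad hornerM hornerXsubC hornerD hornerN hornerX hornerC. Qed.

Lemma bumpE a e x : bump a e x =
  if 0 < (x - a) * (a + e - x) then expR (- ((x - a) * (a + e - x))^-1) else 0.
Proof. by rewrite /bump /bump_fun bump_quadE hornerC expr0 !mul1r. Qed.

Lemma bump_ge0 a e x : 0 <= bump a e x.
Proof. by rewrite bumpE; case: ifP => // _; exact: expR_ge0. Qed.

Lemma bump_le1 a e x : bump a e x <= 1.
Proof.
rewrite bumpE; case: ifP => // h.
by rewrite -expR0 ler_expR oppr_le0 invr_ge0 ltW.
Qed.

Lemma bump_out a e x : 0 < e -> ~~ (a < x < a + e) -> bump a e x = 0.
Proof.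
move=> e0 h; rewrite bumpE ifF//; apply/negbTE; rewrite -leNgt.
have [xa|ax] := leP x a; first by rewrite mulr_le0_ge0 ?subr_le0 ?subr_ge0//; lra.
move: h; rewrite ax/= -leNgt => aex.
by rewrite mulr_ge0_le0 ?subr_le0 ?subr_ge0// ltW.
Qed.

Lemma bump_shift a b e x : bump b e x = bump a e (x - (b - a)).
Proof.
rewrite !bumpE; have -> : x - (b - a) - a = x - b by ring.
by have -> : a + e - (x - (b - a)) = b + e - x by ring.
Qed.

Lemma continuous_bump a e : continuous (bump a e).
Proof.
by move=> x; apply/differentiable_continuous/derivable1_diffP; case: (is_derive_bump 1 (bump_quad a e) 0 x).
Qed.

Lemma measurable_bump a e : measurable_fun [set: R] (bump a e).
Proof. by apply: continuous_measurable_fun; exact: continuous_bump. Qed.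

Lemma smooth_class (P : (R -> R) -> Prop) (f : R -> R) :
  (forall g, P g -> (forall x, derivable g x 1) /\ P g^`()%classic) ->
  P f -> forall n x, derivable (derive1n n f) x 1.
Proof.
move=> Pd Pf n; elim: n f Pf => [|n IH] f Pf x; first by case: (Pd _ Pf).
by rewrite derive1Sn; apply: IH; case: (Pd _ Pf).
Qed.

Lemma smooth_bump_sub a b e n x : derivable (derive1n n (bump a e \- bump b e)) x 1.
Proof.
(* One common exponent k serves both terms, since each derivation raises it by 2 in both. *)
apply: (smooth_class (P := fun f => exists p1 p2 k,
  f = bump_fun p1 (bump_quad a e) k \- bump_fun p2 (bump_quad b e) k)); last by exists 1, 1, 0%N.
move=> _ [p1 [p2 [k ->]]].
have d y := is_deriveB (is_derive_bump p1 (bump_quad a e) k y) (is_derive_bump p2 (bump_quad b e) k y).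
split; first by move=> y; case: (d y).
exists (bump_deriv p1 (bump_quad a e) k), (bump_deriv p2 (bump_quad b e) k), k.+2.
by apply/funext => y; rewrite derive1E; case: (d y).
Qed.

Lemma integrable_bump a e : 0 < e -> mu.-integrable setT (EFin \o bump a e).
Proof.
move=> e0.
have : mu.-integrable `[a, a + e] (EFin \o bump a e).
  apply: measurable_bounded_integrable => //.
  - by apply: compact_finite_measure; exact: segment_compact.
  - by apply: measurable_funTS; exact: measurable_bump.
  - exists 1; split; first exact: num_real.
    by move=> y y1 x _ /=; rewrite ger0_norm ?bump_ge0// (le_trans (bump_le1 _ _ _))// ltW.
move/integrable_mkcond => /(_ (measurable_itv _)); apply: eq_integrable => //.
move=> x _; rewrite patchE; case: ifPn => //= /negP h.
rewrite bump_out//; apply/negP => /andP[ax xa]; apply: h.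
by rewrite inE/= in_itv/= !ltW.
Qed.

Lemma Rintegral_bump_shift a b e : 0 < e ->
  \int[mu]_x bump b e x = \int[mu]_x bump a e x.
Proof.
move=> e0; rewrite /Rintegral; congr fine.
rewrite -(@ge0_integral_shift _ (EFin \o bump a e) (b - a)).
- by apply: eq_integral => x _; rewrite /= (bump_shift a b).
- by apply/measurable_EFinP; exact: measurable_bump.
- by move=> x; rewrite lee_fin bump_ge0.
Qed.

Lemma Rintegral_bump_gt0 a e : 0 < e -> 0 < \int[mu]_x bump a e x.
Proof.
(* On the middle half of the support (x - a)(a + e - x) is at least 3 e^2 / 16, its value at the
   ends of [I]. *)
move=> e0; pose I := `[a + e / 4, a + 3 * e / 4]%classic.
pose m := expR (- (3 * e ^+ 2 / 16)^-1).
have m0 : 0 < m by exact: expR_gt0.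
have muI : mu I = (e / 2)%:E.
  rewrite /I lebesgue_measure_itv/= lte_fin ifT; last by lra.
  by rewrite -EFinD; congr EFin; field.
rewrite -lte_fin /Rintegral fineK; last by apply: integrable_fin_num => //; exact: integrable_bump.
apply: (@lt_le_trans _ _ (\int[mu]_(x in I) m%:E)%E).
  rewrite integral_cst; last exact: measurable_itv.
  by rewrite [X in (_ * X)%E](_ : _ = (e / 2)%:E)// -EFinM lte_fin mulr_gt0// divr_gt0.
apply: (@le_trans _ _ (\int[mu]_(x in I) (bump a e x)%:E)%E).
  apply: ge0_le_integral => //.
  - exact: measurable_itv.
  - by move=> x _; rewrite lee_fin ltW.
  - by apply/measurable_EFinP; apply: measurable_funTS; exact: measurable_bump.
  move=> x; rewrite /I/= in_itv/= => /andP[x1 x2]; rewrite lee_fin bumpE.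
  have h : 3 * e ^+ 2 / 16 <= (x - a) * (a + e - x) by nra.
  have q0 : 0 < 3 * e ^+ 2 / 16 by rewrite divr_gt0// mulr_gt0// exprn_gt0.
  rewrite (lt_le_trans q0 h) /m ler_expR lerN2 lef_pV2 ?posrE//.
  exact: lt_le_trans h.
apply: ge0_subset_integral => //.
- exact: measurable_itv.
- by apply/measurable_EFinP; exact: measurable_bump.
- by move=> x _; rewrite lee_fin bump_ge0.
Qed.
(** Translates of a bump have the same integral, so the primitive of their difference vanishes again
    beyond b + e and has compact support. *)
Lemma test_function_bump_primitive a b e : 0 < a -> a < b -> 0 < e -> b + e < 1 ->
  let phi := fun x => \int[mu]_(t in `]-oo, x]) (bump a e t - bump b e t) in
  test_function phi /\ phi^`()%classic = bump a e \- bump b e.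
Proof.
move=> a0 ab e0 be phi.
have ia := integrable_bump a e0; have ib := integrable_bump b e0.
have iab : mu.-integrable setT (EFin \o (bump a e \- bump b e)).
  have := integrableB measurableT ia ib.
  by apply: eq_integrable => // x _; rewrite /= EFinB.
have D x : derivable phi x 1 /\ phi^`()%classic x = (bump a e \- bump b e) x.
  apply: (@continuous_FTC1 R (bump a e \- bump b e) -oo%O x (x + 1)); rewrite ?ltrDl//.
  - exact: integrableS iab.
  - by rewrite ltNyr.
  - by apply: continuousB; exact: continuous_bump.
have dphi : phi^`()%classic = bump a e \- bump b e by apply/funext => x; case: (D x).
split => //; split.
  case=> [|n] x; first by case: (D x).
  by rewrite derive1Sn dphi; exact: smooth_bump_sub.
exists `[a, b + e]%classic; split; first exact: segment_compact.
  move=> x /=; rewrite !in_itv/= => /andP[ax xb].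
  by rewrite (lt_le_trans a0 ax) (le_lt_trans xb be).
move=> x /= /negP; rewrite in_itv/= negb_and -!ltNge => /orP[xa|bx].
  rewrite /phi; under eq_Rintegral => t.
    rewrite inE/= in_itv/= => tx.
    rewrite !bump_out//; last 2 first.
    + by rewrite negb_and -!leNgt; apply/orP; left; lra.
    + by rewrite negb_and -!leNgt; apply/orP; left; lra.
    rewrite subrr; over.
  by rewrite Rintegral_cst ?mul0r//; exact: measurable_itv.
transitivity (\int[mu]_t (bump a e t - bump b e t)).
  rewrite /phi Rintegral_mkcond; apply: eq_Rintegral => t _.
  rewrite patchE; case: ifPn => // /negP tx.
  have xt : x < t by rewrite ltNge; apply/negP => h; apply: tx; rewrite inE/= in_itv.
  rewrite !bump_out ?subrr//; rewrite negb_and -!leNgt; apply/orP; right; lra.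
by rewrite RintegralB// (Rintegral_bump_shift a b e0) subrr.
Qed.

Lemma ball_right (a e r y : R) : e <= r -> a < y -> y < a + e -> ball a r y.
Proof. by move=> er ay ye; rewrite /ball/= distrC gtr0_norm ?subr_gt0//; lra. Qed.

(** Testing with the primitive of a difference of two bumps equates the weighted averages of H just
    to the right of a and of b. By continuity they differ from H a and H b by at most d / 4, where d
    = |H a - H b|; then d <= d / 2, which excludes d > 0. *)
Lemma du_bois_reymond (H : R -> R) (M : R) :
  measurable_fun (`]0, 1[%classic : set R) H -> (forall x, 0 < x < 1 -> `|H x| <= M) ->
  (forall x, 0 < x < 1 -> {for x, continuous H}) ->
  (forall phi, test_function phi ->
     \int[mu]_(x in `]0, 1[) (H x * phi^`()%classic x) = 0) ->
  forall a b, 0 < a < 1 -> 0 < b < 1 -> H a = H b.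
Proof.
move=> mH HM cH Hphi.
suff main a b : 0 < a -> a < b -> b < 1 -> H a = H b.
  move=> a b /andP[a0 a1] /andP[b0 b1].
  by case: (ltgtP a b) => [ab|ba|-> //]; [exact: main|apply/esym/main].
move=> a0 ab b1; apply/eqP; rewrite -subr_eq0 -normr_eq0; apply: contraT => d0.
pose d : R := `|H a - H b|.
have dp : 0 < d by rewrite lt_neqAle eq_sym d0 normr_ge0.
have d4 : 0 < d / 4 by rewrite divr_gt0.
have Ca : {for a, continuous H} by apply: cH; rewrite a0 (lt_trans ab).
have Cb : {for b, continuous H} by apply: cH; rewrite b1 (lt_trans a0).
have /nbhs_ballP[ea /= ea0 Ba] : \forall y \near a, `|H a - H y| <= d / 4 by move/cvgrPdist_le : Ca; exact.
have /nbhs_ballP[eb /= eb0 Bb] : \forall y \near b, `|H b - H y| <= d / 4 by move/cvgrPdist_le : Cb; exact.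
pose e := Num.min (Num.min ea eb) ((1 - b) / 2).
have e0 : 0 < e by rewrite !lt_min ea0 eb0 divr_gt0// subr_gt0.
have eea : e <= ea by rewrite !ge_min lexx.
have eeb : e <= eb by rewrite !ge_min lexx orbT.
have be : b + e < 1.
  have : e <= (1 - b) / 2 by rewrite ge_min lexx orbT.
  by move: b1; lra.
pose D : set R := `]0, 1[%classic.
have mD : measurable (D : set (measurableTypeR R)) by exact: measurable_itv.
have iT c : mu.-integrable D (EFin \o bump c e).
  by apply: (@integrableS _ _ _ mu setT) => //; exact: integrable_bump.
have iH c : mu.-integrable D (EFin \o (fun x => H x * bump c e x)).
  have -> : EFin \o (fun x => H x * bump c e x) = ((EFin \o H) \* (EFin \o bump c e))%E.
    by apply/funext => x /=; rewrite EFinM.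
  apply: integrableMr => //; exists M; split; first exact: num_real.
  move=> y My x; rewrite /D/= in_itv/= => x01; exact: le_trans (HM _ x01) (ltW My).
have cE c : 0 < c -> c + e < 1 -> \int[mu]_(x in D) bump c e x = \int[mu]_x bump c e x.
  move=> c0 c1; rewrite Rintegral_mkcond; apply: eq_Rintegral => x _.
  rewrite patchE; case: ifPn => // /negP xD; rewrite bump_out//.
  apply/negP => /andP[cx xc]; apply: xD; rewrite inE/D/= in_itv/=.
  by rewrite (lt_trans c0 cx) (lt_trans xc).
pose I c := \int[mu]_(x in D) (H x * bump c e x).
have Iab : I a = I b.
  have [tf dphi] := test_function_bump_primitive a0 ab e0 be.
  have := Hphi _ tf; rewrite dphi.
  have -> : \int[mu]_(x in `]0, 1[) (H x * (bump a e \- bump b e) x) = I a - I b.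
    rewrite /I -RintegralB; [|exact: measurable_itv|exact: iH|exact: iH].
    by apply: eq_Rintegral => x _; rewrite mulrBr.
  by move=> /eqP; rewrite subr_eq0 => /eqP.
have key c : 0 < c -> c + e < 1 -> (forall y, c < y < c + e -> `|H c - H y| <= d / 4) ->
    `|H c * \int[mu]_x bump c e x - I c| <= d / 4 * \int[mu]_x bump c e x.
  move=> c0 c1 B; rewrite -(cE _ c0 c1).
  have iZ k : mu.-integrable D (EFin \o (fun x => k * bump c e x)).
    have := integrableZl mD k (iT c); apply: eq_integrable => // x _.
  have EZ k : k * \int[mu]_(x in D) bump c e x = \int[mu]_(x in D) (k * bump c e x).
    by apply/esym; apply: RintegralZl; [exact: measurable_itv|exact: iT].
  have iB : mu.-integrable D (EFin \o (fun x => H c * bump c e x - H x * bump c e x)).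
    have := integrableB mD (iZ (H c)) (iH c); apply: eq_integrable => // x _.
  have -> : H c * \int[mu]_(x in D) bump c e x - I c =
      \int[mu]_(x in D) (H c * bump c e x - H x * bump c e x).
    by rewrite EZ /I -RintegralB; [|exact: measurable_itv|exact: iZ|exact: iH].
  rewrite EZ.
  apply: (le_trans (le_normr_Rintegral mD iB)).
  apply: le_Rintegral; [exact: measurable_itv| |exact: iZ|].
    exact: integrable_norm iB.
  move=> x _; rewrite -mulrBl normrM (ger0_norm (bump_ge0 _ _ _)).
  have [cx|cx] := boolP (c < x < c + e); last by rewrite (bump_out e0 cx) !mulr0 lexx.
  by apply: ler_wpM2r; [exact: bump_ge0|exact: B].
have Ka := key a a0 (le_lt_trans (lerD (ltW ab) (lexx e)) be).
have Kb := key b (lt_trans a0 ab) be.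
have {}Ka : `|H a * \int[mu]_x bump a e x - I a| <= d / 4 * \int[mu]_x bump a e x.
  apply: Ka => y /andP[ay ya]; apply: Ba.
  exact: ball_right eea ay ya.
have {}Kb : `|H b * \int[mu]_x bump a e x - I a| <= d / 4 * \int[mu]_x bump a e x.
  rewrite -(Rintegral_bump_shift a b e0) Iab.
  apply: Kb => y /andP[ay ya]; apply: Bb.
  exact: ball_right eeb ay ya.
have c0 := Rintegral_bump_gt0 a e0.
clear - Ka Kb c0 dp; move: (\int[mu]_x bump a e x) (I a) c0 Ka Kb => c i c0 Ka Kb.
have : d * c <= d / 4 * c + d / 4 * c.
  have -> : d * c = `|(H a * c - i) - (H b * c - i)|.
    rewrite (_ : H a * c - i - (H b * c - i) = (H a - H b) * c); last by ring.
    by rewrite normrM (gtr0_norm c0).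
  exact: (le_trans (ler_normB _ _) (lerD Ka Kb)).
by move=> h; exfalso; nra.
Qed.

End du_bois_reymond.

(** * Fubini with kernels, and the convolution of a bounded density with x_+^(-b) *)

Section fubini_kernel.
Context {R : realType}.
Local Notation mu := (@lebesgue_measure R).
Local Notation mu2 := (mu \x mu)%E.

(** Every section is assumed integrable, because a real-valued integral is [fine] of an extended one
    and must be lifted back at each point. *)
Lemma Rintegral_kernelC (k : R * R -> R) (u v : R -> R) :
  mu2.-integrable setT (fun z => (k z * (v z.1 * u z.2))%:E) ->
  (forall x, mu.-integrable setT (EFin \o (fun t => k (t, x) * v t))) ->
  (forall t, mu.-integrable setT (EFin \o (fun x => k (t, x) * u x))) ->
  \int[mu]_x (u x * \int[mu]_t (k (t, x) * v t)) =
  \int[mu]_t (v t * \int[mu]_x (k (t, x) * u x)).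
Proof.
move=> i2 i1 i3; rewrite /Rintegral; congr fine.
transitivity (\int[mu]_x \int[mu]_t (k (t, x) * (v t * u x))%:E)%E.
  apply: eq_integral => x _; rewrite EFinM fineK; last exact: integrable_fin_num (i1 x).
  rewrite -integralZl//; last exact: i1.
  by apply: eq_integral => t _; rewrite /= -EFinM; congr EFin; ring.
rewrite -(Fubini i2)/=; apply: eq_integral => t _.
rewrite EFinM fineK; last exact: integrable_fin_num (i3 t).
rewrite -integralZl//; last exact: i3.
by apply: eq_integral => x _; rewrite /= -EFinM; congr EFin; ring.
Qed.

Lemma integrable_pw0M (x : R) (v : R -> R) :
  mu.-integrable setT (EFin \o v) ->
  mu.-integrable setT (EFin \o (fun t => pw 0 (x - t) * v t)).
Proof.
move=> iv.
have -> : EFin \o (fun t => pw 0 (x - t) * v t) = ((EFin \o (fun t => pw 0 (x - t))%R) \* (EFin \o v))%E.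
  by apply/funext => t /=; rewrite EFinM.
apply: integrableMr => //.
  by apply: measurable_pw_comp; exact: measurable_funB.
exists 1; split; first exact: num_real.
by move=> y y1 p _ /=; rewrite ger0_norm ?pw_ge0// (le_trans (pw0_le1 _))// ltW.
Qed.

Lemma integrable_pw0M' (x : R) (v : R -> R) :
  mu.-integrable setT (EFin \o v) ->
  mu.-integrable setT (EFin \o (fun t => pw 0 (t - x) * v t)).
Proof.
move=> iv.
have -> : EFin \o (fun t => pw 0 (t - x) * v t) = ((EFin \o (fun t => pw 0 (t - x))%R) \* (EFin \o v))%E.
  by apply/funext => t /=; rewrite EFinM.
apply: integrableMr => //.
  by apply: measurable_pw_comp; exact: measurable_funB.
exists 1; split; first exact: num_real.
by move=> y y1 p _ /=; rewrite ger0_norm ?pw_ge0// (le_trans (pw0_le1 _))// ltW.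
Qed.

Lemma Rintegral_triangleC (u v : R -> R) :
  mu.-integrable setT (EFin \o u) -> mu.-integrable setT (EFin \o v) ->
  \int[mu]_x (u x * \int[mu]_t (pw 0 (x - t) * v t)) =
  \int[mu]_t (v t * \int[mu]_x (pw 0 (x - t) * u x)).
Proof.
move=> iu iv; apply: (@Rintegral_kernelC (fun z => pw 0 (z.2 - z.1))).
- apply: (@integrable_kernel_prod _ _ _ _ 1) => //.
    by apply: measurable_pw_comp; exact: measurable_funB.
  by move=> z; rewrite ger0_norm ?pw_ge0// pw0_le1.
- by move=> x; exact: integrable_pw0M.
- by move=> t; exact: integrable_pw0M'.
Qed.

(* The two half-lines miss only the point [x]. *)
Lemma Rintegral_pw0_split (x : R) (v : R -> R) :
  mu.-integrable setT (EFin \o v) ->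
  \int[mu]_t (pw 0 (x - t) * v t) + \int[mu]_t (pw 0 (t - x) * v t) = \int[mu]_t v t.
Proof.
move=> iv; have i1 := integrable_pw0M x iv; have i2 := integrable_pw0M' x iv.
rewrite -RintegralD//; congr fine.
have mv : measurable_fun setT v by apply/measurable_EFinP; exact: measurable_int iv.
apply: ae_eq_integral => //.
- apply/measurable_EFinP; apply: measurable_funD; apply: measurable_funM => //;
  by apply: measurable_pw_comp; exact: measurable_funB.
- exact/measurable_EFinP.
exists [set x]; split => //; first exact: lebesgue_measure_set1.
move=> t /= h; apply: contrapT => /eqP tx; apply: h => _.
congr EFin; rewrite -mulrDl.
have -> : pw 0 (x - t) + pw 0 (t - x) = 1.
  by rewrite !pw0E !subr_gt0; move: tx; rewrite neq_lt => /orP[] h;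
    rewrite h (lt_gtF h) ?addr0 ?add0r.
by rewrite mul1r.
Qed.

Lemma Rintegral_pw0_itv (t x : R) (v : R -> R) : t <= x ->
  mu.-integrable setT (EFin \o v) ->
  \int[mu]_p (pw 0 (p - t) * pw 0 (x - p) * v p) =
  \int[mu]_p (pw 0 (x - p) * v p) - \int[mu]_p (pw 0 (t - p) * v p).
Proof.
move=> tx iv; have iw := integrable_pw0M x iv.
rewrite -(Rintegral_pw0_split t iw).
have -> : \int[mu]_p (pw 0 (t - p) * (pw 0 (x - p) * v p)) = \int[mu]_p (pw 0 (t - p) * v p).
  apply: eq_Rintegral => p _; rewrite mulrA; congr (_ * _); rewrite !pw0E !subr_gt0.
  by case: (ltP p t) => [pt|]; rewrite ?mul0r// (lt_le_trans pt tx) mulr1.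
by rewrite [RHS]addrAC subrr add0r; apply: eq_Rintegral => p _; rewrite mulrA.
Qed.
Lemma integrable_pw_right (b z v : R) : b < 1 ->
  mu.-integrable setT (EFin \o (fun x => pw 0 (x - z) * pw (- b) (v - x))).
Proof.
move=> b1; apply/integrableP; split.
  by apply/measurable_EFinP; apply: measurable_funM; apply: measurable_pw_comp; exact: measurable_funB.
have := @integral_pw_right R (1 - b) z v; rewrite (_ : 1 - b - 1 = - b); last by ring.
move=> h; under eq_integral do rewrite /= ger0_norm ?mulr_ge0 ?pw_ge0//.
by rewrite h ?ltry// subr_gt0.
Qed.

Lemma Rintegral_pw_right (b z v : R) : b < 1 ->
  \int[mu]_x (pw 0 (x - z) * pw (- b) (v - x)) = pw (1 - b) (v - z) / (1 - b).
Proof.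
move=> b1; have := @integral_pw_right R (1 - b) z v; rewrite (_ : 1 - b - 1 = - b); last by ring.
by move=> h; rewrite /Rintegral h// subr_gt0.
Qed.

Lemma Rintegral_pw_left (b z v : R) : b < 1 ->
  \int[mu]_x (pw (- b) (x - z) * pw 0 (v - x)) = pw (1 - b) (v - z) / (1 - b).
Proof.
move=> b1; have := @integral_pw_left R (1 - b) z v; rewrite (_ : 1 - b - 1 = - b); last by ring.
by move=> h; rewrite /Rintegral h// subr_gt0.
Qed.

Lemma pw_antimono (b x y : R) : 0 <= b -> 0 < x -> x <= y -> pw (- b) y <= pw (- b) x.
Proof.
move=> b0 x0 xy; have y0 := lt_le_trans x0 xy.
rewrite !pwE// !powRN lef_pV2 ?posrE ?powR_gt0//.
by apply: ge0_ler_powR => //; rewrite nnegrE ltW.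
Qed.

Lemma pw_mono (b x y : R) : 0 <= b -> x <= y -> pw b x <= pw b y.
Proof.
move=> b0 xy; have [x0|x0] := ltP 0 x; last by rewrite pw_le0 ?pw_ge0.
have y0 := lt_le_trans x0 xy; rewrite !pwE//.
by apply: ge0_ler_powR => //; rewrite nnegrE ltW.
Qed.

Lemma le_norm_Rintegral (u v : R -> R) :
  mu.-integrable setT (EFin \o u) -> mu.-integrable setT (EFin \o v) ->
  (forall x, `|u x| <= v x) -> `|\int[mu]_x u x| <= \int[mu]_x v x.
Proof.
move=> iu iv uv; apply: (le_trans (le_normr_Rintegral measurableT iu)).
by apply: le_Rintegral => //; exact: integrable_norm iu.
Qed.

Section bounded_density.
Variables (b M : R) (fp : R -> R).
Hypotheses (b01 : 0 < b < 1) (mfp : measurable_fun setT fp)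
  (fpM : forall x, `|fp x| <= M) (fp0 : forall x, ~~ (0 < x < 1) -> fp x = 0).

Let b0 : 0 < b. Proof. by case/andP: b01. Qed.
Let b1 : b < 1. Proof. by case/andP: b01. Qed.
Let M0 : 0 <= M. Proof. exact: le_trans (normr_ge0 _) (fpM 0). Qed.

Lemma density_le x : `|fp x| <= M * (pw 0 x * pw 0 (1 - x)).
Proof.
have [/andP[x0 x1]|x01] := boolP (0 < x < 1); last first.
  by rewrite fp0// normr0 !mulr_ge0 ?pw_ge0.
by rewrite !pw0E subr_gt0 x0 x1 !mulr1.
Qed.

Lemma integrable_bounded_density : mu.-integrable setT (EFin \o fp).
Proof.
apply: (@le_integrable _ _ _ mu setT _ _ (EFin \o (fun x => M * (pw 0 (x - 0) * pw (- 0) (1 - x))))) => //.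
- exact/measurable_EFinP.
- move=> x _ /=; rewrite lee_fin subr0 oppr0 (le_trans (density_le x))// ler_norm//.
- have := integrableZl measurableT M (integrable_pw_right 0 1 ltr01).
  by apply: eq_integrable => // x _.
Qed.

(** As [fp] vanishes beyond 1 and the kernel grows when the distance shrinks, q may be replaced by
    min(q, 1). The resulting bounds are uniform over all real q. *)
Lemma density_pw_le q p : `|pw (- b) (q - p) * fp p| <=
  M * (pw 0 (p - 0) * pw (- b) (Num.min q 1 - p)).
Proof.
rewrite normrM ger0_norm ?pw_ge0// subr0.
apply: (le_trans (ler_wpM2l (pw_ge0 _ _) (density_le p))).
rewrite mulrCA ler_wpM2l// mulrCA ler_wpM2l ?pw_ge0//.
have [p1|p1] := ltP p 1; last by rewrite (@pw_le0 _ _ (1 - p)) ?subr_le0// mulr0 pw_ge0.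
have [pq|pq] := ltP p q; last by rewrite pw_le0 ?subr_le0// mul0r pw_ge0.
rewrite pwE ?subr_gt0// [pw 0 _]pwE ?subr_gt0// powRr0 mulr1 -pwE ?subr_gt0//.
apply: pw_antimono; first exact: ltW.
  by rewrite subr_gt0 lt_min pq p1.
by rewrite lerD2r ge_min lexx.
Qed.

Lemma integrable_density_pw q :
  mu.-integrable setT (EFin \o (fun p => pw (- b) (q - p) * fp p)).
Proof.
apply: (@le_integrable _ _ _ mu setT _ _ (EFin \o (fun p => M * (pw 0 (p - 0) * pw (- b) (Num.min q 1 - p))))) => //.
- apply/measurable_EFinP; apply: measurable_funM => //.
  by apply: measurable_pw_comp; exact: measurable_funB.
- by move=> p _ /=; rewrite lee_fin (le_trans (density_pw_le q p))// ler_norm.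
- have := integrableZl measurableT M (integrable_pw_right 0 (Num.min q 1) b1).
  by apply: eq_integrable => // x _.
Qed.

Lemma pw_min1_le q : pw (1 - b) (Num.min q 1) <= 1.
Proof.
apply: (@le_trans _ _ (pw (1 - b) 1)).
  by apply: pw_mono; rewrite ?subr_ge0 ?(ltW b1)// ge_min lexx orbT.
by rewrite pwE// powR1.
Qed.

Lemma integral_density_pw_le q :
  (\int[mu]_p (pw (- b) (q - p) * `|fp p|)%:E <= (M / (1 - b))%:E)%E.
Proof.
have b1' : 0 < 1 - b by rewrite subr_gt0.
apply: (@le_trans _ _ (\int[mu]_p (M%:E * (pw 0 (p - 0) * pw (1 - b - 1) (Num.min q 1 - p))%:E))%E).
  apply: ge0_le_integral => //.
  - by move=> p _; rewrite lee_fin mulr_ge0 ?pw_ge0.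
  - apply/measurable_EFinP; apply: measurable_funM; last exact: measurableT_comp.
    by apply: measurable_pw_comp; exact: measurable_funB.
  - apply: emeasurable_funM => //; apply/measurable_EFinP.
    by apply: measurable_funM; apply: measurable_pw_comp; exact: measurable_funB.
  - move=> p _; rewrite -EFinM lee_fin (_ : 1 - b - 1 = - b); last by ring.
    by have := density_pw_le q p; rewrite normrM ger0_norm ?pw_ge0.
rewrite ge0_integralZl//; last 2 first.
- apply/measurable_EFinP.
  by apply: measurable_funM; apply: measurable_pw_comp; exact: measurable_funB.
- by move=> p _; rewrite lee_fin mulr_ge0 ?pw_ge0.
rewrite integral_pw_right// -EFinM lee_fin mulrA ler_wpM2r ?invr_ge0 ?(ltW b1')//.
by rewrite subr0 ler_piMr// pw_min1_le.
Qed.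

(** Up to the factor Gamma(1 - b), the fractional integral of order 1 - b of [fp], that is, the
    Caputo derivative of order b of its primitive. *)
Definition density_conv q : R := \int[mu]_p (pw (- b) (q - p) * fp p).

Lemma density_conv_le q : `|density_conv q| <= M / (1 - b).
Proof.
apply: (@le_trans _ _ (\int[mu]_p (M * (pw 0 (p - 0) * pw (- b) (Num.min q 1 - p))))).
  apply: le_norm_Rintegral.
  - exact: integrable_density_pw.
  - have := integrableZl measurableT M (integrable_pw_right 0 (Num.min q 1) b1).
    by apply: eq_integrable => // x _.
  - exact: density_pw_le.
rewrite RintegralZl//; last exact: integrable_pw_right.
rewrite Rintegral_pw_right// mulrA ler_wpM2r ?invr_ge0 ?subr_ge0 ?(ltW b1)//.
by rewrite subr0 ler_piMr// pw_min1_le.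
Qed.

(** Split the integral at q. Below q the two kernels are ordered, and the integral of their
    difference over p > 0 is explicit: with truncated powers it is (q^(1-b) - q'^(1-b) + (q' -
    q)^(1-b)) / (1 - b), at most its last term. Above q only the kernel of q' remains. Each part
    contributes one M / (1 - b). *)
Lemma density_conv_holder q q' : q < q' ->
  `|density_conv q' - density_conv q| <= 2 * M / (1 - b) * (q' - q) `^ (1 - b).
Proof.
move=> qq'; have b1' : 0 < 1 - b by rewrite subr_gt0.
have iq := integrable_density_pw q; have iq' := integrable_density_pw q'.
pose v x p := pw 0 (p - 0) * pw (- b) (x - p).
have iv x : mu.-integrable setT (EFin \o v x) by exact: integrable_pw_right.
have iM (u : R -> R) : mu.-integrable setT (EFin \o u) -> mu.-integrable setT (EFin \o (fun p => M * u p)).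
  by move=> iu; have := integrableZl measurableT M iu; apply: eq_integrable => // x _.
have iB (u w : R -> R) : mu.-integrable setT (EFin \o u) -> mu.-integrable setT (EFin \o w) ->
    mu.-integrable setT (EFin \o (fun p => u p - w p)).
  by move=> iu iw; have := integrableB measurableT iu iw; apply: eq_integrable => // x _.
have E1 : density_conv q' - density_conv q =
  \int[mu]_p (pw 0 (q - p) * (pw (- b) (q' - p) * fp p) - pw (- b) (q - p) * fp p) +
  \int[mu]_p (pw 0 (p - q) * (pw (- b) (q' - p) * fp p)).
  rewrite RintegralB//; last exact: integrable_pw0M.
  by rewrite /density_conv -(Rintegral_pw0_split q iq') addrAC.
have B1 : `|\int[mu]_p (pw 0 (q - p) * (pw (- b) (q' - p) * fp p) - pw (- b) (q - p) * fp p)| <=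
   M * ((q' - q) `^ (1 - b) / (1 - b)).
  apply: (@le_trans _ _ (\int[mu]_p (M * (v q p - pw 0 (q - p) * v q' p)))).
    apply: le_norm_Rintegral.
    - by apply: iB => //; exact: integrable_pw0M.
    - by apply: iM; apply: iB => //; exact: integrable_pw0M.
    move=> p; rewrite mulrA -mulrBl normrM mulrC.
    apply: (le_trans (ler_wpM2r (normr_ge0 _) (density_le p))).
    rewrite -mulrA ler_wpM2l// /v subr0 mulrCA -mulrBr -mulrA ler_wpM2l ?pw_ge0//.
    have [pq|qp] := ltP p q; last first.
      by rewrite !(@pw_le0 _ _ (q - p)) ?subr_le0// !mul0r subrr normr0 mulr0.
    rewrite [pw 0 (q - p)]pwE ?subr_gt0// powRr0 !mul1r distrC ger0_norm; last first.
      rewrite subr_ge0; apply: pw_antimono; [exact: ltW|by rewrite subr_gt0|].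
      by rewrite lerD2r ltW.
    rewrite ler_piMl// ?pw0_le1// subr_ge0; apply: pw_antimono; [exact: ltW|by rewrite subr_gt0|].
    by rewrite lerD2r ltW.
  rewrite RintegralZl//; last by apply: iB => //; exact: integrable_pw0M.
  rewrite ler_wpM2l// RintegralB//; last exact: integrable_pw0M.
  have := Rintegral_pw0_split q (iv q').
  rewrite {3}/v Rintegral_pw_right// => h.
  have {}h : \int[mu]_t (pw 0 (q - t) * v q' t) = pw (1 - b) (q' - 0) / (1 - b) -
     \int[mu]_t (pw 0 (t - q) * v q' t) by rewrite -h addrK.
  rewrite h /v Rintegral_pw_right// opprB addrCA -[leRHS]addr0 lerD//; last first.
    rewrite subr_le0 ler_wpM2r ?invr_ge0 ?(ltW b1')//; apply: pw_mono; first exact: ltW.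
    by rewrite lerD2r ltW.
  rewrite -(pwE (1 - b) (_ : 0 < q' - q)) ?subr_gt0// -Rintegral_pw_right//.
  apply: le_Rintegral => //.
  - by apply: integrable_pw0M'; exact: integrable_pw_right.
  - exact: integrable_pw_right.
  - by move=> p _; rewrite ler_wpM2l ?pw_ge0// ler_piMl ?pw_ge0 ?pw0_le1.
have B2 : `|\int[mu]_p (pw 0 (p - q) * (pw (- b) (q' - p) * fp p))| <=
   M * ((q' - q) `^ (1 - b) / (1 - b)).
  rewrite -(pwE (1 - b) (_ : 0 < q' - q)) ?subr_gt0// -Rintegral_pw_right// -RintegralZl//; last first.
    exact: integrable_pw_right.
  apply: le_norm_Rintegral.
  - exact: integrable_pw0M'.
  - by apply: iM; exact: integrable_pw_right.
  move=> p; rewrite mulrA normrM ger0_norm ?mulr_ge0 ?pw_ge0// mulrC.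
  by rewrite ler_wpM2r ?mulr_ge0 ?pw_ge0.
rewrite E1; apply: (le_trans (ler_normD _ _)); apply: (le_trans (lerD B1 B2)).
by rewrite le_eqVlt; apply/orP; left; apply/eqP; field; rewrite gt_eqF.
Qed.

Lemma continuous_density_conv : continuous density_conv.
Proof.
have b1' : 0 < 1 - b by rewrite subr_gt0.
move=> q; apply/cvgrPdist_le => e e0.
pose K := 2 * M / (1 - b).
have K1 : 0 < K + 1 by rewrite ltr_wpDl// divr_ge0 ?mulr_ge0// ltW.
have := powR_cvg0 b1'; move/cvgrPdist_le => /(_ (e / (K + 1))).
rewrite divr_gt0// => /(_ isT); rewrite near_withinE => /nbhs_ballP[r /= r0 rP].
near=> y.
have yq : `|q - y| < r by near: y; apply: (nbhsx_ballx q); rewrite ?r0.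
have main u w : u < w -> w - u < r -> `|density_conv w - density_conv u| <= e.
  move=> uw wur; apply: (le_trans (density_conv_holder uw)).
  have wu0 : 0 < w - u by rewrite subr_gt0.
  have := rP (w - u); rewrite /ball/= sub0r normrN (gtr0_norm wu0) => /(_ wur wu0).
  rewrite sub0r normrN ger0_norm ?powR_ge0// => h.
  apply: (@le_trans _ _ ((K + 1) * (w - u) `^ (1 - b))).
    by rewrite ler_wpM2r ?powR_ge0// lerDl.
  by rewrite mulrC -ler_pdivlMr.
have [qy|yq'|->] := ltgtP q y; last by rewrite subrr normr0 ltW.
  by rewrite distrC; apply: main => //; rewrite -(gtr0_norm (_ : 0 < y - q)) ?subr_gt0// distrC.
by apply: main => //; rewrite -(gtr0_norm (_ : 0 < q - y)) ?subr_gt0.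
Unshelve. all: by end_near. Qed.

End bounded_density.
End fubini_kernel.

(** * From the weak equation to a formula for the convolution of f' *)

Section weak_derivative.
Context {R : realType}.
Local Notation mu := (@lebesgue_measure R).
Local Notation mu2 := (mu \x mu)%E.

Section bounded_density.
Variables (b M : R) (fp : R -> R).
Hypotheses (b01 : 0 < b < 1) (mfp : measurable_fun setT fp)
  (fpM : forall x, `|fp x| <= M) (fp0 : forall x, ~~ (0 < x < 1) -> fp x = 0).

Let b0 : 0 < b. Proof. by case/andP: b01. Qed.
Let b1 : b < 1. Proof. by case/andP: b01. Qed.
Let ifp := integrable_bounded_density mfp fpM fp0.

Lemma density_conv_primitive x :
  \int[mu]_y (pw (- b) (x - y) * \int[mu]_t (pw 0 (y - t) * fp t)) =
  \int[mu]_y (pw 0 (x - y) * density_conv b fp y).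
Proof.
have fpt0 t : t <= 0 -> fp t = 0 by move=> t0; rewrite fp0// ltNge t0.
transitivity (\int[mu]_t (fp t * (pw (1 - b) (x - t) / (1 - b)))).
  (* The restriction to y > 0 makes the kernel integrable towards -oo; the inner primitive of [fp]
     vanishes for y <= 0 anyway. *)
  pose u y := pw 0 (y - 0) * pw (- b) (x - y).
  have iu : mu.-integrable setT (EFin \o u) by exact: integrable_pw_right.
  transitivity (\int[mu]_y (u y * \int[mu]_t (pw 0 (y - t) * fp t))).
    apply: eq_Rintegral => y _; rewrite /u subr0.
    have [y0|y0] := ltP 0 y; first by rewrite [pw 0 y]pwE// powRr0 mul1r.
    suff -> : \int[mu]_t (pw 0 (y - t) * fp t) = 0 by rewrite !mulr0.
    rewrite /Rintegral integral0_eq// => t _; congr EFin.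
    have [ty|yt] := ltP t y; first by rewrite fpt0 ?mulr0// (le_trans (ltW ty)).
    by rewrite pw_le0 ?mul0r// subr_le0.
  rewrite (Rintegral_triangleC iu ifp); apply: eq_Rintegral => t _.
  have [t0|t0] := ltP 0 t; last by rewrite fpt0// !mul0r.
  congr (_ * _); rewrite -Rintegral_pw_right//; apply: eq_Rintegral => y _.
  rewrite /u subr0; have [ty|yt] := ltP t y.
    by rewrite [pw 0 y]pwE ?mul1r ?powRr0 ?mul1r// (lt_trans t0).
  by rewrite pw_le0 ?subr_le0// !mul0r.
pose u y := pw 0 (y - 0) * pw (- 0) (x - y).
have iu : mu.-integrable setT (EFin \o u) by exact: integrable_pw_right.
transitivity (\int[mu]_y (u y * density_conv b fp y)); last first.
  apply: eq_Rintegral => y _; rewrite /u subr0 oppr0.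
  have [y0|y0] := ltP 0 y; first by rewrite [pw 0 y]pwE// powRr0 mul1r.
  suff -> : density_conv b fp y = 0 by rewrite !mulr0.
  rewrite /density_conv /Rintegral integral0_eq// => t _; congr EFin.
  have [ty|yt] := ltP t y; first by rewrite fpt0 ?mulr0// (le_trans (ltW ty)).
  by rewrite pw_le0 ?mul0r// subr_le0.
apply/esym.
rewrite (@Rintegral_kernelC _ (fun z => pw (- b) (z.2 - z.1)) u fp); last 3 first.
- apply: integrable_singular_prod => //; exact: integral_density_pw_le.
- by move=> y; exact: integrable_density_pw.
- move=> t.
  apply: (@le_integrable _ _ _ mu setT _ _ (EFin \o (fun y => pw (- b) (y - t) * pw 0 (x - y)))) => //.
  + apply/measurable_EFinP => /=; apply: measurable_funM.
      by apply: measurable_pw_comp; exact: measurable_funB.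
    by apply: measurable_funM; apply: measurable_pw_comp; exact: measurable_funB.
  + move=> y _ /=; rewrite lee_fin !ger0_norm ?mulr_ge0 ?pw_ge0//.
    by rewrite /u ler_wpM2l ?pw_ge0// oppr0 ler_piMl ?pw_ge0 ?pw0_le1.
  + apply/integrableP; split.
      by apply/measurable_EFinP; apply: measurable_funM; apply: measurable_pw_comp; exact: measurable_funB.
    have := @integral_pw_left R (1 - b) t x; rewrite (_ : 1 - b - 1 = - b); last by ring.
    move=> h; under eq_integral do rewrite /= ger0_norm ?mulr_ge0 ?pw_ge0//.
    by rewrite h ?ltry// subr_gt0.
apply: eq_Rintegral => t _.
have [t0|t0] := ltP 0 t; last by rewrite fpt0// !mul0r.
congr (_ * _); rewrite -Rintegral_pw_left//; apply: eq_Rintegral => y _.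
rewrite /u subr0 oppr0; have [ty|yt] := ltP t y.
  by rewrite [pw 0 y]pwE ?powRr0 ?mul1r// (lt_trans t0).
by rewrite pw_le0 ?subr_le0// !mul0r.
Qed.
End bounded_density.

Lemma test_function_out (phi : R -> R) K n x :
  compact K -> (forall y, ~ K y -> phi y = 0) -> ~ K x -> derive1n n phi x = 0.
Proof.
move=> cK; elim: n phi => [|n IH] phi phi0 Kx; first exact: phi0.
rewrite derive1Sn; apply: IH => // y Ky.
have oK : open (~` K) by apply: closed_openC; apply: compact_closed => //; exact: Rhausdorff.
rewrite derive1E (@near_eq_derive _ _ _ phi (cst 0)) ?derive_cst//.
have : nbhs y (~` K) by apply: open_nbhs_nbhs; split.
by apply: filterS => z Kz; exact: phi0.
Qed.

Lemma test_function_derive (phi : R -> R) : test_function phi -> test_function phi^`()%classic.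
Proof.
move=> [sphi [K [cK K01 phi0]]]; split.
  by move=> n x; rewrite -derive1Sn; exact: (sphi n.+1).
by exists K; split => // x Kx; have := test_function_out 1 cK phi0 Kx.
Qed.

Lemma test_function_out01 (phi : R -> R) x : test_function phi -> ~~ (0 < x < 1) -> phi x = 0.
Proof.
move=> [_ [K [_ K01 phi0]]] x01; apply: phi0 => Kx.
by have := K01 _ Kx; rewrite /= in_itv/= (negbTE x01).
Qed.

Lemma test_function_continuous (phi : R -> R) : test_function phi -> continuous phi.
Proof.
move=> [sphi _] x; apply/differentiable_continuous/derivable1_diffP.
exact: (sphi 0%N).
Qed.

Lemma test_function_integrable (phi : R -> R) : test_function phi ->
  mu.-integrable setT (EFin \o phi).
Proof.
move=> tphi; have cphi := test_function_continuous tphi.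
have : mu.-integrable `[0, 1] (EFin \o phi).
  apply: continuous_compact_integrable; first exact: segment_compact.
  by apply: continuous_subspaceT.
move/integrable_mkcond => /(_ (measurable_itv _)); apply: eq_integrable => //.
move=> x _; rewrite patchE; case: ifPn => //= /negP h.
rewrite (test_function_out01 tphi)//; apply/negP => /andP[ax xa]; apply: h.
by rewrite inE/= in_itv/= !ltW.
Qed.

Lemma test_function_primitive (phi : R -> R) x : test_function phi ->
  phi x = \int[mu]_t (pw 0 (x - t) * phi^`()%classic t).
Proof.
move=> tphi; have tphi' := test_function_derive tphi.
have cphi := test_function_continuous tphi.
have cphi' := test_function_continuous tphi'.
have dphi y : derivable phi y 1 by case: tphi => h _; exact: (h 0%N).
(* A starting point to the left of both x and 0, where [phi] vanishes. *)
pose a := Num.min x 0 - 1.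
have ax : a < x by rewrite /a; case: (ltP x 0); lra.
have a0 : a < 0 by rewrite /a; case: (ltP x 0); lra.
have : (\int[mu]_(t in `[a, x]) (phi^`()%classic t)%:E = (phi x)%:E - (phi a)%:E)%E.
  apply: continuous_FTC2 => //.
  - exact: continuous_subspaceT.
  - split; first by move=> y _; exact: dphi.
    + by apply: cvg_at_right_filter; exact: cphi.
    + by apply: cvg_at_left_filter; exact: cphi.
rewrite (test_function_out01 (x := a) tphi); last by rewrite negb_and -!leNgt (ltW a0).
rewrite sube0 => h.
rewrite -[LHS]/(fine (phi x)%:E) -h; congr fine.
rewrite -integral_itv_bndo_bndc; last first.
  by apply/measurable_EFinP; apply: measurable_funTS; exact: continuous_measurable_fun.
rewrite [LHS]integral_mkcond; apply: eq_integral => t _.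
rewrite patchE mem_setE in_itv/= pw0E subr_gt0.
have [tx|xt] := ltP t x; last by rewrite andbF mul0r.
rewrite andbT mul1r; case: ifPn => //; rewrite -ltNge => ta.
by rewrite (test_function_out01 tphi')// negb_and -!leNgt (ltW (lt_trans ta a0)).
Qed.

Lemma Rintegral_test_derive (phi : R -> R) : test_function phi ->
  \int[mu]_x phi^`()%classic x = 0.
Proof.
move=> tphi; have tphi' := test_function_derive tphi.
rewrite -(test_function_out01 (x := 1) tphi) ?ltxx ?andbF//.
rewrite (test_function_primitive 1 tphi); apply: eq_Rintegral => t _.
have [t1|t1] := ltP t 1; first by rewrite pwE ?subr_gt0// powRr0 mul1r.
by rewrite (test_function_out01 tphi') ?mulr0// negb_and -!leNgt t1 orbT.
Qed.

Lemma Rintegral_test_tail (phi : R -> R) y : test_function phi ->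
  \int[mu]_x (pw 0 (x - y) * phi^`()%classic x) = - phi y.
Proof.
move=> tphi; have tphi' := test_function_derive tphi.
have := Rintegral_pw0_split y (test_function_integrable tphi').
rewrite -test_function_primitive// Rintegral_test_derive// => h.
by apply/eqP; rewrite -addr_eq0 addrC h.
Qed.

Lemma continuous_primitive (g : R -> R) : mu.-integrable setT (EFin \o g) ->
  (forall x, x <= 0 -> g x = 0) ->
  forall q, 0 < q < 1 -> {for q, continuous (fun q => \int[mu]_p (pw 0 (q - p) * g p))}.
Proof.
move=> ig g0 q /andP[q0 q1].
have i01 : mu.-integrable `[0, 1] (EFin \o g) by apply: integrableS ig.
have E x : 0 < x -> \int[mu]_p (pw 0 (x - p) * g p) = \int[mu]_(t in `[0, x]) g t.
  move=> x0.
  rewrite -Rintegral_itv_bndo_bndc; last by apply: integrableS ig.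
  rewrite [RHS]Rintegral_mkcond; apply: eq_Rintegral => p _.
  rewrite patchE mem_setE in_itv/= pw0E subr_gt0.
  have [px|xp] := ltP p x; last by rewrite andbF mul0r.
  by rewrite mul1r andbT; case: ifPn => //; rewrite -ltNge => /ltW/g0.
have := parameterized_integral_continuous ler01 i01.
move=> /(continuous_within_itvP _ ltr01)[+ _ _] => /(_ q).
rewrite in_itv/= q0 q1 => /(_ isT).
rewrite /prop_for /continuous_at E// /parameterized_integral.
apply: cvg_trans.
apply: near_eq_cvg; near=> x.
rewrite E//; near: x; exact: lt_nbhsr.
Unshelve. all: by end_near. Qed.

(** Both sides of the weak equation are integrated by parts, through Fubini, until only phi' is
    left. Then [H] is orthogonal to the derivatives of all test functions, hence constant on (0,
    1). *)
Lemma weak_derivative_density (b M A : R) (fp g : R -> R) :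
  0 < b < 1 -> measurable_fun setT fp -> (forall x, `|fp x| <= M) ->
  (forall x, ~~ (0 < x < 1) -> fp x = 0) ->
  0 < A -> mu.-integrable setT (EFin \o g) -> (forall x, ~~ (0 < x < 1) -> g x = 0) ->
  (forall phi, test_function phi ->
    \int[mu]_(x in `]0, 1[) (A^-1 * \int[mu]_y (pw (- b) (x - y) *
        \int[mu]_t (pw 0 (y - t) * fp t)) * derive1n 2 phi x) =
    \int[mu]_(x in `]0, 1[) (g x * phi x)) ->
  exists k0, forall q, 0 < q < 1 ->
    density_conv b fp q = k0 + A * \int[mu]_p (pw 0 (q - p) * g p).
Proof.
move=> b01 mfp fpM fp0 A0 ig g0 W.
have [b0 b1] := andP b01.
pose G q := \int[mu]_p (pw 0 (q - p) * g p).
pose H q := A^-1 * density_conv b fp q - G q.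
have cdc : continuous (density_conv b fp) by exact: continuous_density_conv mfp fpM fp0.
have dcM := density_conv_le b01 mfp fpM fp0.
have cH q : 0 < q < 1 -> {for q, continuous H}.
  move=> q01; apply: cvgB; first by apply: cvgMr; exact: cdc.
  by apply: continuous_primitive => // x x0; rewrite g0// ltNge x0.
pose MG := \int[mu]_p `|g p|.
have GM q : `|G q| <= MG.
  apply: le_norm_Rintegral; [exact: integrable_pw0M|exact: integrable_norm ig|].
  by move=> x; rewrite normrM ger0_norm ?pw_ge0// ler_piMl// pw0_le1.
have mH : measurable_fun (`]0, 1[%classic : set R) H.
  apply: open_continuous_measurable_fun; first exact: interval_open.
  by move=> q; rewrite inE/= in_itv/= => q01; exact: cH.
have HM x : 0 < x < 1 -> `|H x| <= A^-1 * (M / (1 - b)) + MG.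
  move=> _; apply: (le_trans (ler_normB _ _)); apply: lerD => //.
  by rewrite normrM (gtr0_norm (_ : 0 < A^-1)) ?invr_gt0// ler_pM2l ?invr_gt0.
(* [density_conv] need not vanish beyond 1, where it may decay only like q^(-b); the cut to (0, 1)
   makes it integrable. *)
pose dc1 y := density_conv b fp y * (pw 0 (y - 0) * pw (- 0) (1 - y)).
have idc1 : mu.-integrable setT (EFin \o dc1).
  have -> : EFin \o dc1 = ((EFin \o density_conv b fp) \*
      (EFin \o (fun y => pw 0 (y - 0) * pw (- 0) (1 - y))%R))%E.
    by apply/funext => y; rewrite /dc1 /= EFinM.
  apply: integrableMr => //; last exact: integrable_pw_right.
    exact: continuous_measurable_fun.
  exists (M / (1 - b)); split; first exact: num_real.
  by move=> y My x _; exact: le_trans (dcM x) (ltW My).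
have dcE y : 0 < y < 1 -> dc1 y = density_conv b fp y.
  by move=> /andP[y0 y1]; rewrite /dc1 subr0 oppr0 !pw0E subr_gt0 y0 y1 !mulr1.
have dc0 y : ~~ (0 < y < 1) -> dc1 y = 0.
  by rewrite /dc1 subr0 oppr0 !pw0E subr_gt0 negb_and => /orP[]/negbTE->; rewrite ?(mulr0, mul0r).
(* [K] is controlled on (0, 1) only; the test function vanishes elsewhere. *)
have iphiM (phi K : R -> R) (C : R) : test_function phi -> measurable_fun (`]0, 1[%classic : set R) K ->
    (forall x, 0 < x < 1 -> `|K x| <= C) ->
    mu.-integrable setT (EFin \o (fun t => phi t * K t)).
  move=> tphi mK KC; have iphi := test_function_integrable tphi.
  have E : (fun t => phi t * K t) = (fun t => phi t * K t) \_ (`]0, 1[%classic : set R).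
    apply/funext => t; rewrite patchE mem_setE in_itv/=.
    by case: ifPn => // h; rewrite (test_function_out01 tphi)// mul0r.
  apply: (@le_integrable _ _ _ mu setT _ _ (EFin \o (fun t => C * phi t))) => //.
  - apply/measurable_EFinP; rewrite E; apply/(measurable_restrictT _ (measurable_itv _)).
    apply: measurable_funM => //; apply: measurable_funTS.
    exact: continuous_measurable_fun (test_function_continuous tphi).
  - move=> t _ /=; rewrite lee_fin !normrM mulrC.
    have [t01|t01] := boolP (0 < t < 1); last by rewrite (test_function_out01 tphi)// normr0 !mulr0.
    by rewrite ler_wpM2r// (le_trans (KC _ t01))// ler_norm.
  - have := integrableZl measurableT C iphi; apply: eq_integrable => // x _.
have mG : measurable_fun (`]0, 1[%classic : set R) G.
  apply: open_continuous_measurable_fun; first exact: interval_open.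
  move=> q; rewrite inE/= in_itv/= => q01.
  by apply: continuous_primitive => // x x0; rewrite g0// ltNge x0.
have Hphi phi : test_function phi -> \int[mu]_(x in `]0, 1[) (H x * phi^`()%classic x) = 0.
  move=> tphi; have tphi' := test_function_derive tphi.
  have tphi'' := test_function_derive tphi'.
  have iphi' := test_function_integrable tphi'.
  have iphi'' := test_function_integrable tphi''.
  have := W _ tphi.
  have -> : \int[mu]_(x in `]0, 1[) (g x * phi x) = - \int[mu]_t (phi^`()%classic t * G t).
    transitivity (\int[mu]_x (g x * \int[mu]_t (pw 0 (x - t) * phi^`()%classic t))).
      rewrite Rintegral_mkcond; apply: eq_Rintegral => x _.
      rewrite -test_function_primitive// patchE mem_setE in_itv/=.
      by case: ifPn => // h; rewrite g0// mul0r.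
    rewrite (Rintegral_triangleC ig iphi').
    have -> : \int[mu]_t (phi^`()%classic t * \int[mu]_x (pw 0 (x - t) * g x)) =
       \int[mu]_t ((\int[mu]_x g x) * phi^`()%classic t - phi^`()%classic t * G t).
      apply: eq_Rintegral => t _; rewrite -(Rintegral_pw0_split t ig) -/(G t); ring.
    rewrite RintegralB//; last 2 first.
    - have := integrableZl measurableT (\int[mu]_x g x) iphi'; apply: eq_integrable => // x _.
    - by apply: iphiM => // x _; exact: GM.
    by rewrite RintegralZl// Rintegral_test_derive// mulr0 sub0r.
  have -> : \int[mu]_(x in `]0, 1[) (A^-1 * \int[mu]_y (pw (- b) (x - y) *
        \int[mu]_t (pw 0 (y - t) * fp t)) * derive1n 2 phi x) =
      - (A^-1 * \int[mu]_y (dc1 y * phi^`()%classic y)).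
    transitivity (\int[mu]_x (A^-1 * (phi^`()^`()%classic x * \int[mu]_y (pw 0 (x - y) * dc1 y)))).
      rewrite [LHS]Rintegral_mkcond; apply: eq_Rintegral => x _.
      rewrite patchE mem_setE in_itv/=; case: ifPn => [x01|x01]; last first.
        by rewrite (test_function_out01 tphi'')// mul0r mulr0.
      rewrite (density_conv_primitive b01 mfp fpM fp0) -mulrA; congr (_ * _); rewrite mulrC; congr (_ * _).
      apply: eq_Rintegral => y _.
      have [/dcE->//|y01] := boolP (0 < y < 1).
      rewrite dc0//; have [yx|xy] := ltP y x; last by rewrite pw_le0 ?subr_le0// !mul0r.
      have y0 : y <= 0.
        by move: y01; rewrite negb_and -!leNgt => /orP[//|y1]; case/andP: x01 => _ x1; lra.
      suff -> : density_conv b fp y = 0 by rewrite !mulr0.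
      rewrite /density_conv /Rintegral integral0_eq// => t _; congr EFin.
      have [ty|yt] := ltP t y; last by rewrite pw_le0 ?mul0r// subr_le0.
      by rewrite fp0 ?mulr0// negb_and -!leNgt (ltW (lt_le_trans ty y0)).
    have iK : mu.-integrable setT (EFin \o (fun x => phi^`()^`()%classic x * \int[mu]_y (pw 0 (x - y) * dc1 y))).
      apply: (@iphiM _ _ (\int[mu]_y `|dc1 y|)) => //.
        apply: open_continuous_measurable_fun; first exact: interval_open.
        move=> q; rewrite inE/= in_itv/= => q01.
        by apply: continuous_primitive => // x x0; rewrite dc0// ltNge x0.
      move=> x _; apply: le_norm_Rintegral; [exact: integrable_pw0M|exact: integrable_norm idc1|].
      by move=> t; rewrite normrM ger0_norm ?pw_ge0// ler_piMl// pw0_le1.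
    rewrite RintegralZl// -mulrN; congr (_ * _).
    rewrite (Rintegral_triangleC iphi'' idc1).
    have -> : - (\int[mu]_y (dc1 y * phi^`()%classic y)) = \int[mu]_y ((-1) * (dc1 y * phi^`()%classic y)).
      rewrite RintegralZl ?mulN1r//.
      have -> : (fun y => dc1 y * phi^`()%classic y) = (fun y => phi^`()%classic y * dc1 y).
        by apply/funext => y; rewrite mulrC.
      apply: (@iphiM _ _ (M / (1 - b))) => //.
        by apply: measurable_funTS; apply/measurable_EFinP; exact: measurable_int idc1.
      by move=> x x01; rewrite dcE.
    by apply: eq_Rintegral => y _; rewrite Rintegral_test_tail// mulrN mulN1r.
  move=> /eqP; rewrite eqr_opp => /eqP E.
  transitivity (\int[mu]_x (A^-1 * (dc1 x * phi^`()%classic x) - phi^`()%classic x * G x)).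
    rewrite [LHS]Rintegral_mkcond; apply: eq_Rintegral => x _.
    rewrite patchE mem_setE in_itv/=; case: ifPn => [x01|x01].
      by rewrite dcE// /H; ring.
    by rewrite (test_function_out01 tphi')// mulr0 mul0r mulr0 subr0.
  have iD : mu.-integrable setT (EFin \o (fun y => dc1 y * phi^`()%classic y)).
    have -> : (fun y => dc1 y * phi^`()%classic y) = (fun y => phi^`()%classic y * dc1 y).
      by apply/funext => y; rewrite mulrC.
    apply: (@iphiM _ _ (M / (1 - b))) => //.
      by apply: measurable_funTS; apply/measurable_EFinP; exact: measurable_int idc1.
    by move=> x x01; rewrite dcE.
  rewrite RintegralB//; last 2 first.
  - have := integrableZl measurableT A^-1 iD; apply: eq_integrable => // x _.
  - by apply: iphiM => // x _; exact: GM.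
  by rewrite RintegralZl// E subrr.
have cst := du_bois_reymond mH HM cH Hphi.
have h01 : 0 < (2^-1 : R) < 1 by rewrite invr_gt0 ltr0n invf_lt1// ltr1n.
(* The constant value of [H] is read at the reference point 1/2. *)
exists (A * H 2^-1) => q q01.
rewrite -(cst q 2^-1 q01 h01) /H mulrBr mulrA divff ?gt_eqF// mul1r -/(G q); ring.
Qed.

End weak_derivative.

(** * Positivity of Gamma on (0, 1) *)

Section Gamma_positivity.
Context {R : realType}.
Local Notation mu := (@lebesgue_measure R).

(** [Gamma] is a real-valued integral, which would be 0 if the integral diverged; finiteness is
    therefore part of positivity. *)
Lemma Gamma_gt0 (a : R) : 0 < a < 1 -> 0 < Gamma a.
Proof.
move=> /andP[a0 a1].
pose F t := pw (a - 1) t * expR (- t).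
have FE : Gamma a = \int[mu]_t F t.
  rewrite /Gamma Rintegral_mkcond; apply: eq_Rintegral => t _.
  by rewrite patchE mem_setE in_itv/= andbT /F /pw; case: ifPn => //; rewrite mul0r.
have mF : measurable_fun setT F.
  apply: measurable_funM; first exact: measurable_pw.
  apply: measurableT_comp; first exact: measurable_expR.
  by have := @measurable_funN _ _ R setT id; apply; exact: measurable_id.
have F0 t : 0 <= F t by rewrite mulr_ge0 ?pw_ge0 ?expR_ge0.
have mkF (c k p : R) (s : R -> R) : measurable_fun setT s ->
    measurable_fun setT (fun t : R => (c * (pw k (t - p) * pw 0 (s t)))%:E).
  move=> ms; apply/measurable_EFinP; apply: measurable_funM => //.
  by apply: measurable_funM; apply: measurable_pw_comp => //; exact: measurable_funB.
have m1 (c : R) : measurable_fun setT (fun t : R => c - t) by exact: measurable_funB.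
have m2 (c : R) : measurable_fun setT (fun t : R => t - c) by exact: measurable_funB.
have up : (\int[mu]_t (F t)%:E < +oo)%E.
  (* The majorant is t^(a-1) for t < 2 plus 2 t^(-2) for t > 1, the latter from t^2 exp(-t) <= 2!.
     The ranges overlap, so that strict indicators cover every t > 0. *)
  apply: (@le_lt_trans _ _ (\int[mu]_t ((1 * (pw (a - 1) (t - 0) * pw 0 (2 - t)))%:E
      + (2 * (pw (- 1 - 1) (t - 0) * pw 0 (t - 1)))%:E))%E).
    apply: ge0_le_integral => //.
    - by move=> t _; rewrite lee_fin.
    - exact/measurable_EFinP.
    - by apply: emeasurable_funD; apply: mkF.
    move=> t _; rewrite -EFinD lee_fin subr0 mul1r /F.
    have [t0|t0] := ltP 0 t; last by rewrite !(pw_le0 _ t0) !mul0r mulr0 addr0.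
    have [t2|t2] := ltP t 2.
      rewrite pw0E subr_gt0 t2 mulr1 ler_wpDr ?mulr_ge0 ?pw_ge0//.
      by rewrite ler_piMr ?pw_ge0// -expR0 ler_expR; lra.
    rewrite (pw_le0 _ (_ : 2 - t <= 0)); last by lra.
    rewrite mulr0 add0r [pw 0 _]pw0E subr_gt0 (_ : 1 < t); last by lra.
    rewrite mulr1 [leLHS]mulrC [leRHS]mulrC.
    have e2 := expR_pow_le 1 (ltW t0).
    rewrite mulrC; rewrite !pwE// (_ : -1 - 1 = - 2%:R); last by lra.
    rewrite (_ : t `^ (-2) = (t ^+ 2)^-1); last by rewrite powRN powR_mulrn ?ltW.
    have ta : t `^ (a - 1) <= 1.
      by rewrite -[leRHS](powRr0 t) ler_powR; lra.
    apply: (@le_trans _ _ (expR (- t))).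
      by rewrite ler_piMl ?expR_ge0.
    by rewrite mulrC ler_pdivlMr ?exprn_gt0// mulrC.
  rewrite ge0_integralD//; last 4 first.
  - by move=> t _; rewrite lee_fin !mulr_ge0 ?pw_ge0.
  - exact: mkF.
  - by move=> t _; rewrite lee_fin !mulr_ge0 ?pw_ge0.
  - exact: mkF.
  under eq_integral do rewrite mul1r.
  rewrite integral_pw_left//.
  under [X in (_ + X)%E]eq_integral do rewrite EFinM.
  rewrite ge0_integralZl//; last 2 first.
  - by have := @mkF 1 (-1 - 1) 0 _ (m2 1); apply: eq_measurable_fun => t _; rewrite mul1r.
  - by move=> t _; rewrite lee_fin mulr_ge0 ?pw_ge0.
  by rewrite (@integral_pw_tail R 1 0 1)// -EFinM -EFinD ltry.
have lo : ((expR (- 1) * (pw a (1 - 0) / a))%:E <= \int[mu]_t (F t)%:E)%E.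
  rewrite EFinM -integral_pw_left// -ge0_integralZl//.
  - apply: ge0_le_integral => //.
    + by move=> t _; rewrite -EFinM lee_fin !mulr_ge0 ?pw_ge0 ?expR_ge0.
    + exact: mkF.
    + exact/measurable_EFinP.
    move=> t _; rewrite -EFinM lee_fin subr0 /F mulrCA.
    apply: ler_wpM2l; first exact: pw_ge0.
    have [t1|t1] := ltP t 1; last by rewrite [X in _ * X]pw_le0 ?mulr0 ?expR_ge0//; lra.
    by rewrite -[leRHS]mulr1 ler_pM ?expR_ge0 ?pw_ge0 ?pw0_le1// ler_expR; lra.
  - by have := @mkF 1 (a - 1) 0 _ (m1 1); apply: eq_measurable_fun => t _; rewrite mul1r.
  - by move=> t _; rewrite lee_fin mulr_ge0 ?pw_ge0.
rewrite FE /Rintegral fine_gt0//; apply/andP; split => //.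
apply: lt_le_trans lo.
by rewrite lte_fin subr0 !mulr_gt0 ?expR_gt0 ?invr_gt0// pwE// powR_gt0.
Qed.

End Gamma_positivity.

(** * A bounded density for a C^1 function *)

Section C1_density.
Context {R : realType}.
Local Notation mu := (@lebesgue_measure R).
Variables (f f' : R -> R).
Hypothesis ff' : C1_with_derivative f f'.

Lemma C1_difference_quotient (x e : R) : 0 <= x <= 1 -> 0 < e ->
  exists2 r, 0 < r & forall y, 0 <= y <= 1 -> `|y - x| < r ->
    `|f y - f x - f' x * (y - x)| <= e * `|y - x|.
Proof.
move=> x01 e0; have [h _] := ff'.
have /cvgrPdist_le/(_ _ e0) := h x x01.
move=> [r /= r0 hr]; exists r => // y y01 yx.
have [->|yNx] := eqVneq y x; first by rewrite !subrr mulr0 subrr normr0 mulr0.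
have yx0 : y - x != 0 by rewrite subr_eq0.
have := hr y; rewrite /ball/= distrC => /(_ yx yNx y01) {}hr.
rewrite -[X in X - _](divfK yx0) -mulrBl normrM distrC.
by apply: ler_wpM2r hr; exact: normr_ge0.
Qed.

Lemma C1_within_continuous : {within `[0, 1], continuous f}.
Proof.
apply/subspace_continuousP => x x01; have /= {}x01 : 0 <= x <= 1 by move: x01; rewrite /= in_itv.
apply/cvgrPdist_le => e e0.
have [r r0 hr] := C1_difference_quotient x01 ltr01.
pose K := 1 + `|f' x|; have K0 : 0 < K by rewrite /K ltr_pwDl.
exists (Num.min r (e / K)) => /=; first by rewrite lt_min r0 divr_gt0.
move=> y /=; rewrite distrC lt_min => /andP[yr yK]; rewrite in_itv/= => y01.
have hy := hr y y01 yr.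
have tri : `|f y - f x| <= `|f y - f x - f' x * (y - x)| + `|f' x * (y - x)|.
  by rewrite -[X in `|X|](subrK (f' x * (y - x))); exact: ler_normD.
suff : `|f y - f x| <= e by rewrite distrC.
apply: (le_trans tri); apply: (le_trans (lerD hy (lexx _))).
by rewrite normrM -mulrDl -ler_pdivlMl// mulrC ltW.
Qed.

Lemma C1_derivative (x : R) : 0 < x < 1 -> is_derive x 1 f (f' x).
Proof.
move=> /andP[x0 x1].
have H : h^-1 *: (f (h *: 1 + x) - f x) @[h --> (0 : R)^'] --> f' x.
  apply/cvgrPdist_le => e e0.
  have [|r r0 hr] := @C1_difference_quotient x e _ e0; first by rewrite !ltW.
  exists (Num.min r (Num.min x (1 - x))) => /=.
    by rewrite !lt_min r0 x0 subr_gt0.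
  move=> h /=; rewrite sub0r normrN !lt_min => /and3P[hr' hx hx1] h0.
  have := hr (h + x); rewrite addrK=> /(_ _ hr').
  move: hx hx1; rewrite !ltr_norml => /andP[? ?] /andP[? ?].
  rewrite /GRing.scale/= mulr1 => hh.
  rewrite -(ler_pM2r (_ : 0 < `|h|)) ?normr_gt0// -normrM mulrBl mulrAC mulVf// mul1r distrC.
  by apply: hh; lra.
by apply: DeriveDef; [apply/cvg_ex; exists (f' x)|exact: cvg_lim].
Qed.

(** The density is f' set to 0 outside (0, 1), so that all later integrals can run over the whole
    line. *)
Lemma C1_density : f 0 = 0 -> exists (M : R) (fp : R -> R), [/\ measurable_fun setT fp,
  (forall x, `|fp x| <= M), (forall x, ~~ (0 < x < 1) -> fp x = 0) &
  forall x : R, 0 <= x <= 1 -> f x = \int[mu]_t (pw 0 (x - t) * fp t)].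
Proof.
move=> f00; have [_ cf'] := ff'.
have [M M0 hM] : exists2 M, 0 <= M & forall x, 0 <= x <= 1 -> `|f' x| <= M.
  have cn : {within `[0, 1], continuous (fun x => `|f' x|)}.
    by move=> x; apply: continuous_comp; [exact: cf'|exact: norm_continuous].
  have [c _ hc] := EVT_max (ler01 : 0 <= 1 :> R) cn.
  by exists `|f' c| => // x x01; apply: hc; rewrite in_itv.
pose fp := f' \_ `]0, 1[.
have fpE x : 0 < x < 1 -> fp x = f' x by move=> x01; rewrite /fp patchE mem_setE in_itv/= x01.
have fp0 x : ~~ (0 < x < 1) -> fp x = 0.
  by move=> /negbTE x01; rewrite /fp patchE mem_setE in_itv/= x01.
exists M, fp; split => //.
- apply/(measurable_restrictT _ (measurable_itv _)).
  apply: (@measurable_funS _ _ (measurableTypeR R) R `[0, 1]%classic `]0, 1[%classic f' (measurable_itv _)).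
    by apply: subset_itv_oo_cc.
  exact: subspace_continuous_measurable_fun.
- move=> x; have [x01|x01] := boolP (0 < x < 1); last by rewrite fp0// normr0.
  by rewrite fpE// hM//; case/andP: x01 => ? ?; rewrite !ltW.
move=> x /andP[]; rewrite le_eqVlt => /predU1P[<- _|x0 x1].
  rewrite f00 /Rintegral integral0_eq// => t _; congr EFin.
  have [t0|t0] := ltP t 0; first by rewrite fp0 ?mulr0// ltNge (ltW t0).
  by rewrite pw_le0 ?mul0r// subr_le0.
have sub : (`[0, x] `<=` `[0, 1])%classic.
  by move=> t /=; rewrite !in_itv/= => /andP[-> tx]; exact: le_trans tx x1.
have cfx := continuous_subspaceW sub cf'.
have cx := continuous_subspaceW sub C1_within_continuous.
have dx : derivable_oo_LRcontinuous f 0 x.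
  have /(continuous_within_itvP _ x0)[_ c0 c1] := cx.
  split => // t; rewrite in_itv/= => /andP[t0 tx].
  have t01 : 0 < t < 1 by rewrite t0 (lt_le_trans tx).
  by case: (C1_derivative t01).
have eqd : {in `]0, x[, f^`()%classic =1 f'}.
  move=> t; rewrite in_itv/= => /andP[t0 tx].
  have t01 : 0 < t < 1 by rewrite t0 (lt_le_trans tx).
  by rewrite derive1E; case: (C1_derivative t01).
have := continuous_FTC2 x0 cfx dx eqd; rewrite f00 -EFinB subr0 => fE.
transitivity (\int[mu]_(t in `[0, x]) f' t); first by rewrite /Rintegral fE.
have i0x : mu.-integrable `[0, x] (EFin \o f').
  by apply: continuous_compact_integrable => //; exact: segment_compact.
rewrite -Rintegral_itv_obnd_cbnd; last first.
  by apply: integrableS i0x => //; exact: subset_itv_oc_cc.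
rewrite -Rintegral_itv_bndo_bndc; last first.
  by apply: integrableS i0x => //; exact: subset_itv_oo_cc.
rewrite Rintegral_mkcond; apply: eq_Rintegral => t _.
rewrite patchE mem_setE in_itv/= pw0E subr_gt0.
have [tx|_] := ltP t x; last by rewrite andbF mul0r.
rewrite andbT mul1r; case: ifPn => t0; last by rewrite fp0// (negbTE t0).
by rewrite fpE// t0 (lt_le_trans tx).
Qed.

End C1_density.

(** * Truncated powers: Hölder bound, densities and convolutions *)

Section truncated_power_sums.
Context {R : realType}.
Local Notation mu := (@lebesgue_measure R).

Lemma integrable_lincomb n (a : 'I_n -> R) (u : 'I_n -> R -> R) :
  (forall i, mu.-integrable setT (EFin \o u i)) ->
  mu.-integrable setT (EFin \o (fun x => \sum_(i < n) a i * u i x)).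
Proof.
move=> iu.
have -> : EFin \o (fun x => \sum_(i < n) a i * u i x) =
    (fun x => \sum_(i < n) (a i)%:E * (u i x)%:E)%E.
  by apply/funext => x /=; rewrite -sumEFin.
by apply: integrable_sum => // i _; apply: (integrableZl measurableT (a i) (iu i)).
Qed.

Lemma Rintegral_lincomb n (a : 'I_n -> R) (u : 'I_n -> R -> R) :
  (forall i, mu.-integrable setT (EFin \o u i)) ->
  \int[mu]_x (\sum_(i < n) a i * u i x) = \sum_(i < n) a i * \int[mu]_x u i x.
Proof.
elim: n a u => [|n IH] a u iu.
  under eq_Rintegral do rewrite big_ord0.
  by rewrite big_ord0 /Rintegral integral0.
under eq_Rintegral do rewrite big_ord_recr/=.
rewrite RintegralD//; last 2 first.
- by apply: integrable_lincomb => i; exact: iu.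
- have := integrableZl measurableT (a ord_max) (iu ord_max).
  by apply: eq_integrable => // x _.
by rewrite big_ord_recr/= IH// RintegralZl.
Qed.

Section kernel.
Variable b : R.
Hypothesis b01 : 0 < b < 1.
Let b0 : 0 < b. Proof. by case/andP: b01. Qed.
Let b1 : b < 1. Proof. by case/andP: b01. Qed.

(** Subadditivity of the power: (y - x) / y and x / y add up to 1, and numbers in [0, 1] are at most
    their b-th powers. *)
Lemma pw_holder x y : x < y -> `|pw b y - pw b x| <= (y - x) `^ b.
Proof.
move=> xy; rewrite ger0_norm ?subr_ge0; last by apply: pw_mono; rewrite ?ltW.
have [y0|y0] := ltP 0 y; last by rewrite pw_le0// sub0r (le_trans _ (powR_ge0 _ _))// oppr_le0 pw_ge0.
have [x0|x0] := ltP 0 x; last first.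
  rewrite (pw_le0 b x0) subr0 pwE//; 
  by apply: ge0_ler_powR; rewrite ?nnegrE ?subr_ge0 ?lerDl ?oppr_ge0// ltW.
have w0 : 0 < y - x by rewrite subr_gt0.
rewrite !pwE// lerBlDr.
have h1 : (y - x) / y <= ((y - x) / y) `^ b.
  by apply: ger1_powR; rewrite ?(ltW b1)// divr_gt0//= ler_pdivrMr// mul1r; lra.
have h2 : x / y <= (x / y) `^ b.
  by apply: ger1_powR; rewrite ?(ltW b1)// divr_gt0//= ler_pdivrMr// mul1r; lra.
have E u : 0 <= u -> u `^ b = (u / y) `^ b * y `^ b.
  by move=> u0; rewrite -powRM ?divfK ?(gt_eqF y0) ?divr_ge0 ?(ltW y0).
rewrite (E (y - x) (ltW w0)) (E x (ltW x0)) -mulrDl ler_peMl ?powR_ge0//.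
by apply: le_trans (lerD h1 h2); rewrite -mulrDl subrK divff// gt_eqF.
Qed.

(** The density (t - Z)_+^(b-1) is cut at 1 to become integrable on the line; evaluation at points x
    <= 1 does not see the cut. *)
Lemma integrable_pw0_pw Z : mu.-integrable setT
  (EFin \o (fun t => pw 0 (1 - t) * pw (b - 1) (t - Z))).
Proof.
apply/integrableP; split.
  by apply/measurable_EFinP; apply: measurable_funM; apply: measurable_pw_comp; exact: measurable_funB.
under eq_integral do rewrite /= ger0_norm ?mulr_ge0 ?pw_ge0// mulrC.
by rewrite integral_pw_left// ltry.
Qed.

Lemma Rintegral_pw0_pw x Z : x <= 1 ->
  \int[mu]_t (pw 0 (x - t) * (pw 0 (1 - t) * pw (b - 1) (t - Z))) = pw b (x - Z) / b.
Proof.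
move=> x1; transitivity (\int[mu]_t (pw (b - 1) (t - Z) * pw 0 (x - t))).
  apply: eq_Rintegral => t _; rewrite mulrCA mulrA mulrC.
  have [tx|xt] := ltP t x; last by rewrite [pw 0 (x - t)]pw_le0 ?mulr0// subr_le0.
  by rewrite [pw 0 (1 - t)]pwE ?powRr0 ?mul1r// subr_gt0 (lt_le_trans tx).
by rewrite /Rintegral integral_pw_left.
Qed.

(** For q > 1 the cut at 1 allows q to be lowered to 1, which only enlarges the kernel; the Beta
    integral then bounds the convolution uniformly in q. *)
Lemma integral_conv_pw0_pw q Z :
  (\int[mu]_p (pw (- b) (q - p) * (pw 0 (1 - p) * pw (b - 1) (p - Z)))%:E <= (beta_const b)%:E)%E.
Proof.
apply: (@le_trans _ _ (\int[mu]_p (pw (- b) (Num.min q 1 - p) * pw (b - 1) (p - Z))%:E)%E).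
  apply: ge0_le_integral => //.
  - by move=> t _; rewrite lee_fin !mulr_ge0 ?pw_ge0.
  - apply/measurable_EFinP; apply: measurable_funM; last apply: measurable_funM;
    by apply: measurable_pw_comp; exact: measurable_funB.
  - apply/measurable_EFinP; apply: measurable_funM;
    by apply: measurable_pw_comp; exact: measurable_funB.
  move=> p _; rewrite lee_fin mulrA; apply: ler_wpM2r; first exact: pw_ge0.
  have [p1|p1] := ltP p 1; last by rewrite [pw 0 _]pw_le0 ?mulr0 ?pw_ge0// subr_le0.
  have [pq|pq] := ltP p q; last by rewrite [pw (- b) _]pw_le0 ?mul0r ?pw_ge0// subr_le0.
  rewrite pw0E subr_gt0 p1 mulr1; apply: pw_antimono; rewrite ?(ltW b0) ?subr_gt0 ?lt_min ?p1 ?pq//.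
  by rewrite lerB// ge_min lexx.
by rewrite integral_beta_kernel// lee_fin ler_piMr ?beta_const_ge0 ?pw0_le1.
Qed.

Lemma integrable_conv_pw0_pw q Z : mu.-integrable setT
  (EFin \o (fun p => pw (- b) (q - p) * (pw 0 (1 - p) * pw (b - 1) (p - Z)))).
Proof.
apply/integrableP; split.
  apply/measurable_EFinP; apply: measurable_funM; last apply: measurable_funM;
  by apply: measurable_pw_comp; exact: measurable_funB.
under eq_integral do rewrite /= ger0_norm ?mulr_ge0 ?pw_ge0//.
by apply: le_lt_trans (integral_conv_pw0_pw q Z) _; rewrite ltry.
Qed.

Lemma Rintegral_conv_pw0_pw q Z : q <= 1 ->
  \int[mu]_p (pw (- b) (q - p) * (pw 0 (1 - p) * pw (b - 1) (p - Z))) =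
  beta_const b * pw 0 (q - Z).
Proof.
move=> q1; transitivity (\int[mu]_p (pw (- b) (q - p) * pw (b - 1) (p - Z))).
  apply: eq_Rintegral => p _; rewrite mulrA.
  have [pq|pq] := ltP p q; last by rewrite [pw (- b) _]pw_le0 ?mul0r// subr_le0.
  by rewrite [pw 0 (1 - p)]pwE ?powRr0 ?mulr1// subr_gt0 (lt_le_trans pq).
by rewrite /Rintegral integral_beta_kernel.
Qed.

End kernel.

End truncated_power_sums.

(** * The energy estimate for the error *)

Section energy_estimate.
Context {R : realType}.
Local Notation mu := (@lebesgue_measure R).
Local Notation mu2 := (mu \x mu)%E.

Lemma integrable_mul_primitive (u v : R -> R) :
  mu.-integrable setT (EFin \o u) -> mu.-integrable setT (EFin \o v) ->
  mu.-integrable setT (EFin \o (fun x => u x * \int[mu]_t (pw 0 (x - t) * v t))).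
Proof.
move=> iu iv.
have i2 : mu2.-integrable setT (fun z => (pw 0 (z.1 - z.2) * (u z.1 * v z.2))%:E).
  apply: (@integrable_kernel_prod _ (fun z => pw 0 (z.1 - z.2)) _ _ 1) => //.
    by apply: measurable_pw_comp; exact: measurable_funB.
  by move=> z; rewrite ger0_norm ?pw_ge0// pw0_le1.
have := integrable_fubini_F i2; apply: eq_integrable => // x _.
rewrite /fubini_F /= EFinM fineK; last by apply: integrable_fin_num => //; exact: integrable_pw0M.
rewrite -integralZl//; last exact: integrable_pw0M.
by apply: eq_integral => t _; rewrite /= -EFinM; congr EFin; ring.
Qed.

(** On x < 1, the derivative of the sum of a_i (x - Z_i)_+^b, whence the factor b. *)
Definition spline_density (n : nat) (b : R) (a Z : 'I_n -> R) (x : R) : R :=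
  \sum_(i < n) (b * a i) * (pw 0 (1 - x) * pw (b - 1) (x - Z i)).

Variables (b M : R) (fp : R -> R) (n : nat) (a Z : 'I_n -> R).
Local Notation sp := (spline_density b a Z).

Definition error_density (x : R) : R := fp x - sp x.
Local Notation d := error_density.

(** Taking the primitive of the density as the definition gives a function on the whole line that
    vanishes left of 0 and, once e(1) = 0, right of 1. On [0, 1] it will be f - s. *)
Definition error_fun (x : R) : R := \int[mu]_t (pw 0 (x - t) * d t).
Local Notation e := error_fun.

Hypotheses (b01 : 0 < b < 1) (mfp : measurable_fun setT fp)
  (fpM : forall x, `|fp x| <= M) (fp0 : forall x, ~~ (0 < x < 1) -> fp x = 0)
  (Z0 : forall i, 0 <= Z i).

Let b0 : 0 < b. Proof. by case/andP: b01. Qed.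
Let b1 : b < 1. Proof. by case/andP: b01. Qed.
Let ifp := integrable_bounded_density mfp fpM fp0.
Let isp : mu.-integrable setT (EFin \o sp).
Proof. by apply: integrable_lincomb => i; exact: integrable_pw0_pw. Qed.
Let id_ : mu.-integrable setT (EFin \o d).
Proof.
have := integrableB measurableT ifp isp.
by apply: eq_integrable => // x _; rewrite /= -EFinB.
Qed.
Let d0 x : ~~ (0 < x < 1) -> d x = 0.
Proof.
move=> x01; rewrite /error_density fp0// sub0r /spline_density big1 ?oppr0// => i _.
have [x0|x0] := leP x 0.
  by rewrite [pw (b - 1) _]pw_le0 ?mulr0// subr_le0 (le_trans x0).
by rewrite [pw 0 _]pw_le0 ?mul0r ?mulr0// subr_le0 leNgt; move: x01; rewrite x0.
Qed.

Lemma primitive_spline_density x : x <= 1 ->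
  \int[mu]_t (pw 0 (x - t) * sp t) = \sum_(i < n) a i * pw b (x - Z i).
Proof.
move=> x1.
transitivity (\int[mu]_t (\sum_(i < n) (b * a i) *
   (pw 0 (x - t) * (pw 0 (1 - t) * pw (b - 1) (t - Z i))))).
  by apply: eq_Rintegral => t _; rewrite mulr_sumr; apply: eq_bigr => i _; rewrite mulrCA.
rewrite Rintegral_lincomb => [|i]; last by apply: integrable_pw0M; exact: integrable_pw0_pw.
apply: eq_bigr => i _; rewrite Rintegral_pw0_pw//.
by field; rewrite gt_eqF.
Qed.

Lemma error_primitive x : x <= 1 ->
  e x = \int[mu]_t (pw 0 (x - t) * fp t) - \sum_(i < n) a i * pw b (x - Z i).
Proof.
move=> x1; rewrite -primitive_spline_density// -RintegralB//; last 2 first.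
- exact: integrable_pw0M.
- exact: integrable_pw0M.
by apply: eq_Rintegral => t _; rewrite -mulrBr.
Qed.

(** The part from [fp] is Lipschitz with constant M, hence b-Hölder since y - x <= 1; each truncated
    power is b-Hölder with constant 1. *)
Lemma error_holder x y : 0 <= x -> x < y -> y <= 1 ->
  `|e y - e x| <= (M + \sum_(i < n) `|a i|) * (y - x) `^ b.
Proof.
move=> x0 xy y1; have M0 : 0 <= M by apply: le_trans (fpM 0); exact: normr_ge0.
rewrite !error_primitive ?(le_trans (ltW xy))//.
set F := fun x => \int[mu]_t (pw 0 (x - t) * fp t).
set S := fun x => \sum_(i < n) a i * pw b (x - Z i).
rewrite -/(F y) -/(F x) -/(S y) -/(S x) mulrDl.
rewrite (_ : F y - S y - (F x - S x) = (F y - F x) - (S y - S x)); last by ring.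
rewrite (le_trans (ler_normD _ _))// normrN; apply: lerD.
  rewrite /F -Rintegral_pw0_itv ?(ltW xy)//.
  apply: (@le_trans _ _ (\int[mu]_p (M * (pw 0 (p - x) * pw (- 0) (y - p))))).
    apply: le_norm_Rintegral.
    - have := integrable_pw0M' x (integrable_pw0M y ifp).
      by apply: eq_integrable => // t _ /=; rewrite mulrA.
    - have := integrableZl measurableT M (@integrable_pw_right R 0 x y ltr01).
      by apply: eq_integrable => // t _.
    move=> p; rewrite oppr0 normrM ger0_norm ?mulr_ge0 ?pw_ge0// mulrC.
    by apply: ler_wpM2r; rewrite ?mulr_ge0 ?pw_ge0.
  rewrite RintegralZl//; last exact: integrable_pw_right.
  rewrite Rintegral_pw_right// subr0 divr1 pwE ?subr_gt0// powRr1 ?subr_ge0 ?(ltW xy)//.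
  apply: ler_wpM2l => //; apply: ger1_powR; rewrite ?(ltW b1)// subr_gt0 xy/=; lra.
rewrite /S -sumrB mulr_suml (le_trans (ler_norm_sum _ _ _))//.
apply: ler_sum => i _; rewrite -mulrBr normrM; apply: ler_wpM2l => //.
have -> : y - x = y - Z i - (x - Z i) by ring.
by apply: pw_holder => //; rewrite ltrD2r.
Qed.

Lemma conv_error q : q <= 1 -> \int[mu]_p (pw (- b) (q - p) * d p) =
  density_conv b fp q - \sum_(i < n) (b * a i) * (beta_const b * pw 0 (q - Z i)).
Proof.
move=> q1.
transitivity (\int[mu]_p (pw (- b) (q - p) * fp p - \sum_(i < n) (b * a i) *
   (pw (- b) (q - p) * (pw 0 (1 - p) * pw (b - 1) (p - Z i))))).
  apply: eq_Rintegral => p _; rewrite mulrBr; congr (_ - _).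
  by rewrite mulr_sumr; apply: eq_bigr => i _; rewrite mulrCA.
rewrite RintegralB//; last 2 first.
- exact: integrable_density_pw mfp fpM fp0 _.
- by apply: integrable_lincomb => i; exact: integrable_conv_pw0_pw.
rewrite Rintegral_lincomb => [|i]; last exact: integrable_conv_pw0_pw.
by congr (_ - _); apply: eq_bigr => i _; rewrite Rintegral_conv_pw0_pw.
Qed.

(** Only finiteness and uniformity in q count: this bound licenses the energy identity, and its
    dependence on the coefficients does not reach the estimate. *)
Lemma integral_conv_error_le q :
  (\int[mu]_p (pw (- b) (q - p) * `|d p|)%:E <=
   (M / (1 - b) + \sum_(i < n) `|b * a i| * beta_const b)%:E)%E.
Proof.
have iS : mu.-integrable setT (EFin \o (fun p => \sum_(i < n) `|b * a i| *
   (pw (- b) (q - p) * (pw 0 (1 - p) * pw (b - 1) (p - Z i))))).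
  by apply: integrable_lincomb => i; exact: integrable_conv_pw0_pw.
have iF : mu.-integrable setT (EFin \o (fun p => pw (- b) (q - p) * `|fp p|)).
  have := integrable_norm (integrable_density_pw b01 mfp fpM fp0 q).
  by apply: eq_integrable => // p _ /=; rewrite normrM ger0_norm ?pw_ge0.
have md : measurable_fun setT d by apply/measurable_EFinP; exact: measurable_int id_.
have mS : measurable_fun setT (fun p : R => \sum_(i < n) `|b * a i| *
   (pw (- b) (q - p) * (pw 0 (1 - p) * pw (b - 1) (p - Z i)))).
  by apply/measurable_EFinP; exact: measurable_int iS.
have mF : measurable_fun setT (fun p : R => pw (- b) (q - p) * `|fp p|).
  by apply/measurable_EFinP; exact: measurable_int iF.
have S0 p : 0 <= \sum_(i < n) `|b * a i| *
   (pw (- b) (q - p) * (pw 0 (1 - p) * pw (b - 1) (p - Z i))).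
  by apply: sumr_ge0 => i _; rewrite !mulr_ge0 ?pw_ge0.
apply: (@le_trans _ _ (\int[mu]_p ((pw (- b) (q - p) * `|fp p|)%:E + (\sum_(i < n) `|b * a i| *
   (pw (- b) (q - p) * (pw 0 (1 - p) * pw (b - 1) (p - Z i))))%:E))%E).
  apply: ge0_le_integral => //.
  - by move=> p _; rewrite lee_fin mulr_ge0 ?pw_ge0.
  - apply/measurable_EFinP; apply: measurable_funM; last exact: measurableT_comp.
    by apply: measurable_pw_comp; exact: measurable_funB.
  - by apply: emeasurable_funD; exact/measurable_EFinP.
  move=> p _; rewrite -EFinD lee_fin.
  apply: (le_trans (ler_wpM2l (pw_ge0 _ _) (ler_normB _ _))); rewrite mulrDr lerD2l.
  apply: (le_trans (ler_wpM2l (pw_ge0 _ _) (ler_norm_sum _ _ _))).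
  rewrite mulr_sumr; apply: ler_sum => i _; rewrite normrM mulrCA; apply: ler_wpM2l => //.
  by rewrite ger0_norm ?mulr_ge0 ?pw_ge0.
rewrite ge0_integralD//; last 4 first.
- by move=> p _; rewrite lee_fin mulr_ge0 ?pw_ge0.
- exact/measurable_EFinP.
- by move=> p _; rewrite lee_fin.
- exact/measurable_EFinP.
rewrite EFinD; apply: leeD; first exact: integral_density_pw_le.
have -> : (\int[mu]_p (\sum_(i < n) `|b * a i| *
   (pw (- b) (q - p) * (pw 0 (1 - p) * pw (b - 1) (p - Z i))))%:E)%E =
  (\int[mu]_p (\sum_(i < n) `|b * a i| *
   (pw (- b) (q - p) * (pw 0 (1 - p) * pw (b - 1) (p - Z i)))))%:E.
  rewrite /Rintegral fineK//; exact: integrable_fin_num.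
rewrite Rintegral_lincomb => [|i]; last exact: integrable_conv_pw0_pw.
rewrite lee_fin; apply: ler_sum => i _; apply: ler_wpM2l => //.
rewrite -lee_fin /Rintegral fineK; first exact: integral_conv_pw0_pw.
by apply: integrable_fin_num => //; exact: integrable_conv_pw0_pw.
Qed.

Let dI : e 1 = 0 -> \int[mu]_t d t = 0.
Proof.
move=> e1; rewrite -e1; apply: eq_Rintegral => t _; rewrite pw0E subr_gt0.
by case: (boolP (t < 1)) => t1; rewrite ?mul1r// mul0r d0// (negbTE t1) andbF.
Qed.

Lemma error_out x : e 1 = 0 -> ~~ (0 < x < 1) -> e x = 0.
Proof.
move=> e1 x01; have [x0|x0] := leP x 0.
  rewrite /error_fun /Rintegral integral0_eq// => t _; congr EFin.
  have [t0|t0] := ltP 0 t; last by rewrite d0 ?mulr0// ltNge t0.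
  by rewrite pw_le0 ?mul0r// subr_le0 (le_trans x0)// ltW.
rewrite -(dI e1); apply: eq_Rintegral => t _; rewrite pw0E subr_gt0.
have [tx|xt] := ltP t x; first by rewrite mul1r.
by rewrite mul0r d0// negb_and -!leNgt (le_trans _ xt) ?orbT//; move: x01; rewrite x0/= -leNgt.
Qed.

Lemma measurable_error : e 1 = 0 -> measurable_fun setT e.
Proof.
move=> e1.
have -> : e = (e \_ `]0, 1[)%classic.
  apply/funext => x; rewrite patchE mem_setE in_itv/=; case: ifPn => // x01.
  exact: error_out.
apply/(measurable_restrictT _ (measurable_itv _)).
apply: open_continuous_measurable_fun; first exact: interval_open.
move=> q; rewrite inE/= in_itv/= => q01.
by apply: continuous_primitive => // x x0; rewrite d0// ltNge x0.
Qed.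

(** The constant [k0] meets the integral of d, which is e(1) = 0. A jump at Z_i meets the integral
    of d beyond Z_i, which is - e(Z_i) = 0. Fubini turns the remaining term into an integral of g
    against the same tails of d. *)
Lemma integral_error_conv (A k0 : R) (g : R -> R) :
  mu.-integrable setT (EFin \o g) -> (forall x, ~~ (0 < x < 1) -> g x = 0) ->
  (forall q, 0 < q < 1 -> density_conv b fp q = k0 + A * \int[mu]_p (pw 0 (q - p) * g p)) ->
  e 1 = 0 -> (forall i, e (Z i) = 0) ->
  \int[mu]_q (d q * \int[mu]_p (pw (- b) (q - p) * d p)) = - (A * \int[mu]_x (g x * e x)).
Proof.
move=> ig g0 hA e1 eZ.
have tail t : \int[mu]_x (pw 0 (x - t) * d x) = - e t.
  by apply/eqP; rewrite -addr_eq0 addrC; apply/eqP; rewrite Rintegral_pw0_split// dI.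
pose G q := \int[mu]_p (pw 0 (q - p) * g p).
have iG : mu.-integrable setT (EFin \o (fun q => d q * G q)).
  exact: integrable_mul_primitive.
pose L q := \sum_(i < n) (b * a i * beta_const b) * (pw 0 (q - Z i) * d q).
have iL : mu.-integrable setT (EFin \o L).
  by apply: integrable_lincomb => i; exact: integrable_pw0M'.
transitivity (\int[mu]_q (k0 * d q + A * (d q * G q) - L q)).
  apply: eq_Rintegral => q _.
  have [q01|q01] := boolP (0 < q < 1); last first.
    rewrite /L d0// !mul0r !mulr0 big1 ?subr0 ?addr0// => i _.
    by rewrite mulr0 mulr0.
  rewrite conv_error ?hA//; last by case/andP: q01 => _ /ltW.
  rewrite /L mulrBr mulrDr [d q * k0]mulrC [d q * (A * _)]mulrCA mulr_sumr; congr (_ - _).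
  by apply: eq_bigr => i _; ring.
have ik : mu.-integrable setT (EFin \o (fun q => k0 * d q)).
  by have := integrableZl measurableT k0 id_; apply: eq_integrable => // q _.
have iAG : mu.-integrable setT (EFin \o (fun q => A * (d q * G q))).
  by have := integrableZl measurableT A iG; apply: eq_integrable => // q _.
rewrite RintegralB//; last first.
  by have := integrableD measurableT ik iAG; apply: eq_integrable => // q _.
rewrite RintegralD// RintegralZl// dI// mulr0 add0r RintegralZl//.
have -> : \int[mu]_q L q = 0.
  rewrite Rintegral_lincomb => [|i]; last exact: integrable_pw0M'.
  by rewrite big1// => i _; rewrite tail eZ oppr0 mulr0.
rewrite subr0 -mulrN; congr (_ * _).
rewrite (Rintegral_triangleC id_ ig) -mulN1r -RintegralZl//; last first.
  exact: integrable_mul_primitive.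
by apply: eq_Rintegral => t _; rewrite tail mulN1r mulrN.
Qed.

Lemma error_estimate (A k0 delta : R) (g : R -> R) (N : nat) (X : 'I_N -> R) :
  mu.-integrable setT (EFin \o g) -> (forall x, ~~ (0 < x < 1) -> g x = 0) ->
  (forall q, 0 < q < 1 -> density_conv b fp q = k0 + A * \int[mu]_p (pw 0 (q - p) * g p)) ->
  e 1 = 0 -> (forall i, e (Z i) = 0) ->
  (forall j, 0 < X j) -> (forall j, e (X j) = 0) ->
  (forall l r, 0 <= l -> l < r -> r <= 1 -> (forall j, ~ (l < X j < r)) -> r - l <= delta) ->
  (\int[mu]_x (pw 0 x * pw 0 (1 - x) * e x ^+ 2)%:E <=
   (2 * (1 + b) * (2 + b) / b ^+ 2 * delta `^ (1 + b) *
    (2 / (b * (b + 1)) * - (A * \int[mu]_x (g x * e x))))%:E)%E.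
Proof.
move=> ig g0 hA e1 eZ X0 eX gap.
have me := measurable_error e1.
have e0 : e 0 = 0 by apply: error_out; rewrite // ltxx.
apply: (le_trans (gaps_hardy b0 me error_holder X0 e0 eX gap)).
rewrite [leRHS]EFinM; apply: lee_wpmul2l.
  by rewrite lee_fin mulr_ge0 ?powR_ge0// divr_ge0 ?sqr_ge0// !mulr_ge0 ?addr_ge0// ltW.
rewrite -(integral_error_conv ig g0 hA e1 eZ).
rewrite -(energy_identity b0 id_ integral_conv_error_le).
have mE : measurable_fun setT (fun z : R * R => pw (- b - 2) (z.2 - z.1) * (e z.2 - e z.1) ^+ 2).
  apply: measurable_funM.
    by apply: measurable_pw_comp; exact: measurable_funB.
  by apply: measurable_funX; apply: measurable_funB; exact: measurableT_comp.
have -> : (\int[mu2]_z (pw (- b - 2) (z.2 - z.1) *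
    (\int[mu]_p (pw 0 (p - z.1) * pw 0 (z.2 - p) * d p)) ^+ 2)%:E =
    \int[mu2]_z (pw (- b - 2) (z.2 - z.1) * (e z.2 - e z.1) ^+ 2)%:E)%E.
  apply: eq_integral => z _; congr EFin.
  have [z12|z21] := ltP z.1 z.2; last by rewrite pw_le0 ?mul0r// subr_le0.
  by rewrite Rintegral_pw0_itv// ltW.
(* The Hardy bound involves 0 < t < x < 1 only, the energy identity the whole plane. *)
apply: ge0_le_integral => //.
- move=> z _; rewrite lee_fin; apply: mulr_ge0; first by rewrite mulr_ge0 ?pw_ge0.
  by apply: mulr_ge0; rewrite ?pw_ge0 ?sqr_ge0.
- apply/measurable_EFinP; apply: measurable_funM => //.
  apply: measurable_funM; apply: measurable_pw_comp => //; exact: measurable_funB.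
- exact/measurable_EFinP.
move=> z _; rewrite lee_fin; apply: ler_piMl; first by apply: mulr_ge0; rewrite ?pw_ge0 ?sqr_ge0.
by rewrite mulr_ile1 ?pw_ge0 ?pw0_le1.
Qed.

End energy_estimate.

(** * The interpolant as a sum of truncated powers, and L^2 norms *)

Section interpolation_error.
Context {R : realType}.
Local Notation mu := (@lebesgue_measure R).

Lemma pw_powR (b x : R) : b != 0 -> 0 <= x -> pw b x = x `^ b.
Proof.
move=> b0; rewrite le_eqVlt => /predU1P[<-|/pwE//].
by rewrite pw_le0// powR0.
Qed.

(* On [0, 1] the interpolant is a combination of the truncated powers
   [(x - z)_+^b] with [z] among 0 and the nodes; 0 gets the index [ord0]. *)
Definition spline_coef (N : nat) (b : R) (X c : 'I_N -> R) (i : 'I_N.+1) : R :=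
  if unlift ord0 i is Some j then - c j else \sum_(j < N) c j * (1 - X j) `^ b.

Definition spline_node (N : nat) (X : 'I_N -> R) (i : 'I_N.+1) : R :=
  if unlift ord0 i is Some j then X j else 0.

(** Up to 1 / Gamma(alpha), both branches of the kernel read x^b (1 - z)^b - (x - z)_+^b with b =
    alpha - 1; the first terms gather into the coefficient of the node 0. *)
Lemma interpolantE (alpha : R) (N : nat) (X c : 'I_N -> R) (x : R) :
  1 < alpha -> (forall j, 0 < X j < 1) -> 0 <= x <= 1 ->
  interpolant alpha X c x = \sum_(i < N.+1)
    ((Gamma alpha)^-1 * spline_coef (alpha - 1) X c i) * pw (alpha - 1) (x - spline_node X i).
Proof.
move=> a1 X01 /andP[x0 x1].
have a0 : alpha - 1 != 0 by rewrite gt_eqF// subr_gt0.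
rewrite big_ord_recl /spline_coef /spline_node unlift_none subr0.
under [X in _ + X]eq_bigr do rewrite liftK.
rewrite mulr_sumr mulr_suml -big_split; apply: eq_bigr => j _ /=.
have /andP[Xj0 Xj1] := X01 j; rewrite /RL_Green.
have [Xx|xX] := leP (X j) x.
  rewrite powRM ?subr_ge0 ?(ltW Xj1)// !pw_powR ?subr_ge0//; ring.
by rewrite [pw _ (x - _)]pw_le0 ?subr_le0 ?(ltW xX)// pw_powR//; ring.
Qed.

Lemma interpolant1 (alpha : R) (N : nat) (X c : 'I_N -> R) :
  (forall j, 0 < X j < 1) -> interpolant alpha X c 1 = 0.
Proof.
move=> X01; rewrite /interpolant big1// => j _; have /andP[_ /ltW Xj1] := X01 j.
by rewrite /RL_Green Xj1 mul1r subrr !mulr0.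
Qed.

Lemma RL_integral_density (alpha : R) (f fp : R -> R) (x : R) :
  1 < alpha -> (forall x, ~~ (0 < x < 1) -> fp x = 0) ->
  (forall x : R, 0 <= x <= 1 -> f x = \int[mu]_t (pw 0 (x - t) * fp t)) -> 0 < x < 1 ->
  RL_integral alpha f x = (Gamma (2 - alpha))^-1 *
    \int[mu]_y (pw (- (alpha - 1)) (x - y) * \int[mu]_t (pw 0 (y - t) * fp t)).
Proof.
move=> a1 fp0 fE /andP[x0 x1]; congr (_ * _).
rewrite Rintegral_mkcond; apply: eq_Rintegral => y _.
rewrite patchE mem_setE in_itv/=.
have [y0|y0] := leP 0 y; last first.
  suff -> : \int[mu]_t (pw 0 (y - t) * fp t) = 0 by rewrite mulr0.
  rewrite /Rintegral integral0_eq// => t _; congr EFin.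
  have [t0|t0] := ltP 0 t; last by rewrite fp0 ?mulr0// ltNge t0.
  by rewrite pw_le0 ?mul0r// subr_le0 ltW// (lt_trans y0).
have [yx|xy] := leP y x; last by rewrite pw_le0 ?mul0r// subr_le0 ltW.
rewrite fE ?y0 ?(le_trans yx) ?(ltW x1)// opprB pw_powR ?subr_ge0//.
by rewrite lt_eqF// subr_lt0.
Qed.

Lemma L2norm_sqr (u : R -> R) :
  (Lnorm mu 2%:E (EFin \o u) `^ 2 = \int[mu]_x (u x ^+ 2)%:E)%E.
Proof.
rewrite powR_Lnorm//; apply: eq_integral => x _ /=.
by rewrite powR_mulrn// real_normK// num_real.
Qed.

(** The weak derivative is known to be measurable on the open interval only, while the norm is taken
    on [0, 1]. *)
Lemma L2norm01_restrict (u : R -> R) : measurable_fun (`]0, 1[%classic : set R) u ->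
  (Lnorm mu 2%:E (EFin \o (u \_ `]0%R, 1%R[)) <= L2norm01 u)%E.
Proof.
move=> mu_; rewrite /L2norm01 unlock.
have m1 : measurable_fun setT (u \_ `]0, 1[).
  exact/(measurable_restrictT _ (measurable_itv _)).
have m2 : measurable_fun setT (u \_ `[0, 1]).
  apply/(measurable_restrictT _ (measurable_itv _)).
  by apply/measurable_fun_itv_bndo_bndcP/measurable_fun_itv_obnd_cbndP.
have mp (v : R -> R) : measurable_fun setT v ->
    measurable_fun setT (fun x => `|(EFin \o v) x| `^ 2)%E.
  move=> mv; apply: (measurableT_comp (measurable_poweR _)) => //.
  by apply: measurableT_comp => //; exact/measurable_EFinP.
apply: gt0_ler_poweR => //.
- by rewrite in_itv/= leey integral_ge0// => x _; exact: poweR_ge0.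
- by rewrite in_itv/= leey integral_ge0// => x _; exact: poweR_ge0.
apply: ge0_le_integral => //.
- by move=> x _; exact: poweR_ge0.
- exact: mp.
- exact: mp.
move=> x _; rewrite /= lee_fin !patchE !mem_setE !in_itv/=.
case: ifPn => [/andP[x0 x1]|_]; first by rewrite (ltW x0) (ltW x1).
by rewrite [X in `|X|](_ : _ = 0)// normr0 powR0// powR_ge0.
Qed.

(** On (0, 1) one has |u| <= 1 + u^2. *)
Lemma L2norm_integrable (u : R -> R) : measurable_fun setT u ->
  (forall x, ~~ (0 < x < 1) -> u x = 0) -> (Lnorm mu 2%:E (EFin \o u) < +oo)%E ->
  mu.-integrable setT (EFin \o u).
Proof.
move=> mu_ u0 uoo; apply/integrableP; split; first exact/measurable_EFinP.
have m1 : measurable_fun setT (fun x : R => pw 0 (x - 0) * pw 0 (1 - x)).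
  by apply: measurable_funM; apply: measurable_pw_comp; exact: measurable_funB.
have m2 : measurable_fun setT (fun x : R => u x ^+ 2) by exact: measurable_funX.
apply: (@le_lt_trans _ _ (\int[mu]_x ((pw 0 (x - 0) * pw 0 (1 - x))%:E + (u x ^+ 2)%:E))%E).
  apply: ge0_le_integral => //.
  - by apply: measurableT_comp => //; exact/measurable_EFinP.
  - by apply: emeasurable_funD; exact/measurable_EFinP.
  move=> x _; rewrite -EFinD lee_fin.
  have [/andP[x0 x1]|/u0 ->] := boolP (0 < x < 1); last first.
    by rewrite normr0 expr2 mul0r addr0 mulr_ge0 ?pw_ge0.
  rewrite subr0 !pw0E subr_gt0 x0 x1 mulr1 -real_normK ?num_real//.
  have := normr_ge0 (u x); set t : R := `|u x|.
  rewrite (_ : true%:R = 1 :> R)//; have := sqr_ge0 (t - 1); clear; nra.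
rewrite ge0_integralD//; last 4 first.
- by move=> x _; rewrite lee_fin mulr_ge0 ?pw_ge0.
- exact/measurable_EFinP.
- by move=> x _; rewrite lee_fin sqr_ge0.
- exact/measurable_EFinP.
have := @integral_pw_left R 1 0 1; rewrite subrr => -> //.
by rewrite -L2norm_sqr lte_add_pinfty ?ltry// poweR_lty.
Qed.

Lemma le_Rintegral_mul_L2norm (u v : R -> R) : measurable_fun setT u -> measurable_fun setT v ->
  (Lnorm mu 2%:E (EFin \o u) < +oo)%E -> (Lnorm mu 2%:E (EFin \o v) < +oo)%E ->
  `|\int[mu]_x (u x * v x)| <= fine (Lnorm mu 2%:E (EFin \o u)) * fine (Lnorm mu 2%:E (EFin \o v)).
Proof.
move=> mu_ mv uoo voo.
have H : (2^-1 + 2^-1 = 1 :> R)%R by lra.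
have h : (\int[mu]_x `|(u x * v x)%:E| <=
    (fine (Lnorm mu 2%:E (EFin \o u)) * fine (Lnorm mu 2%:E (EFin \o v)))%:E)%E.
  rewrite EFinM !fineK ?ge0_fin_numE ?Lnorm_ge0//.
  have := hoelder mu mu_ mv (ltr0n R 2) (ltr0n R 2) H; rewrite Lnorm1; exact.
have iuv : mu.-integrable setT (EFin \o (fun x => u x * v x)).
  apply/integrableP; split; last by apply: le_lt_trans h _; rewrite ltry.
  by apply/measurable_EFinP; exact: measurable_funM.
apply: (le_trans (le_normr_Rintegral measurableT iuv)).
rewrite -lee_fin /Rintegral fineK; first exact: h.
exact: (integrable_fin_num measurableT (integrable_norm iuv)).
Qed.

End interpolation_error.

Theorem theorem4p1 (R : realType) (alpha : R) (halpha : 1 < alpha < 2) :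
  exists C3 : R, 0 < C3 /\
    forall (N : nat) (X : 'I_N -> R) (f f' : R -> R) (c : 'I_N -> R),
      (0 < N)%N ->
      injective X ->
      (forall j, 0 < X j < 1) ->
      C1_with_derivative f f' ->
      f 0 = 0 -> f 1 = 0 -> f' 0 = 0 ->
      (forall i, interpolant alpha X c (X i) = f (X i)) ->
      forall g : R -> R, is_RL_derivative alpha f g ->
      (L2norm01 (fun x => f x - interpolant alpha X c x)%R
         <= (C3 * fill_distance X `^ alpha)%:E * L2norm01 g)%E.
Proof.
have /andP[a1 a2] := halpha; pose b := alpha - 1; pose A := Gamma (2 - alpha).
have b0 : 0 < b by rewrite subr_gt0.
have b1 : b < 1 by rewrite /b; lra.
have b01 : 0 < b < 1 by rewrite b0.
have A0 : 0 < A by apply: Gamma_gt0; lra.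
(* The factors come from the Hardy inequality, from gaps of length at most 2 h (the power of 2),
   from the energy identity and from Gamma(2 - alpha). *)
pose K := 2 * (1 + b) * (2 + b) / b ^+ 2 * 2 `^ alpha * (2 / (b * (b + 1))) * A.
have K0 : 0 < K.
  rewrite /K; move: (A) (b) A0 b0 => A' b' A0 b0.
  by rewrite !(mulr_gt0, invr_gt0, powR_gt0, exprn_gt0, addr_gt0)//.
exists K; split => // N X f f' c N0 _ X01 ff' f0 f1 _ fX g [[mg _ _] wg].
have h0 := fill_distance_gt0 N0 X01; set h := fill_distance X in h0 *.
(* If the norm of [g] is infinite, so is the right side, because h > 0. *)
have [gy|] := eqVneq (L2norm01 g) +oo%E.
  by rewrite gy gt0_muley ?leey// lte_fin mulr_gt0// powR_gt0.
rewrite -ltey => goo.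
pose g1 := (g \_ `]0, 1[)%classic.
have ng := le_lt_trans (L2norm01_restrict mg) goo.
have mg1 : measurable_fun setT g1 by exact/(measurable_restrictT _ (measurable_itv _)).
have g10 x : ~~ (0 < x < 1) -> g1 x = 0.
  by move=> /negbTE x01; rewrite /g1 patchE mem_setE in_itv/= x01.
have ig1 := L2norm_integrable mg1 g10 ng.
have [M [fp [mfp fpM fp0 fE]]] := C1_density ff' f0.
have [k0 hk] : exists k0, forall q, 0 < q < 1 ->
    density_conv b fp q = k0 + A * \int[lebesgue_measure]_p (pw 0 (q - p) * g1 p).
  apply: (weak_derivative_density b01 mfp fpM fp0 A0 ig1 g10) => phi tphi.
  have := wg phi tphi => {}wg.
  transitivity (\int[lebesgue_measure]_(x in `]0, 1[) (RL_integral alpha f x * derive1n 2 phi x)).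
    apply: eq_Rintegral => x; rewrite inE/= in_itv/= => x01.
    by rewrite (RL_integral_density a1 fp0 fE x01).
  rewrite wg; apply: eq_Rintegral => x; rewrite inE/= in_itv/= => x01.
  by rewrite /g1 patchE mem_setE in_itv/= x01.
pose a i := (Gamma alpha)^-1 * spline_coef b X c i.
pose Z := spline_node X.
have Z0 i : 0 <= Z i.
  by rewrite /Z /spline_node; case: unliftP => [j _|//]; have /andP[/ltW] := X01 j.
pose e := error_fun b fp a Z.
pose s := interpolant alpha X c.
have eE x : 0 <= x <= 1 -> e x = f x - s x.
  move=> x01; have /andP[_ x1] := x01.
  by rewrite /e (error_primitive a Z b01 mfp fpM fp0 x1) -fE// /s interpolantE.
have eX j : e (X j) = 0.
  have /andP[Xj0 Xj1] := X01 j.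
  by rewrite eE ?ltW// /s fX subrr.
have e1 : e 1 = 0 by rewrite eE ?ler01 ?lexx// f1 /s interpolant1// subrr.
have eout x : ~~ (0 < x < 1) -> e x = 0 by exact: error_out.
have e0 : e 0 = 0 by apply: eout; rewrite ltxx.
have eZ i : e (Z i) = 0 by rewrite /Z /spline_node; case: unliftP.
have X0 j : 0 < X j by case/andP: (X01 j).
have gap l r : 0 <= l -> l < r -> r <= 1 -> (forall j, ~ (l < X j < r)) -> r - l <= 2 * h.
  exact: gap_le_fill_distance.
have := error_estimate b01 mfp fpM fp0 Z0 ig1 g10 hk e1 eZ X0 eX gap.
have me := measurable_error b01 mfp fpM fp0 Z0 e1.
have es : L2norm01 (fun x => f x - s x) = Lnorm lebesgue_measure 2%:E (EFin \o e).
  rewrite /L2norm01; congr (Lnorm _ _ _); apply/funext => x /=; congr EFin.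
  rewrite patchE mem_setE in_itv/=; case: ifPn => [/eE->//|x01].
  by rewrite eout//; apply: contra x01 => /andP[x0 x1]; rewrite (ltW x0) (ltW x1).
rewrite es.
have -> : (\int[lebesgue_measure]_x (pw 0 x * pw 0 (1 - x) * e x ^+ 2)%:E =
    \int[lebesgue_measure]_x (e x ^+ 2)%:E)%E.
  apply: eq_integral => x _; congr EFin; rewrite !pw0E subr_gt0.
  have [/andP[-> ->]|/eout ->] := boolP (0 < x < 1); first by rewrite !mul1r.
  by rewrite expr2 mul0r mulr0.
rewrite -L2norm_sqr => H.
set ne := Lnorm _ _ _ in H *.
have ne0 : (0 <= ne)%E by exact: Lnorm_ge0.
(* The right side of [H] is a real number, so the norm of [e] is finite. *)
have noo : (ne < +oo)%E.
  rewrite ltey; apply/eqP => ney; move: H; rewrite ney poweRyr//.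
have := le_Rintegral_mul_L2norm mg1 me ng noo.
have ngf : Lnorm lebesgue_measure 2%:E (EFin \o g1) \is a fin_num.
  by rewrite ge0_fin_numE// Lnorm_ge0.
have nef : ne \is a fin_num by rewrite ge0_fin_numE.
rewrite -/e -/ne => cs; rewrite -/e in H.
have C0 : 0 <= K * h `^ alpha by rewrite mulr_ge0 ?powR_ge0// ltW.
suff S : fine ne <= K * h `^ alpha * fine (Lnorm lebesgue_measure 2%:E (EFin \o g1)).
  have C0' : (0 <= (K * h `^ alpha)%:E)%E by rewrite lee_fin.
  apply: le_trans (lee_wpmul2l C0' (L2norm01_restrict mg)).
  by rewrite -(fineK nef) -(fineK ngf) -EFinM lee_fin.
rewrite -(fineK nef) poweR_EFin lee_fin powR_mulrn ?fine_ge0// in H.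
have x0 : 0 <= fine ne by rewrite fine_ge0.
move: cs x0 H; set x := fine ne; set y := fine _; set I := Rintegral _ _ _ => cs x0 H.
(* With x and y the norms of e and g, the pairing is at most y x in absolute value; one factor x
   then cancels unless x = 0. *)
have {}H : x ^+ 2 <= K * h `^ alpha * (y * x).
  apply: le_trans (ler_wpM2l C0 cs); apply: (le_trans H).
  have -> : (2 * h) `^ (1 + b) = 2 `^ alpha * h `^ alpha.
    by rewrite powRM ?(ltW h0)// /b addrC subrK.
  rewrite (_ : _ * _ = K * h `^ alpha * - I); last by rewrite /K; ring.
  by apply: ler_wpM2l => //; rewrite -normrN ler_norm.
have [x00|xN0] := eqVneq x 0.
  by rewrite x00 mulr_ge0// /y fine_ge0// Lnorm_ge0.
have xp : 0 < x by rewrite lt_def xN0.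
by rewrite -(ler_pM2r xp); move: H; rewrite expr2 !mulrA.
Qed.
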